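(* Let $\mathcal{F}_{nn}$ be the class of depth-$d$ neural networks with parameters in a given parameter set ($\mathcal{W}_F$ or $\mathcal{W}_{1,\infty}$), whose activation functions satisfy Assumptions A and B of the context, and let $\mathbf{x}_1,\dots,\mathbf{x}_n\in\mathbb{R}^h$ be i.i.d. random samples generated by an unbounded-support sub-Gaussian distribution $\mu\in\mathcal{P}_{uB}$. Then: (I) If the parameter set is $\mathcal{W}_F$ and the activation functions satisfy $\sigma_i(\alpha x)=\alpha\sigma_i(x)$ for all $\alpha>0$ and $x\in\mathbb{R}$, then $$\mathcal{R}_n(\mathcal{F}_{nn},\mu)\le\frac{\Gamma_{uB}\prod_{i=1}^dM_F(i)\prod_{i=1}^{d-1}L_i\sqrt{6d\log2+5h/4}}{\sqrt n}.$$ (II) If the parameter set is $\mathcal{W}_{1,\infty}$ and each activation function satisfies $\sigma_i(0)=0$, then $$\mathcal{R}_n(\mathcal{F}_{nn},\mu)\le\frac{\sqrt2\,\Gamma_{uB}\prod_{i=1}^dM_{1,\infty}(i)\prod_{i=1}^{d-1}L_i\sqrt{d\log2+\log h}}{\sqrt n}.$$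
   Context: Fix integers $h\ge1$ (input dimension), $d\ge2$ (depth), layer widths $k_1=h,k_2,\dots,k_d\ge1$, and sample size $n\ge1$. For a matrix $\mathbf{W}$, $\|\mathbf{W}\|_F$ is the Frobenius norm and $\|\mathbf{W}\|_{1,\infty}$ is the maximal $\ell_1$ norm of its rows; $\|\cdot\|$ on vectors is the $\ell_2$ norm and $\|\cdot\|_1$ the $\ell_1$ norm. $\log$ is the natural logarithm. Networks: a depth-$d$ neural network is a function $f:\mathbb{R}^h\to\mathbb{R}$, $f(\mathbf{x})=\mathbf{w}_d^T\sigma_{d-1}(\mathbf{W}_{d-1}\sigma_{d-2}(\cdots\sigma_1(\mathbf{W}_1\mathbf{x})))$, where $\mathbf{W}_i\in\mathbb{R}^{k_{i+1}\times k_i}$ for $i=1,\dots,d-1$, $\mathbf{w}_d\in\mathbb{R}^{k_d}$, and the scalar activation functions $\sigma_i:\mathbb{R}\to\mathbb{R}$ (fixed) are applied entrywise. Given positive constants $M_F(i)$, $M_{1,\infty}(i)$, $i=1,\dots,d$, the parameter sets are: $\mathcal{W}_F$, all $(\mathbf{W}_1,\dots,\mathbf{W}_{d-1},\mathbf{w}_d)$ with $\|\mathbf{W}_i\|_F\le M_F(i)$ for $i\le d-1$ and $\|\mathbf{w}_d\|\le M_F(d)$; and $\mathcal{W}_{1,\infty}$, all such tuples with $\|\mathbf{W}_i\|_{1,\infty}\le M_{1,\infty}(i)$ for $i\le d-1$ and $\|\mathbf{w}_d\|_1\le M_{1,\infty}(d)$. $\mathcal{F}_{nn}$ is the set of all such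 networks with parameters in the given parameter set. Assumption A: each $\sigma_i$ is continuous, non-decreasing, satisfies $\sigma_i(0)\ge0$, and is $L_i$-Lipschitz with $L_i>0$ (these are the $L_i$ in the claim). Assumption B: for each $i=1,\dots,d-1$ there are positive constants $q(i)$ and $Q_\sigma(i)$ such that $\sigma_i(x_2)-\sigma_i(x_1)\ge Q_\sigma(i)(x_2-x_1)$ for all $0\le x_1\le x_2\le q(i)$. Class $\mathcal{P}_{uB}$: given $\Gamma_{uB}>0$, $\mathcal{P}_{uB}$ is the set of all Borel probability measures $\mu$ on $\mathbb{R}^h$ with unbounded support such that $\|\mathbb{E}_{\mathbf{x}\sim\mu}\mathbf{x}\|\le\Gamma_{uB}$ and, for some $\tau$ with $0<\tau\le\Gamma_{uB}$, $\mathbb{E}_{\mathbf{x}\sim\mu}e^{\mathbf{a}^T(\mathbf{x}-\mathbb{E}\mathbf{x})}\le e^{\|\mathbf{a}\|^2\tau^2/2}$ for all $\mathbf{a}\in\mathbb{R}^h$. Average Rademacher complexity: $\mathcal{R}_n(\mathcal{F}_{nn},\mu)=\mathbb{E}_{\mathbf{x},\epsilon}\sup_{f\in\mathcal{F}_{nn}}\left|\frac1n\sum_{i=1}^n\epsilon_if(\mathbf{x}_i)\right|$, where $\mathbf{x}_1,\dots,\mathbf{x}_n$ are i.i.d. from $\mu$ and $\epsilon_1,\dots,\epsilon_n$ are independent and uniform on $\{-1,1\}$, independent of the $\mathbf{x}_i$. *)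

(* Defs.v *)
From HB Require Import structures.
From mathcomp Require Import all_boot all_order all_algebra.
From mathcomp Require Import all_classical all_reals all_analysis.

Set Implicit Arguments.
Unset Strict Implicit.
Unset Printing Implicit Defensive.

Import Order.TTheory GRing.Theory Num.Theory.
Import numFieldNormedType.Exports.

Local Open Scope classical_set_scope.
Local Open Scope ring_scope.

(* The library norm on matrices is the maximum of the absolute values of the
   entries, so the norms used here are defined separately. *)
Section norms.
Context {R : realType}.

Definition frobenius (m n : nat) (A : 'M[R]_(m, n)) : R :=
  Num.sqrt (\sum_i \sum_j A i j ^+ 2).

Definition norm_1oo (m n : nat) (A : 'M[R]_(m, n)) : R :=
  \big[Num.max/0]_i \sum_j `|A i j|.

Definition norm2 (n : nat) (v : 'cV[R]_n) : R := Num.sqrt (\sum_i v i 0 ^+ 2).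

Definition norm1 (n : nat) (v : 'cV[R]_n) : R := \sum_i `|v i 0|.

Definition dotv (n : nat) (a x : 'cV[R]_n) : R := \sum_i a i 0 * x i 0.

End norms.

(* R^h with its Borel sigma-algebra. *)
Definition borel_cV (R : realType) (h : nat) :=
  g_sigma_algebraType (@open 'cV[R]_h).

Section iid.
Context {d : measure_display} {T : measurableType d} {R : realType}.

Definition iid_cons n (z : T * n.-tuple T) : n.+1.-tuple T :=
  [tuple of z.1 :: z.2].

Lemma measurable_iid_cons n : measurable_fun [set: T * n.-tuple T] (@iid_cons n).
Proof. exact: measurable_cons. Qed.

HB.instance Definition _ n :=
  isMeasurableFun.Build _ _ _ _ (@iid_cons n) (@measurable_iid_cons n).

(* The law on n.-tuple T of n independent samples of law mu, that is, the n-fold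
   product of mu. *)
Fixpoint iid (mu : probability T R) (n : nat) : probability (n.-tuple T) R :=
  match n with
  | 0 => \d_ [tuple]
  | n'.+1 => distribution (mu \x iid mu n')%E (@iid_cons n')
  end.

Lemma iid_rect (mu : probability T R) n (A : 'I_n -> set T) :
  (forall i, measurable (A i)) ->
  iid mu n [set t | forall i, A i (tnth t i)] = (\prod_i mu (A i))%E.
Proof.
elim: n A => [|n IHn] A mA /=.
  by rewrite big_ord0 diracE mem_set// => -[].
rewrite big_ord_recl -IHn; last by move=> i; exact: mA.
rewrite /distribution /pushforward.
rewrite (_ : _ @^-1` _ =
  A ord0 `*` [set t | forall i, A (lift ord0 i) (tnth t i)]).
  rewrite product_measure1E//.
  rewrite (_ : [set _ | _] =
      \bigcap_(i in [set: 'I_n]) ((@tnth n T)^~ i @^-1` A (lift ord0 i))).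
    apply: fin_bigcap_measurable => // i _.
    by rewrite -[X in measurable X]setTI; exact: measurable_tnth.
  by apply/seteqP; split=> t /= h i; [move=> _; exact: h|exact: h].
apply/seteqP; split=> -[x t] /=.
  move=> h; split; first by have := h ord0.
  by move=> i; have := h (lift ord0 i); rewrite tnthS.
move=> [h0 h1] i; case: (unliftP ord0 i) => [j ->|->//].
by rewrite tnthS.
Qed.

(* E_{x,eps} sup_{f in F} |1/n sum_i eps_i f(x_i)|; the expectation over the signs
   (-1) ^+ e i, independent of the sample and uniform, is the average over e.
   The value is an extended real, +oo if the supremum is not integrable. *)
Definition rademacher (n : nat) (F : set (T -> R)) (mu : probability T R)
    : \bar R :=
  (\int[iid mu n]_x
     (((2 ^+ n)^-1)%R%:E *
      \sum_(e : {ffun 'I_n -> bool})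
         ereal_sup [set `| n%:R^-1 *
                           (\sum_(i < n) (-1) ^+ e i * f (tnth x i)) |%R%:E
                   | f in F]))%E.

End iid.

Section networks.
Context {R : realType}.
Variables (k : nat -> nat) (d : nat) (sigma : nat -> R -> R).

(* The layers are numbered from 1, as is the width sequence k, and k 1 is the
   input dimension. Only W i with 1 <= i < d and sigma i with 1 <= i < d enter
   the network. *)
Record weights := Weights {
  W : forall i : nat, 'M[R]_(k i.+1, k i);
  wlast : 'cV[R]_(k d) }.

Section layers.
Variables (V : forall i : nat, 'M[R]_(k i.+1, k i)) (x : 'cV[R]_(k 1%N)).

Fixpoint layerS (i : nat) : 'cV[R]_(k i.+1) :=
  match i with
  | 0 => x
  | j.+1 => map_mx (sigma j.+1) (V j.+1 *m layerS j)
  end.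

(* The input of the i-th weight matrix for i >= 1; the value at 0 is irrelevant. *)
Definition layer (i : nat) : 'cV[R]_(k i) :=
  match i with 0 => 0 | j.+1 => layerS j end.

End layers.

Definition network (w : weights) (x : 'cV[R]_(k 1%N)) : R :=
  dotv (wlast w) (layer (W w) x d).

(* F_nn for the parameter set P. *)
Definition nn_class (P : set weights) : set (borel_cV R (k 1%N) -> R) :=
  network @` P.

Definition weights_F (M : nat -> R) : set weights :=
  [set w | (forall i, (1 <= i < d)%N -> frobenius (W w i) <= M i) /\
           norm2 (wlast w) <= M d].

Definition weights_1oo (M : nat -> R) : set weights :=
  [set w | (forall i, (1 <= i < d)%N -> norm_1oo (W w i) <= M i) /\
           norm1 (wlast w) <= M d].

Definition assumptionA (L : nat -> R) : Prop :=
  forall i, (1 <= i < d)%N ->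
    [/\ continuous (sigma i), {homo sigma i : x y / x <= y}, 0 <= sigma i 0,
        0 < L i & (L i).-lipschitz (sigma i)].

Definition assumptionB : Prop :=
  forall i, (1 <= i < d)%N -> exists q Q : R,
    [/\ 0 < q, 0 < Q & forall x1 x2, 0 <= x1 -> x1 <= x2 -> x2 <= q ->
       Q * (x2 - x1) <= sigma i x2 - sigma i x1].

End networks.

Arguments network {R k d} sigma w x.
Arguments nn_class {R k d} sigma P.
Arguments weights_F {R} k d M.
Arguments weights_1oo {R} k d M.

Section subgaussian.
Context {R : realType} {h : nat}.
Implicit Type mu : probability (borel_cV R h) R.

Definition msupport mu : set 'cV[R]_h :=
  [set x | forall U : set 'cV[R]_h, open U -> U x -> (0 < mu U)%E].

Definition mean mu : 'cV[R]_h := \col_i (\int[mu]_x (x : 'cV[R]_h) i 0).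

Definition PuB (Gamma : R) : set (probability (borel_cV R h) R) :=
  [set mu |
    [/\ ~ bounded_set (msupport mu),
        forall i : 'I_h,
          mu.-integrable setT (fun x => ((x : 'cV[R]_h) i 0)%:E),
        norm2 (mean mu) <= Gamma &
        exists tau : R, [/\ 0 < tau, tau <= Gamma &
          forall a : 'cV[R]_h,
            (\int[mu]_x (expR (dotv a ((x : 'cV[R]_h) - mean mu)))%:E
             <= (expR (norm2 a ^+ 2 * tau ^+ 2 / 2))%:E)%E]]].

End subgaussian.

(* Main.v *)
Require Import Defs.
From HB Require Import structures.
From mathcomp Require Import all_boot all_order all_algebra.
From mathcomp Require Import all_classical all_reals all_analysis.
From mathcomp Require Import measurable_realfun.
From mathcomp Require Import ring lra.

(* The average of the suprema over the sign patterns [e] is bounded as soon as the average over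
   [e] is bounded for every selection of networks depending on [e]. For such selections one
   bounds the averages of [G] applied to the signed sums, with [G] convex and increasing, and
   peels off the layers one at a time by contraction.

   (I) For positively homogeneous activations [G y = expR (la y)] loses a factor 2 per layer,
   down to [expR (la |S|)], where [S] is the vector of signed sums of the sample. This is at
   most [expR] of a constant plus a multiple of [|S| ^ 2], and a Gaussian average turns the
   square into linear terms, to which the sub-Gaussian hypothesis applies.

   (II) The squared mean of the sample adds to the variance, so that coordinate [l] has
   variance proxy [1 + m_l ^ 2] with [\sum_l m_l ^ 2 <= 1], and a factor 2 per layer is too
   much for the constant [sqrt 2]. But a nondecreasing contraction is half the identity plus
   half a contraction, and only the second half pays the factor 2: if
   [G ((a + b) / 2) <= G1 a + G2 b] then [G] after a layer is controlled by [G1 + 2 G2] before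
   it. For exponentials this costs only [sqrt 2]. Through the last layers the identity is
   pulled back instead to a constant plus a sum of hinge functions [max 0 (y - t)], which is
   dominated by an exponential (large depth or input dimension) or by
   [w (cosh (la y) - 1)]. *)

Set Implicit Arguments.
Unset Strict Implicit.
Unset Printing Implicit Defensive.

Import Order.TTheory GRing.Theory Num.Theory.
Import numFieldNormedType.Exports.

Local Open Scope classical_set_scope.
Local Open Scope ring_scope.

(** * Contraction *)

Section contraction.
Context {R : realType}.
Implicit Types (G phi : R -> R).

(** In (II) the delicate case is input dimension 1 with a mean of full length [Gamma]. The variance
    proxy is then 2, and the target lets the factors collected on the way, including the 2 lost in
    passing from [expR] of an absolute value to [ch], multiply up to [expR (x / 2)], where [x] is
    the depth times [ln 2]. A factor [sqrt 2] for every hidden layer overshoots this by [sqrt 2].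
    Three hinge layers cost [expR (107 / 160)], less than 2, instead of [2 * sqrt 2], which repairs
    it. Two of them cost [expR (143 / 400)] instead of 2, about one percent too much; the slack of
    larger input dimensions absorbs this. Networks with one or two hidden layers have no such
    reserve in small dimension and need a majorant that, like the hinges there, vanishes at 0.

    Since the supremum over the class is not known to be measurable in the sample, every bound is
    proved for a fixed sample and selection, and Jensen's inequality is replaced by a tangent line
    of the exponential. *)

Definition convex_incr G :=
  {homo G : x y / x <= y} /\
  forall u v t, u <= v -> 0 <= t -> G (u + t) + G v <= G (v + t) + G u.

Definition zero_contraction phi :=
  phi 0 = 0 /\ forall x y, `|phi x - phi y| <= `|x - y|.

Lemma contraction_le phi x : zero_contraction phi -> `|phi x| <= `|x|.
Proof. by move=> [p0 /(_ x 0)]; rewrite p0 !subr0. Qed.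

Lemma contractionN phi : zero_contraction phi -> zero_contraction (fun x => - phi x).
Proof.
move=> [p0 pc]; split; first by rewrite p0 oppr0.
by move=> x y; rewrite -opprD normrN; exact: pc.
Qed.

Lemma convex_incr_spread G b x y : convex_incr G -> `|y| <= `|x| ->
  G (b + y) + G (b - y) <= G (b + x) + G (b - x).
Proof.
move=> [_ Gc].
wlog x0 : x / 0 <= x.
  move=> H; have [/H//|/ltW x0] := leP 0 x.
  rewrite -(normrN x) => yx; have := H (- x).
  by rewrite opprK oppr_ge0 => /(_ x0 yx); rewrite [G (b - x) + _]addrC.
wlog y0 : y / 0 <= y.
  move=> H; have [/H//|/ltW y0] := leP 0 y.
  rewrite -(normrN y) => yx; have := H (- y).
  by rewrite opprK oppr_ge0 => /(_ y0 yx); rewrite [G (b - y) + _]addrC.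
rewrite !ger0_norm // => yx.
have := Gc (b - x) (b + y) (x - y).
rewrite (_ : b - x + (x - y) = b - y); last by lra.
rewrite (_ : b + y + (x - y) = b + x); last by lra.
by move=> /(_ ltac:(lra) ltac:(lra)); lra.
Qed.

(** If replacing [phi] by the identity raises both arguments, monotonicity suffices. Otherwise one
    argument drops, by no more than the other gains because [phi] is a contraction, and the one that
    drops ends up to the left, so convexity compensates. Both cannot drop. *)
Let contraction_pair_ge G phi a b s t : convex_incr G -> zero_contraction phi ->
  t <= s -> b + phi t <= a + phi s -> a - phi s <= b - phi t ->
  G (a + phi s) + G (b - phi t) <= G (a + s) + G (b - t).
Proof.
move=> [Gh Gc] [p0 pc] ts h1 h2.
have st := pc s t; rewrite ger0_norm ?[`|s - t|]ger0_norm in st; [|lra|lra].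
have hs := pc s 0; rewrite p0 !subr0 in hs.
have ht := pc t 0; rewrite p0 !subr0 in ht.
have [s1|s1] := leP (phi s) s; have [t1|t1] := leP t (phi t).
- by apply: lerD; apply: Gh; lra.
- have t0 : 0 <= t.
    case: (leP 0 t) => // t0; move: ht; rewrite !ltr0_norm//; lra.
  have pt : - t <= phi t by move: ht; rewrite (ger0_norm t0) ler_norml => /andP[].
  have := Gc (b - t) (a + phi s) (t - phi t).
  rewrite (_ : b - t + (t - phi t) = b - phi t); last by lra.
  move=> /(_ ltac:(lra) ltac:(lra)).
  have : G (a + phi s + (t - phi t)) <= G (a + s) by apply: Gh; lra.
  lra.
- have s0 : s <= 0.
    case: (leP s 0) => // s0; move: hs; rewrite !gtr0_norm//; lra.
  have ps : phi s <= - s by move: hs; rewrite (ler0_norm s0) ler_norml => /andP[].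
  have := Gc (a + s) (b - phi t) (phi s - s).
  rewrite (_ : a + s + (phi s - s) = a + phi s); last by lra.
  move=> /(_ ltac:(lra) ltac:(lra)).
  have : G (b - phi t + (phi s - s)) <= G (b - t) by apply: Gh; lra.
  lra.
- lra.
Qed.

(** The comparison of Ledoux and Talagrand for one coordinate, where [a] and [b] are the signed sums
    over the other coordinates under two selections. In place of suprema, [c] records for each sign
    of the coordinate which of the two selections to keep. *)
Lemma contraction_pair G phi a b s t : convex_incr G -> zero_contraction phi ->
  exists c : bool * bool, G (a + phi s) + G (b - phi t) <=
    (if c.1 then G (a + s) else G (b + t)) +
    (if c.2 then G (a - s) else G (b - t)).
Proof.
(* If one selection is better for both signs, it can be used twice, and the spread lemma removes
   [phi]. *)
move=> Gc pc; have [h1|h1] := leP (b + phi t) (a + phi s); last first.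
  exists (false, false) => /=.
  have := convex_incr_spread b Gc (contraction_le t pc).
  have := Gc.1 _ _ (ltW h1); lra.
have [h2|h2] := leP (a - phi s) (b - phi t); last first.
  exists (true, true) => /=.
  have := convex_incr_spread a Gc (contraction_le s pc).
  have := Gc.1 _ _ (ltW h2); lra.
have [ts|st] := leP t s.
  by exists (true, false) => /=; exact: (@contraction_pair_ge G phi a b s t).
exists (false, true) => /=; rewrite [leRHS]addrC.
pose psi x := phi (- x).
have psic : zero_contraction psi.
  split; first by rewrite /psi oppr0 pc.1.
  by move=> x y; rewrite /psi (le_trans (pc.2 _ _))// -opprD normrN.
have := @contraction_pair_ge G psi a b (- s) (- t) Gc psic.
rewrite /psi !opprK => H; apply: H; lra.
Qed.

Section coordinates.
Variables (n : nat) (J : Type).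
Notation signs := {ffun 'I_n -> bool}.

Definition rsum (t : 'I_n -> R) (e : signs) : R := \sum_i (-1) ^+ e i * t i.

Definition flip (k : 'I_n) (e : signs) : signs :=
  [ffun i => if i == k then ~~ e i else e i].

Lemma flipK k : involutive (flip k).
Proof.
by move=> e; apply/ffunP => i; rewrite !ffunE; case: eqP => // _; rewrite negbK.
Qed.

Lemma flip_at k e : flip k e k = ~~ e k. Proof. by rewrite ffunE eqxx. Qed.

Lemma flip_off k e i : i != k -> flip k e i = e i.
Proof. by rewrite ffunE => /negbTE ->. Qed.

Lemma sum_signs_flip k (F : signs -> R) :
  \sum_e F e = \sum_(e : signs | ~~ e k) (F e + F (flip k e)).
Proof.
rewrite big_split /= (bigID (fun e : signs => ~~ e k)) /=; congr (_ + _).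
rewrite (reindex_inj (inv_inj (flipK k))) /=; apply: eq_bigl => e.
by rewrite flip_at negbK.
Qed.

Lemma rsumN t e : rsum (fun i => - t i) e = - rsum t e.
Proof. by rewrite /rsum -sumrN; apply: eq_bigr => i _; rewrite mulrN. Qed.

Lemma rsumD t u e : rsum (fun i => t i + u i) e = rsum t e + rsum u e.
Proof. by rewrite /rsum -big_split; apply: eq_bigr => i _; rewrite /= mulrDr. Qed.

Lemma rsumZ c t e : rsum (fun i => c * t i) e = c * rsum t e.
Proof. by rewrite /rsum mulr_sumr; apply: eq_bigr => i _; rewrite mulrCA. Qed.

Lemma rsum_sum (I : finType) (f : I -> 'I_n -> R) e :
  rsum (fun i => \sum_l f l i) e = \sum_l rsum (f l) e.
Proof.
rewrite /rsum exchange_big /=; apply: eq_bigr => i _.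
by rewrite mulr_sumr.
Qed.

Lemma contraction_coord G phi (t u : J -> 'I_n -> R) k :
  convex_incr G -> zero_contraction phi ->
  (forall j, u j k = phi (t j k)) ->
  (forall j i, i != k -> u j i = t j i) ->
  forall s : signs -> J, exists s' : signs -> J,
    \sum_e G (rsum (u (s e)) e) <= \sum_e G (rsum (t (s' e)) e).
Proof.
move=> Gc pc uk uo s.
pose rest j (e : signs) := \sum_(i | i != k) (-1) ^+ e i * t j i.
have rsumt j e : rsum (t j) e = rest j e + (-1) ^+ e k * t j k.
  by rewrite /rsum (bigD1 k) //= addrC.
have rsumu j e : rsum (u j) e = rest j e + (-1) ^+ e k * phi (t j k).
  rewrite /rsum (bigD1 k) //= addrC uk; congr (_ + _).
  by apply: eq_bigr => i ik; rewrite uo.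
have restf j e : rest j (flip k e) = rest j e.
  by apply: eq_bigr => i ik; rewrite flip_off.
have /choice[c hc] : forall e : signs, exists c : bool * bool, _ := fun e => contraction_pair
  (rest (s e) e) (rest (s (flip k e)) e) (t (s e) k) (t (s (flip k e)) k) Gc pc.
(* The pattern with [e k = false] carries the plus sign. Both patterns of a pair consult the same
   [c], indexed by that one. *)
exists (fun e : signs => if e k then (if (c (flip k e)).2 then s (flip k e) else s e)
                 else if (c e).1 then s e else s (flip k e)).
rewrite !(sum_signs_flip k); apply: ler_sum => e ek.
rewrite !flip_at !flipK (negbTE ek) /=.
have := hc e; rewrite !rsumu !rsumt !restf !flip_at (negbTE ek) /=.
rewrite expr0 expr1 !mul1r !mulN1r => /le_trans; apply.
by case: (c e) => [[] []].
Qed.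

(** The coordinates are contracted one at a time. Each step may change the selection, so the
    conclusion only promises some [s']. *)
Lemma contraction_principle G (phi : R -> R) (t : J -> 'I_n -> R) :
  convex_incr G -> zero_contraction phi ->
  forall s : signs -> J, exists s' : signs -> J,
    \sum_e G (rsum (fun i => phi (t (s e) i)) e) <=
    \sum_e G (rsum (t (s' e)) e).
Proof.
move=> Gc pc.
pose tk m j (i : 'I_n) := if (i < m)%N then phi (t j i) else t j i.
have H m : (m <= n)%N -> forall s : signs -> J, exists s' : signs -> J,
    \sum_e G (rsum (tk m (s e)) e) <= \sum_e G (rsum (t (s' e)) e).
  elim: m => [|m IHm] mn s; first by exists s.
  have [s1 h1] := @contraction_coord G phi (tk m) (tk m.+1) (Ordinal mn) Gc pc
    ltac:(by move=> j; rewrite /tk /= ltnSn ltnn)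
    ltac:(by move=> j i; rewrite /tk /= ltnS leq_eqVlt -val_eqE /= => /negbTE ->) s.
  have [s2 h2] := IHm (ltnW mn) s1.
  by exists s2; exact: le_trans h1 h2.
move=> s; have [s' h] := H n (leqnn n) s; exists s'; apply: le_trans h.
by rewrite le_eqVlt; apply/orP; left; apply/eqP; apply: eq_bigr => e _;
  congr (G _); apply: eq_bigr => i _; rewrite /tk ltn_ord.
Qed.

End coordinates.
End contraction.

(** * Contraction with absolute values and for monotone activations *)

Section layer_step.
Context {R : realType} {n : nat} {J : Type}.
Notation signs := {ffun 'I_n -> bool}.
Implicit Types (G phi : R -> R) (t : J -> 'I_n -> R).

(** The value of [G] at an absolute value is at most [G y + G (- y)], and [- phi] is again a
    contraction; each of the two terms brings its own selection. *)
Lemma contraction_abs G phi t : convex_incr G -> (forall y, 0 <= G y) ->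
  zero_contraction phi ->
  forall s : signs -> J, exists s1 s2 : signs -> J,
    \sum_e G `|rsum (fun i => phi (t (s e) i)) e| <=
    \sum_e G `|rsum (t (s1 e)) e| + \sum_e G `|rsum (t (s2 e)) e|.
Proof.
move=> Gc G0 pc s.
have [s1 h1] := contraction_principle t Gc pc s.
have [s2 h2] := contraction_principle t Gc (contractionN pc) s.
exists s1, s2.
have le_abs (s' : signs -> J) :
    \sum_e G (rsum (t (s' e)) e) <= \sum_e G `|rsum (t (s' e)) e|.
  by apply: ler_sum => e _; apply: Gc.1; exact: ler_norm.
apply: (le_trans _ (lerD (le_trans h1 (le_abs s1)) (le_trans h2 (le_abs s2)))).
rewrite -big_split /=; apply: ler_sum => e _; rewrite rsumN.
set y := rsum _ e; have := G0 y; have := G0 (- y).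
by case: (ger0P y) => _; lra.
Qed.

Lemma monotone_contraction phi : {homo phi : x y / x <= y} -> zero_contraction phi ->
  zero_contraction (fun x => 2 * phi x - x).
Proof.
move=> ph [p0 pc]; split; first by rewrite p0; lra.
move=> x y; wlog yx : x y / y <= x.
  move=> H; have [/H//|/ltW/H] := leP y x.
  by rewrite distrC [`|x - y|]distrC.
have h1 := ph _ _ yx; have := pc x y.
rewrite (ger0_norm (_ : 0 <= phi x - phi y)) ?subr_ge0//.
by rewrite (ger0_norm (_ : 0 <= x - y)) ?subr_ge0// ler_norml => h2; apply/andP; split; lra.
Qed.

(* A monotone contraction is [x / 2] plus half a contraction; only the second part costs
   the factor 2 of the contraction principle with absolute values. *)
Lemma monotone_layer G G1 G2 phi t :
  {homo phi : x y / x <= y} -> zero_contraction phi ->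
  {homo G : x y / x <= y} -> {homo G1 : x y / x <= y} ->
  convex_incr G2 -> (forall y, 0 <= G2 y) ->
  (forall a b, 0 <= a -> 0 <= b -> G ((a + b) / 2) <= G1 a + G2 b) ->
  forall s : signs -> J, exists s' : signs -> J,
    \sum_e G `|rsum (fun i => phi (t (s e) i)) e| <=
    \sum_e (G1 `|rsum (t (s' e)) e| + 2 * G2 `|rsum (t (s' e)) e|).
Proof.
move=> ph pc Gh G1h G2c G20 GG s.
have [s1 [s2 h]] := contraction_abs t G2c G20 (monotone_contraction ph pc) s.
(* Three selections occur. For each [e] the one with the largest absolute sum is kept, so that [G1]
   and [G2] are finally evaluated at the same point. *)
pose better (s3 s4 : signs -> J) (e : signs) : J :=
  if `|rsum (t (s3 e)) e| <= `|rsum (t (s4 e)) e| then s4 e else s3 e.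
have betterl s3 s4 e : `|rsum (t (s3 e)) e| <= `|rsum (t (better s3 s4 e)) e|.
  by rewrite /better; case: ifP.
have betterr s3 s4 e : `|rsum (t (s4 e)) e| <= `|rsum (t (better s3 s4 e)) e|.
  by rewrite /better; case: ifP => // /negbT; rewrite -ltNge => /ltW.
exists (better s (better s1 s2)).
have {}h : \sum_e G2 `|rsum (fun i => 2 * phi (t (s e) i) - t (s e) i) e| <=
    \sum_e 2 * G2 `|rsum (t (better s (better s1 s2) e)) e|.
  apply: (le_trans h); rewrite -big_split /=; apply: ler_sum => e _.
  have h1 : G2 `|rsum (t (s1 e)) e| <= G2 `|rsum (t (better s (better s1 s2) e)) e|.
    apply: G2c.1; apply: le_trans (betterr _ _ _); exact: betterl.
  have h2 : G2 `|rsum (t (s2 e)) e| <= G2 `|rsum (t (better s (better s1 s2) e)) e|.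
    apply: G2c.1; apply: le_trans (betterr _ _ _); exact: betterr.
  lra.
rewrite big_split /=; apply: le_trans (lerD (lexx _) h).
rewrite -big_split /=; apply: ler_sum => e _.
set a := rsum (t (s e)) e.
have eqr : rsum (fun i => phi (t (s e) i)) e =
    (a + rsum (fun i => 2 * phi (t (s e) i) - t (s e) i) e) / 2.
  rewrite [X in a + X](_ : _ = 2 * rsum (fun i => phi (t (s e) i)) e - a).
    by field.
  by rewrite /a -rsumZ -rsumN -rsumD.
rewrite eqr; set b := rsum (fun i => 2 * _ - _) e.
apply: (@le_trans _ _ (G ((`|a| + `|b|) / 2))).
  by apply: Gh; rewrite normrM (ger0_norm (_ : 0 <= 2^-1))// ler_wpM2r// ler_normD.
apply: (le_trans (GG _ _ (normr_ge0 _) (normr_ge0 _))).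
by rewrite lerD2r G1h// betterl.
Qed.

End layer_step.

Section norms.
Context {R : realType}.

Lemma cauchy_schwarz_sum (I : finType) (a b : I -> R) :
  (\sum_i a i * b i) ^+ 2 <= (\sum_i a i ^+ 2) * (\sum_i b i ^+ 2).
Proof.
have H : 0 <= \sum_i \sum_j (a i * b j - a j * b i) ^+ 2.
  by apply: sumr_ge0 => i _; apply: sumr_ge0 => j _; exact: sqr_ge0.
have E : \sum_i \sum_j (a i * b j - a j * b i) ^+ 2 =
    2 * ((\sum_i a i ^+ 2) * (\sum_i b i ^+ 2)) - 2 * (\sum_i a i * b i) ^+ 2.
  have E1 : (\sum_i a i ^+ 2) * (\sum_i b i ^+ 2) =
      \sum_i \sum_j (a i ^+ 2 * b j ^+ 2).
    by rewrite mulr_suml; apply: eq_bigr => i _; rewrite mulr_sumr.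
  have E2 : (\sum_i a i ^+ 2) * (\sum_i b i ^+ 2) =
      \sum_i \sum_j (a j ^+ 2 * b i ^+ 2).
    by rewrite E1 exchange_big.
  have E3 : (\sum_i a i * b i) ^+ 2 = \sum_i \sum_j (a i * b i * (a j * b j)).
    by rewrite expr2 mulr_suml; apply: eq_bigr => i _; rewrite mulr_sumr.
  rewrite [in RHS]mulrDl ?mul1r {1}E1 E2 E3 mulr_sumr -big_split /= -sumrB.
  apply: eq_bigr => i _; rewrite mulr_sumr -big_split /= -sumrB.
  by apply: eq_bigr => j _; ring.
by move: H; rewrite E; lra.
Qed.

Lemma norm2_ge0 m (v : 'cV[R]_m) : 0 <= norm2 v.
Proof. exact: sqrtr_ge0. Qed.

Lemma norm2_sqr m (v : 'cV[R]_m) : norm2 v ^+ 2 = \sum_i v i 0 ^+ 2.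
Proof. by rewrite sqr_sqrtr//; apply: sumr_ge0 => i _; exact: sqr_ge0. Qed.

Lemma dotv_le m (u v : 'cV[R]_m) : `|dotv u v| <= norm2 u * norm2 v.
Proof.
rewrite -ler_sqr ?nnegrE ?mulr_ge0 ?norm2_ge0// real_normK ?num_real//.
by rewrite exprMn !norm2_sqr; exact: cauchy_schwarz_sum.
Qed.

Lemma sum_le_norm1 (I : finType) (w a : I -> R) (A : R) :
  (forall i, `|a i| <= A) -> `|\sum_i w i * a i| <= (\sum_i `|w i|) * A.
Proof.
move=> aA; apply: (le_trans (ler_norm_sum _ _ _)); rewrite mulr_suml.
by apply: ler_sum => i _; rewrite normrM ler_wpM2l.
Qed.

Lemma norm_1oo_row m p (A : 'M[R]_(m, p)) i : \sum_j `|A i j| <= norm_1oo A.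
Proof. exact: (@le_bigmax _ _ _ 0 (fun i => \sum_j `|A i j|) i). Qed.

End norms.

Lemma exists_max {R : realType} (I : finType) (i0 : I) (a : I -> R) :
  exists i, forall j, a j <= a i.
Proof.
by case: (@arg_maxP _ _ _ i0 xpredT a isT) => i _ h; exists i => j; exact: h.
Qed.

(** * From one layer of the network to the preceding one *)

Section layers.
Context {R : realType} {k : nat -> nat} {n : nat} (sigma : nat -> R -> R).
Notation signs := {ffun 'I_n -> bool}.
Notation family := (forall i : nat, 'M[R]_(k i.+1, k i)).
Variables (xs : 'I_n -> 'cV[R]_(k 1)) (P : family -> Prop).

Definition lsum (V : family) j (e : signs) (r : 'I_(k j.+1)) : R :=
  rsum (fun i => layerS sigma V (xs i) j r 0) e.

Definition lvec (V : family) j (e : signs) : 'cV[R]_(k j.+1) :=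
  \col_r lsum V e r.

Lemma rsum_dotv V j e (u : 'cV[R]_(k j.+1)) :
  rsum (fun i => dotv u (layerS sigma V (xs i) j)) e = dotv u (lvec V j e).
Proof.
rewrite rsum_sum; apply: eq_bigr => l _.
by rewrite rsumZ mxE.
Qed.

Lemma rsum_mulmx V j e m (A : 'M[R]_(m, k j.+1)) r :
  rsum (fun i => (A *m layerS sigma V (xs i) j) r 0) e =
  \sum_l A r l * lsum V e l.
Proof.
transitivity (rsum (fun i => \sum_l A r l * layerS sigma V (xs i) j l 0) e).
  by apply: eq_bigr => i _; rewrite mxE.
by rewrite rsum_sum; apply: eq_bigr => l _; rewrite rsumZ.
Qed.

(** A row has l1 norm at most [M], so its signed sum is at most [M] times the largest coordinate of
    the preceding layer, which is again one selected coordinate. The divisors [c] and [c * (M * L)]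
    make the activation a contraction. *)
Lemma layer_step_1oo j (c M L : R) (G G1 G2 : R -> R) (C : R) :
  0 < c -> 0 < M -> 0 < L -> (0 < k j.+1)%N ->
  (forall V, P V -> norm_1oo (V j.+1) <= M) ->
  {homo sigma j.+1 : x y / x <= y} ->
  (forall x y, `|sigma j.+1 x - sigma j.+1 y| <= L * `|x - y|) ->
  sigma j.+1 0 = 0 ->
  {homo G : x y / x <= y} -> {homo G1 : x y / x <= y} ->
  convex_incr G2 -> (forall y, 0 <= G2 y) ->
  (forall a b, 0 <= a -> 0 <= b -> G ((a + b) / 2) <= G1 a + G2 b) ->
  (forall (Vs : signs -> family) (rs : signs -> 'I_(k j.+1)),
     (forall e, P (Vs e)) ->
     \sum_e (G1 (`|lsum (Vs e) e (rs e)| / c) +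
             2 * G2 (`|lsum (Vs e) e (rs e)| / c)) <= C) ->
  forall (Vs : signs -> family) (rs : signs -> 'I_(k j.+2)),
     (forall e, P (Vs e)) ->
     \sum_e G (`|lsum (Vs e) e (rs e)| / (c * (M * L))) <= C.
Proof.
move=> c0 M0 L0 kj nM sh sL s0 Gh G1h G2c G20 GG H Vs rs PV.
pose J := ({V : family | P V} * 'I_(k j.+2))%type.
pose t (u : J) (i : 'I_n) : R :=
  (c * M)^-1 * (sval u.1 j.+1 *m layerS sigma (sval u.1) (xs i) j) u.2 0.
pose phi y := sigma j.+1 (c * M * y) / (c * (M * L)).
have cM0 : 0 < c * M by exact: mulr_gt0.
have cML0 : 0 < c * (M * L) by rewrite mulrA mulr_gt0.
have ph : {homo phi : x y / x <= y}.
  by move=> x y xy; rewrite /phi ler_pM2r ?invr_gt0//; apply: sh; rewrite ler_pM2l.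
have pc : zero_contraction phi.
  split; first by rewrite /phi mulr0 s0 mul0r.
  move=> x y; rewrite /phi -mulrBl normrM (gtr0_norm (_ : 0 < (c * (M * L))^-1)) ?invr_gt0//.
  rewrite ler_pdivrMr//; apply: (le_trans (sL _ _)).
  rewrite -mulrBr normrM (gtr0_norm cM0) le_eqVlt; apply/orP; left; apply/eqP; ring.
pose s (e : signs) : J := (exist _ (Vs e) (PV e), rs e).
have [s' hs'] := monotone_layer t ph pc Gh G1h G2c G20 GG s.
have key (u : J) e : exists r : 'I_(k j.+1),
    `|rsum (t u) e| <= `|lsum (sval u.1) e r| / c.
  have [r hr] := exists_max (Ordinal kj) (fun r => `|lsum (sval u.1) e r|).
  exists r; rewrite /t rsumZ rsum_mulmx normrM gtr0_norm ?invr_gt0// mulrC ler_pdivrMr//.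
  apply: (le_trans (sum_le_norm1 _ hr)).
  rewrite (_ : `|_| / c * (c * M) = M * `|lsum (sval u.1) e r|); last first.
    by field; rewrite gt_eqF.
  rewrite ler_wpM2r//; apply: le_trans (nM _ (svalP u.1)).
  exact: norm_1oo_row.
have /choice[r hr] := fun e => key (s' e) e.
apply: le_trans (H (fun e => sval (s' e).1) r (fun e => svalP (s' e).1)).
apply: (@le_trans _ _ (\sum_e G `|rsum (fun i => phi (t (s e) i)) e|)).
  rewrite le_eqVlt; apply/orP; left; apply/eqP; apply: eq_bigr => e _.
  congr (G _); rewrite -[X in _ / X]gtr0_norm// -normfV -normrM mulrC -rsumZ.
  congr (`| rsum _ e |); apply/funext => i.
  rewrite /phi /t /= mulrC; congr (_ / _); rewrite mxE; congr (sigma _ _).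
  by field; rewrite !gt_eqF.
apply: (le_trans hs'); apply: ler_sum => e _.
by apply: lerD; [exact: G1h|rewrite ler_pM2l//; apply: G2c.1].
Qed.

(** Homogeneity pulls the norm of each row [w r] out of the activation, so the squared norm of the
    signed sums is [\sum_r norm2 (w r) ^+ 2 * q r ^+ 2], with [q r] the signed sum for the
    normalised row. This is at most [M ^+ 2] times the largest [q r ^+ 2]: the whole layer is
    replaced by one unit vector, and the contraction is applied with the unit ball in the index
    set. *)
Lemma layer_step_F j (c M L : R) (G : R -> R) (C : R) :
  0 < c -> 0 < M -> 0 < L ->
  (forall V, P V -> frobenius (V j.+1) <= M) ->
  (forall x y, `|sigma j.+1 x - sigma j.+1 y| <= L * `|x - y|) ->
  (forall a x, 0 < a -> sigma j.+1 (a * x) = a * sigma j.+1 x) ->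
  convex_incr G -> (forall y, 0 <= G y) ->
  (forall (Vs : signs -> family), (forall e, P (Vs e)) ->
     \sum_e G (norm2 (lvec (Vs e) j e) / c) <= C) ->
  forall (Vs : signs -> family), (forall e, P (Vs e)) ->
     \sum_e G (norm2 (lvec (Vs e) j.+1 e) / (c * (M * L))) <= 2 * C.
Proof.
move=> c0 M0 L0 nM sL sa Gc G0 H Vs PV.
have s0 : sigma j.+1 0 = 0.
  by have := sa 2 0 ltac:(lra); rewrite mulr0; lra.
pose J := ({V : family | P V} * {u : 'cV[R]_(k j.+1) | norm2 u <= 1})%type.
pose t (u : J) (i : 'I_n) : R :=
  c^-1 * dotv (sval u.2) (layerS sigma (sval u.1) (xs i) j).
pose phi y := sigma j.+1 (c * y) / (c * L).
have cL0 : 0 < c * L by exact: mulr_gt0.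
have pc : zero_contraction phi.
  split; first by rewrite /phi mulr0 s0 mul0r.
  move=> x y; rewrite /phi -mulrBl normrM (gtr0_norm (_ : 0 < (c * L)^-1)) ?invr_gt0//.
  rewrite ler_pdivrMr//; apply: (le_trans (sL _ _)).
  rewrite -mulrBr normrM (gtr0_norm c0) le_eqVlt; apply/orP; left; apply/eqP; ring.
have key V e : P V -> exists2 u : 'cV[R]_(k j.+1), norm2 u <= 1 &
    norm2 (lvec V j.+1 e) <=
    M * `|rsum (fun i => sigma j.+1 (dotv u (layerS sigma V (xs i) j))) e|.
  move=> PVV; pose w r : 'cV[R]_(k j.+1) := \col_l V j.+1 r l.
  pose u r : 'cV[R]_(k j.+1) := (norm2 (w r))^-1 *: w r.
  pose q r := rsum (fun i => sigma j.+1 (dotv (u r) (layerS sigma V (xs i) j))) e.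
  have Sq r : lsum V e r = norm2 (w r) * q r.
    rewrite /q -rsumZ; congr (rsum _ e); apply/funext => i.
    rewrite mxE mxE.
    rewrite (_ : \sum_l _ = dotv (w r) (layerS sigma V (xs i) j)); last first.
      by apply: eq_bigr => l _; rewrite mxE.
    (* Homogeneity covers positive factors only; a zero row is settled by [sigma j.+1 0 = 0]. *)
    have := norm2_ge0 (w r); rewrite le_eqVlt => /predU1P[w0|w0].
      have := dotv_le (w r) (layerS sigma V (xs i) j).
      by rewrite -w0 !mul0r normr_le0 => /eqP ->.
    rewrite -sa//; congr (sigma _ _); rewrite /dotv mulr_sumr.
    by apply: eq_bigr => l _; rewrite /u !mxE; field; rewrite gt_eqF.
  have u1 r : norm2 (u r) <= 1.
    rewrite -[leRHS]sqrtr1 ler_wsqrtr//.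
    rewrite (_ : \sum_i _ = (norm2 (w r))^-1 ^+ 2 * norm2 (w r) ^+ 2); last first.
      rewrite norm2_sqr mulr_sumr; apply: eq_bigr => i _.
      by rewrite mxE exprMn.
    rewrite -exprMn; have [->|w0] := eqVneq (norm2 (w r)) 0.
      by rewrite mulr0 expr0n.
    by rewrite mulVf// expr1n.
  have [kj|kj] := posnP (k j.+2).
    exists 0.
      by rewrite /norm2 big1 ?sqrtr0// => i _; rewrite mxE expr0n.
    rewrite (_ : norm2 _ = 0) ?mulr_ge0//; first exact: ltW.
    by rewrite /norm2 big1 ?sqrtr0// => -[i ik]; exfalso; move: ik; rewrite kj.
  have [r hr] := exists_max (Ordinal kj) (fun r => `|q r|).
  exists (u r) => //; rewrite -/(q r).
  rewrite -ler_sqr ?nnegrE ?mulr_ge0 ?norm2_ge0 ?(ltW M0)//.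
  rewrite exprMn norm2_sqr.
  apply: (@le_trans _ _ (\sum_r0 norm2 (w r0) ^+ 2 * `|q r| ^+ 2)).
    apply: ler_sum => r0 _; rewrite mxE Sq exprMn ler_wpM2l ?sqr_ge0//.
    by rewrite -[leLHS]real_normK ?num_real// lerXn2r ?nnegrE.
  rewrite -mulr_suml ler_wpM2r ?sqr_ge0//.
  apply: (@le_trans _ _ (frobenius (V j.+1) ^+ 2)); last first.
    by rewrite lerXn2r ?nnegrE ?sqrtr_ge0 ?nM// ltW.
  rewrite sqr_sqrtr; last first.
    by apply: sumr_ge0 => r1 _; apply: sumr_ge0 => l _; exact: sqr_ge0.
  apply: ler_sum => r1 _; rewrite norm2_sqr; apply: ler_sum => l _.
  by rewrite mxE.
have /choice[us hus] (e : signs) : exists u : {u : 'cV[R]_(k j.+1) | norm2 u <= 1},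
    norm2 (lvec (Vs e) j.+1 e) <=
    M * `|rsum (fun i => sigma j.+1 (dotv (sval u) (layerS sigma (Vs e) (xs i) j))) e|.
  by have [u u1 hu] := key (Vs e) e (PV e); exists (exist _ u u1).
pose s (e : signs) : J := (exist _ (Vs e) (PV e), us e).
have [s1 [s2 hs]] := contraction_abs t Gc G0 pc s.
have tle (s' : signs -> J) : \sum_e G `|rsum (t (s' e)) e| <= C.
  apply: le_trans (H (fun e => sval (s' e).1) (fun e => svalP (s' e).1)).
  apply: ler_sum => e _; apply: Gc.1.
  rewrite /t rsumZ rsum_dotv normrM gtr0_norm ?invr_gt0// mulrC ler_pM2r ?invr_gt0//.
  apply: (le_trans (dotv_le _ _)); rewrite ler_piMl ?norm2_ge0//.
  exact: (svalP (s' e).2).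
apply: (@le_trans _ _ (\sum_e G `|rsum (fun i => phi (t (s e) i)) e|)); last first.
  by apply: (le_trans hs); have := tle s1; have := tle s2; lra.
apply: ler_sum => e _; apply: Gc.1; rewrite ler_pdivrMr; last by rewrite mulrA mulrAC mulr_gt0.
apply: (le_trans (hus e)); rewrite le_eqVlt; apply/orP; left; apply/eqP.
transitivity (M * `|c * L * rsum (fun i => phi (t (s e) i)) e|).
  rewrite -rsumZ; congr (_ * `|rsum _ e|); apply/funext => i.
  rewrite /phi /t /= mulrCA mulfV ?gt_eqF// mulr1; congr (sigma _ _).
  by rewrite mulrA mulfV ?gt_eqF// mul1r.
by rewrite normrM (gtr0_norm cL0); ring.
Qed.

End layers.

(** * Exponential moments of the sample *)

Section exp_bounds.
Context {R : realType}.

Lemma deriv_ge0_ge (f df : R -> R) x : (forall y, is_derive y (1 : R) f (df y)) ->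
  (forall y, 0 <= y -> 0 <= df y) -> 0 <= x -> f 0 <= f x.
Proof.
move=> fd f0 x0.
have fc : {within `[0, x], continuous f}.
  by apply: derivable_within_continuous => y _; case: (fd y).
have [c] := MVT_segment x0 (fun y _ => fd y) fc.
rewrite in_itv /= => /andP[c0 _] h; rewrite -subr_ge0 h subr0.
by rewrite mulr_ge0// f0.
Qed.

Lemma expR_ge_quadratic (x : R) : 0 <= x -> 1 + x + x ^+ 2 / 2 <= expR x.
Proof.
move=> x0; rewrite -subr_ge0.
pose f (y : R) := expR y - (1 + y + y ^+ 2 / 2).
pose df (y : R) := expR y - (1 + y).
have : f 0 <= f x.
  apply: (@deriv_ge0_ge f df) => // y.
    rewrite /f /df; apply: is_derive_eq.
    by rewrite /GRing.scale /=; field.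
  by move=> _; rewrite subr_ge0 expR_ge1Dx.
by rewrite {1}/f expR0 /f; lra.
Qed.

(** For [x < 2] this bounds [expR x] by its Padé approximant [(2 + x) / (2 - x)]; applied to a small
    fraction of the argument it yields the rational certificates for upper bounds. *)
Lemma expR_le_pade (x : R) : 0 <= x -> (2 - x) * expR x <= 2 + x.
Proof.
move=> x0; pose f (y : R) := 2 + y - (2 - y) * expR y.
pose df (y : R) := 1 - (1 - y) * expR y.
have : f 0 <= f x.
  apply: (@deriv_ge0_ge f df) => // y.
    rewrite /f /df; apply: is_derive_eq.
    by rewrite /GRing.scale /=; ring.
  move=> _; rewrite /df subr_ge0.
  have := expR_ge1Dx (- y); rewrite expRN => h.
  by rewrite -ler_pdivlMr ?expR_gt0// div1r.
by rewrite {1}/f expR0 /f; lra.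
Qed.

(** The product of [cosh z] and [expR (- (z ^+ 2 / 2))] decreases for [z >= 0]: its derivative has
    the sign of [sinh z - z * cosh z], and [z * cosh z - sinh z] vanishes at 0 and has derivative
    [z * sinh z]. *)
Lemma cosh_le_expR (c : R) : expR c + expR (- c) <= 2 * expR (c ^+ 2 / 2).
Proof.
wlog c0 : c / 0 <= c.
  move=> H; have [/H//|/ltW c0] := leP 0 c.
  by have := H (- c); rewrite oppr_ge0 opprK sqrrN addrC; exact.
have odd_ge0 (y : R) : 0 <= y -> 0 <= expR y - expR (- y).
  by move=> y0; rewrite subr_ge0 ler_expR; lra.
have tanh_le (y : R) : 0 <= y ->
    0 <= y * (expR y + expR (- y)) - (expR y - expR (- y)).
  move=> y0; pose f (z : R) := z * (expR z + expR (- z)) - (expR z - expR (- z)).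
  pose df (z : R) := z * (expR z - expR (- z)).
  have : f 0 <= f y.
    apply: (@deriv_ge0_ge f df) => // z.
      rewrite /f /df; apply: is_derive_eq.
      by rewrite /GRing.scale /=; ring.
    by move=> z0; rewrite mulr_ge0// odd_ge0.
  by rewrite {1}/f oppr0 expR0 /f; lra.
pose f (z : R) := - ((expR z + expR (- z)) * expR (- (z ^+ 2 / 2))).
pose df (z : R) := (z * (expR z + expR (- z)) - (expR z - expR (- z)))
  * expR (- (z ^+ 2 / 2)).
have : f 0 <= f c.
  apply: (@deriv_ge0_ge f df) => // z.
    rewrite /f /df; apply: is_derive_eq.
    by rewrite /GRing.scale /=; field.
  by move=> z0; rewrite mulr_ge0 ?expR_ge0// tanh_le.
rewrite /f oppr0 expr0n /= mul0r oppr0 expR0 lerN2 mulr1 (expRN (_ / _)) => h.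
by rewrite -ler_pdivrMr ?expR_gt0.
Qed.

Lemma sum_signs_expR n (t : 'I_n -> R) :
  \sum_(e : {ffun 'I_n -> bool}) expR (rsum t e) <=
  2 ^+ n * expR ((\sum_i t i ^+ 2) / 2).
Proof.
under eq_bigr do rewrite expR_sum.
rewrite -(bigA_distr_bigA (fun i (b : bool) => expR ((-1) ^+ b * t i))) /=.
apply: (@le_trans _ _ (\prod_(i < n) (2 * expR (t i ^+ 2 / 2)))).
  apply: ler_prod => i _; rewrite big_bool /= expr0 expr1 mul1r mulN1r.
  by rewrite addr_ge0 ?expR_ge0//= addrC cosh_le_expR.
by rewrite big_split /= prodr_const card_ord -expR_sum mulr_suml.
Qed.

End exp_bounds.

(** * Integrals over the sample, and suprema as selections *)

Section measure_tools.
Local Open Scope ereal_scope.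

(** The integral of a nonnegative function is a supremum over the simple functions below it, so
    monotonicity needs no measurability. This matters for the integrand of [rademacher], a supremum
    over a possibly uncountable class. *)
Lemma ge0_integral_mono d (T : measurableType d) (R : realType)
    (mu : {measure set T -> \bar R}) (f g : T -> \bar R) :
  (forall x, 0 <= f x) -> (forall x, f x <= g x) ->
  \int[mu]_x f x <= \int[mu]_x g x.
Proof.
move=> f0 fg; have g0 x : 0 <= g x by exact: le_trans (fg x).
rewrite !ge0_integralTE//; apply: ereal_sup_le => _ [h hf <-].
by exists h => // x; apply: le_trans (fg x).
Qed.

Lemma ge0_integral_iid d (T : measurableType d) (R : realType)
    (mu : probability T R) n (f : 'I_n -> T -> \bar R) (C : 'I_n -> \bar R) :
  (forall i x, 0 <= f i x) -> (forall i, measurable_fun setT (f i)) ->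
  (forall i, \int[mu]_x f i x <= C i) ->
  \int[iid mu n]_x (\prod_i f i (tnth x i)) <= \prod_i C i.
Proof.
elim: n f C => [|n IHn] f C f0 mf fC.
  rewrite big_ord0; under eq_integral do rewrite big_ord0.
  by rewrite integral_cst//= diracT mule1.
have mprod m (h : 'I_m -> T -> \bar R) : (forall i, measurable_fun setT (h i)) ->
    measurable_fun setT (fun x : m.-tuple T => \prod_i h i (tnth x i)).
  move=> mh; elim: (index_enum _) => [|i s IHs].
    by under eq_fun do rewrite big_nil; exact: measurable_cst.
  under eq_fun do rewrite big_cons.
  by apply: emeasurable_funM => //; apply: measurableT_comp => //; exact: measurable_tnth.
have p0 m (h : 'I_m -> T -> \bar R) x : (forall i x, 0 <= h i x) ->
    0 <= \prod_i h i (tnth x i) by move=> h0; apply: prode_ge0 => i _; exact: h0.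
rewrite /= ge0_integral_distribution; [|exact: mprod|by move=> y; exact: p0].
pose g (z : T * n.-tuple T) := f ord0 z.1 * \prod_i f (lift ord0 i) (tnth z.2 i).
rewrite (_ : _ \o _ = g); last first.
  apply/funext => -[x y]; rewrite /g /= big_ord_recl; congr (_ * _).
  by apply: eq_bigr => i _; rewrite tnthS.
have mg : measurable_fun setT g.
  apply: emeasurable_funM; first exact: measurableT_comp.
  have mt : measurable_fun setT (fun y : n.-tuple T =>
      \prod_i f (lift ord0 i) (tnth y i)) by exact: (mprod _ (fun i => f (lift ord0 i))).
  exact: (measurableT_comp mt measurable_snd).
have g0 z : 0 <= g z by rewrite mule_ge0// (p0 _ (fun i => f (lift ord0 i))).
rewrite fubini_tonelli1//.
rewrite [leLHS](_ : _ = \int[mu]_x (f ord0 x *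
    \int[iid mu n]_y \prod_i f (lift ord0 i) (tnth y i))); last first.
  apply: eq_integral => x _; rewrite /fubini_F /g /=.
  rewrite ge0_integralZl//; first exact: (mprod _ (fun i => f (lift ord0 i))).
  by move=> y _; exact: (p0 _ (fun i => f (lift ord0 i))).
have I0 : 0 <= \int[iid mu n]_y \prod_i f (lift ord0 i) (tnth y i).
  by apply: integral_ge0 => y _; exact: (p0 _ (fun i => f (lift ord0 i))).
rewrite ge0_integralZr// big_ord_recl lee_pmul// ?integral_ge0//.
by apply: (IHn (fun i => f (lift ord0 i)) (fun i => C (lift ord0 i))) => *; auto.
Qed.

End measure_tools.

Section rademacher_bound.
Context {d : measure_display} {T : measurableType d} {R : realType}.
Local Open Scope ereal_scope.

(** Nearly optimal elements can be chosen for all [i] at once, so a bound on every selection bounds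
    the sum of the suprema. *)
Lemma sum_ereal_sup_le (I : finType) (A : I -> set R) (C : R) :
  (forall i, A i !=set0) -> (forall i r, A i r -> 0 <= r)%R ->
  (forall a : I -> R, (forall i, A i (a i)) -> (\sum_i a i <= C)%R) ->
  \sum_i ereal_sup [set r%:E | r in A i] <= C%:E.
Proof.
move=> An A0 AC.
have /choice[a0 ha0] : forall i, exists r, A i r by move=> i; have [r] := An i; exists r.
have supE i : exists r : R, ereal_sup [set r%:E | r in A i] = r%:E.
  exists (fine (ereal_sup [set r%:E | r in A i])); rewrite fineK// fin_numElt.
  apply/andP; split.
    apply: (@lt_le_trans _ _ (a0 i)%:E); first exact: ltNyr.
    by apply: ereal_sup_ubound; exists (a0 i).
  apply: (@le_lt_trans _ _ C%:E); last exact: ltry.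
  apply: ge_ereal_sup => _ [r Air <-]; rewrite lee_fin.
  (* Varying the entry [i] alone, with the nonnegative entries of [a0] elsewhere, shows that each
     supremum is finite. *)
  have := AC (fun j => if j == i then r else a0 j).
  rewrite (bigD1 i)//= eqxx => H.
  apply: le_trans (H _); last by move=> j; case: eqP => [->|_].
  rewrite lerDl sumr_ge0// => j ji; rewrite (negbTE ji); exact: A0 (ha0 j).
have /choice[s hs] := supE.
rewrite (eq_bigr (fun i => (s i)%:E))// sumEFin lee_fin.
apply/ler_addgt0Pr => eps eps0.
have [n0|n0] := posnP #|I|.
  rewrite big_pred0; last by move=> i; have := fintype0 i; rewrite n0.
  have := AC a0 ha0; rewrite big_pred0; last by move=> i; have := fintype0 i; rewrite n0.
  lra.
have eps'0 : (0 < eps / #|I|%:R)%R by rewrite divr_gt0// ltr0n.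
have /choice[a ha] i : exists r, A i r /\ (s i - eps / #|I|%:R < r)%R.
  have := @ub_ereal_sup_adherent _ [set r%:E | r in A i] _ eps'0.
  rewrite hs => /(_ erefl)[_ [r Ar <-]].
  by rewrite -EFinB lte_fin => h; exists r.
apply: (@le_trans _ _ (\sum_i (a i + eps / #|I|%:R))%R).
  by apply: ler_sum => i _; have [_] := ha i; lra.
have -> : (\sum_i (a i + eps / #|I|%:R) = \sum_i a i + eps)%R.
  rewrite big_split /= sumr_const -(mulr_natr (eps / _)) -mulrA mulVf ?mulr1//.
  by rewrite pnatr_eq0 -lt0n.
by rewrite lerD2r; apply: AC => i; have [] := ha i.
Qed.

(** This is where the fixed-sample bounds enter. The constant [c] is the deterministic part left by
    tangent lines and thresholds, and [g] is a measurable majorant of the rest, with average at most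
    [K] per sign pattern. *)
Lemma rademacher_le n (F : set (T -> R)) (mu : probability T R)
    (g : n.-tuple T -> R) (c K : R) :
  F !=set0 -> (0 <= c)%R -> (forall x, 0 <= g x)%R -> measurable_fun setT g ->
  \int[iid mu n]_x (g x)%:E <= (2 ^+ n * K)%:E ->
  (forall (x : n.-tuple T) (f : {ffun 'I_n -> bool} -> T -> R),
     (forall e, F (f e)) ->
     (\sum_e `|rsum (fun i => f e (tnth x i)) e| <= 2 ^+ n * c + g x)%R) ->
  rademacher n F mu <= (n%:R^-1 * (c + K))%:E.
Proof.
move=> [f0 Ff0] c0 g0 mg gK H.
have e2 : (0 < 2 ^+ n :> R)%R by rewrite exprn_gt0.
have n0 : (0 <= n%:R^-1 :> R)%R by rewrite invr_ge0.
apply: (@le_trans _ _ (\int[iid mu n]_x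
    (n%:R^-1 * c + n%:R^-1 * (2 ^+ n)^-1 * g x)%:E)).
  apply: ge0_integral_mono => x.
    apply: mule_ge0; first by rewrite lee_fin invr_ge0 ltW.
    apply: sume_ge0 => e _; apply: (@le_trans _ _ (`|n%:R^-1 *
      (\sum_(i < n) (-1) ^+ e i * f0 (tnth x i))|%R%:E)); first by rewrite lee_fin.
    by apply: ereal_sup_ubound; exists f0.
  pose A (e : {ffun 'I_n -> bool}) : set R :=
    [set `|n%:R^-1 * (\sum_(i < n) (-1) ^+ e i * f (tnth x i))|%R | f in F].
  have hA := @sum_ereal_sup_le _ A (n%:R^-1 * (2 ^+ n * c + g x)).
  rewrite (_ : (n%:R^-1 * c + n%:R^-1 * (2 ^+ n)^-1 * g x)%R =
    ((2 ^+ n)^-1 * (n%:R^-1 * (2 ^+ n * c + g x)))%R); last first.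
    have e20 : (2 ^+ n != 0 :> R)%R by rewrite gt_eqF.
    rewrite [in RHS]mulrCA [in RHS]mulrDr mulKf// mulrDr; congr (_ + _)%R.
    by rewrite mulrA.
  rewrite EFinM lee_wpmul2l ?lee_fin ?invr_ge0 ?(ltW e2)//.
  apply: le_trans (hA _ _ _).
  - apply: lee_sum => e _; apply: ereal_sup_le => _ [f Ff <-].
    by exists `|n%:R^-1 * (\sum_(i < n) (-1) ^+ e i * f (tnth x i))|%R => //; exists f.
  - by move=> e; exists `|n%:R^-1 * (\sum_(i < n) (-1) ^+ e i * f0 (tnth x i))|%R, f0.
  - by move=> e r [f _ <-].
  move=> a ha; have /choice[f hf] : forall e : {ffun 'I_n -> bool}, exists f, F f /\
      (`|n%:R^-1 * (\sum_(i < n) (-1) ^+ e i * f (tnth x i))| = a e)%R.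
    by move=> e; have [f Ff <-] := ha e; exists f.
  rewrite (eq_bigr (fun e => n%:R^-1 * `|rsum (fun i => f e (tnth x i)) e|)%R); last first.
    by move=> e _; have [_ <-] := hf e; rewrite normrM ger0_norm.
  rewrite -mulr_sumr ler_wpM2l//; apply: H => e; by have [] := hf e.
under eq_integral do rewrite EFinD EFinM.
rewrite ge0_integralD//; last 3 first.
- by move=> x _; rewrite lee_fin mulr_ge0.
- by move=> x _; rewrite lee_fin !mulr_ge0// invr_ge0 ltW.
- by apply/measurable_EFinP; apply: measurable_funM.
under [X in _ + X]eq_integral do rewrite EFinM.
rewrite integral_cst// [X in _ * X + _](_ : _ = 1); last exact: probability_setT.
rewrite mule1 ge0_integralZl_EFin; [|by []|by move=> x _; rewrite lee_fin
  |exact/measurable_EFinP|by rewrite mulr_ge0// invr_ge0 ltW].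
apply: (@le_trans _ _ ((n%:R^-1 * c)%:E + (n%:R^-1 * (2 ^+ n)^-1)%:E * (2 ^+ n * K)%:E)).
  by rewrite leeD2l// lee_wpmul2l// lee_fin mulr_ge0// invr_ge0 ltW.
rewrite -EFinM -EFinD lee_fin mulrDr lerD2l le_eqVlt; apply/orP; left; apply/eqP.
by rewrite -mulrA mulKf// gt_eqF.
Qed.

End rademacher_bound.

Section subgaussian_moments.
Context {R : realType} {h : nat}.
Local Notation T := (borel_cV R h).

Lemma measurable_coord (j : 'I_h) :
  measurable_fun [set: T] (fun x : T => (x : 'cV[R]_h) j 0).
Proof.
apply: (@measurability _ _ T _ setT _ (@RGenOpens.G R)).
  exact: RGenOpens.measurableE.
move=> _ [_ [a [b ->] <-]]; rewrite setTI; apply: sub_sigma_algebra.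
have /continuousP : continuous (fun M : 'cV[R]_h => M j 0) := @coord_continuous _ _ _ j 0.
by apply; exact: interval_open.
Qed.

Lemma measurable_dotv (a : 'cV[R]_h) :
  measurable_fun [set: T] (fun x : T => dotv a (x : 'cV[R]_h)).
Proof.
rewrite /dotv; apply: measurable_sum => j.
by apply: measurable_funM => //; exact: measurable_coord.
Qed.

Variables (Gamma : R) (mu : probability T R).
Hypothesis hmu : PuB Gamma mu.

Lemma dotvB (a x y : 'cV[R]_h) : dotv a (x - y) = dotv a x - dotv a y.
Proof.
by rewrite /dotv -sumrB; apply: eq_bigr => i _; rewrite !mxE mulrBr.
Qed.

Lemma mgf_le (a : 'cV[R]_h) :
  (\int[mu]_x (expR (dotv a (x : 'cV[R]_h)))%:E <=
   (expR (dotv a (mean mu) + norm2 a ^+ 2 * Gamma ^+ 2 / 2))%:E)%E.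
Proof.
have [_ _ _ [tau [tau0 tauG H]]] := hmu.
have splitE (x : 'cV[R]_h) : (expR (dotv a x))%:E =
    ((expR (dotv a (mean mu)))%:E * (expR (dotv a (x - mean mu)))%:E)%E.
  by rewrite -EFinM -expRD dotvB addrC subrK.
under eq_integral do rewrite splitE.
have mexp : measurable_fun [set: T]
    (fun x : T => (expR (dotv a ((x : 'cV[R]_h) - mean mu)))%:E).
  apply/measurable_EFinP; apply: measurableT_comp => //.
  under eq_fun do rewrite dotvB.
  by apply: measurable_funB => //; exact: measurable_dotv.
rewrite ge0_integralZl_EFin; [|by []|by move=> x _; rewrite lee_fin expR_ge0|by []|exact: expR_ge0].
rewrite expRD EFinM lee_wpmul2l ?lee_fin ?expR_ge0//.
apply: (le_trans (H a)); rewrite lee_fin ler_expR ler_pM2r ?invr_gt0//.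
rewrite ler_wpM2l ?sqr_ge0// lerXn2r ?nnegrE ?(ltW tau0)//.
exact: le_trans (ltW tau0) tauG.
Qed.

Lemma iid_mgf_le n (e : {ffun 'I_n -> bool}) (a : 'cV[R]_h) :
  (\int[iid mu n]_x
     (expR (rsum (fun i => dotv a (tnth x i : 'cV[R]_h)) e))%:E <=
   (expR (n%:R * (norm2 a ^+ 2 * Gamma ^+ 2 / 2)
          + rsum (fun=> dotv a (mean mu)) e))%:E)%E.
Proof.
pose f (i : 'I_n) (x : T) := (expR ((-1) ^+ e i * dotv a (x : 'cV[R]_h)))%:E.
pose C (i : 'I_n) := (expR ((-1) ^+ e i * dotv a (mean mu) + norm2 a ^+ 2 * Gamma ^+ 2 / 2))%:E.
have := @ge0_integral_iid _ _ _ mu n f C.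
rewrite (_ : (fun x => _) = (fun x =>
  (expR (rsum (fun i => dotv a (tnth x i : 'cV[R]_h)) e))%:E)); last first.
  by apply/funext => x; rewrite /f /rsum expR_sum prodEFin.
rewrite (_ : (\prod_i C i)%E = (expR (n%:R * (norm2 a ^+ 2 * Gamma ^+ 2 / 2)
          + rsum (fun=> dotv a (mean mu)) e))%:E); last first.
  rewrite /C prodEFin -expR_sum big_split /= sumr_const card_ord addrC.
  by rewrite [in RHS]mulr_natl.
apply.
- by move=> i x; rewrite lee_fin expR_ge0.
- move=> i; apply/measurable_EFinP; apply: measurableT_comp => //.
  by apply: measurable_funM => //; exact: measurable_dotv.
move=> i; rewrite /f /C; case: (e i); last first.
  by under eq_integral do rewrite expr0 mul1r; rewrite expr0 mul1r; exact: mgf_le.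
have dN x : (-1) ^+ true * dotv a x = dotv (- a) x.
  by rewrite expr1 mulN1r /dotv -sumrN; apply: eq_bigr => l _; rewrite mxE mulNr.
under eq_integral do rewrite dN.
apply: le_trans (mgf_le _) _; rewrite dN lee_fin ler_expR lerD2l.
rewrite !norm2_sqr le_eqVlt; apply/orP; left; apply/eqP; congr (_ * _ / _).
by apply: eq_bigr => l _; rewrite mxE sqrrN.
Qed.

End subgaussian_moments.

(** * Gaussian averages of exponentials of squares *)

Section gaussian.
Context {R : realType}.

(** Completing the square turns the integrand into a constant times the normal density of mean
    [c * s ^+ 2] and deviation [s]. *)
Lemma integral_normal_expR (s q c : R) : 0 < s -> s ^+ 2 * (1 - 2 * q) = 1 ->
  (\int[lebesgue_measure]_y (normal_pdf 0 1 y * expR (q * y ^+ 2 + c * y))%:E =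
   (s * expR (c ^+ 2 * s ^+ 2 / 2))%:E)%E.
Proof.
move=> s0 sq; have sn0 : s != 0 by rewrite gt_eqF.
have peak : normal_peak 1 = s * normal_peak s.
  rewrite /normal_peak expr1n mul1r -mulrnAr sqrtrM ?sqr_ge0// sqrtr_sqr.
  by rewrite ger0_norm ?(ltW s0)// invfM mulrA mulfV// mul1r.
have pt (y : R) : normal_pdf 0 1 y * expR (q * y ^+ 2 + c * y) =
    s * expR (c ^+ 2 * s ^+ 2 / 2) * normal_pdf (c * s ^+ 2) s y.
  rewrite !normal_pdfE ?oner_eq0// peak /normal_fun.
  rewrite -[LHS]mulrA -[LHS]mulrA -[RHS]mulrA; congr (_ * _).
  rewrite [RHS]mulrCA; congr (_ * _); rewrite -!expRD; congr (expR _).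
  have qE : q = (1 - (s ^+ 2)^-1) / 2.
    suff : (s ^+ 2)^-1 = 1 - 2 * q by move=> ->; lra.
    by apply: (mulfI (_ : s ^+ 2 != 0)); rewrite ?expf_neq0// mulfV ?expf_neq0.
  by rewrite qE subr0 expr1n; field.
under eq_integral do rewrite pt EFinM.
rewrite ge0_integralZl_EFin ?integral_normal_pdf ?mule1//.
- by move=> y _; rewrite lee_fin normal_pdf_ge0.
- by apply/measurable_EFinP; exact: measurable_normal_pdf.
- by rewrite mulr_ge0 ?expR_ge0// ltW.
Qed.

Local Notation pdf := (@normal_pdf R 0 1).
Local Notation s32 := (Num.sqrt (3 / 2) : R).

Section squares.
Context {d : measure_display} {T : measurableType d} (P : probability T R).
Variables (h : nat) (S : 'I_h -> T -> R) (b : 'I_h -> R).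
Hypothesis mS : forall j, measurable_fun setT (S j).
Hypothesis mgfS : forall a : 'I_h -> R,
  (\int[P]_x (expR (\sum_j a j * S j x))%:E <=
   (expR (\sum_j (a j ^+ 2 / 2 + a j * b j)))%:E)%E.

(* [exp (S ^ 2 / 6)] is the average of [exp (g S / sqrt 3)] over a standard Gaussian g,
   so each square is traded for a linear term. *)
Lemma integral_expR_squares :
  (\int[P]_x (expR ((\sum_j S j x ^+ 2) / 6))%:E <=
   (s32 ^+ h * expR ((\sum_j b j ^+ 2) / 4))%:E)%E.
Proof.
have s32_0 : 0 < s32 by rewrite sqrtr_gt0; lra.
pose t3 : R := (Num.sqrt 3)^-1.
have t3E : t3 ^+ 2 = 3^-1 by rewrite /t3 exprVn sqr_sqrtr//; lra.
(* Coordinates below [r] already carry squares, the others keep free coefficients [a]. The induction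
   step puts [y * t3] into coordinate [r] and averages over a Gaussian [y]. *)
pose F r (a : 'I_h -> R) x :=
  \sum_(j < h) (if (j < r)%N then S j x ^+ 2 / 6 else a j * S j x).
pose B r (a : 'I_h -> R) :=
  \sum_(j < h) (if (j < r)%N then b j ^+ 2 / 4 else a j ^+ 2 / 2 + a j * b j).
have mF r a : measurable_fun setT (F r a).
  apply: measurable_sum => j; case: (j < r)%N; last exact: measurable_funM.
  by apply: measurable_funM => //; exact: measurable_funX.
have main r : (r <= h)%N -> forall a,
    (\int[P]_x (expR (F r a x))%:E <= (s32 ^+ r * expR (B r a))%:E)%E.
  elim: r => [_ a|r IHr rh a].
    by rewrite expr0 mul1r; exact: mgfS.
  pose r' := Ordinal rh.
  pose a' y (j : 'I_h) := if j == r' then y * t3 else a j.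
  have rest (f g f' : 'I_h -> R) : (forall j, j != r' -> (if (j < r)%N then f j else g j) =
      (if (j < r.+1)%N then f j else f' j)) ->
      \sum_(j < h) (if (j < r)%N then f j else g j) = g r' +
      (\sum_(j < h) (if (j < r.+1)%N then f j else f' j) - f r').
    move=> H; rewrite (bigD1 r')//= ltnn [X in _ = _ + (X - _)](bigD1 r')//=.
    rewrite ltnSn addrAC subrr add0r; congr (_ + _); exact: eq_bigr.
  have FE y x : F r (a' y) x = y * (t3 * S r' x) + (F r.+1 a x - S r' x ^+ 2 / 6).
    rewrite {1}/F (rest _ _ (fun j => a j * S j x)) /a' ?eqxx ?mulrA// => j jr.
    by rewrite (negbTE jr) ltnS (leq_eqVlt j r); move: jr; rewrite -val_eqE /= => /negbTE ->.
  have BE y : B r (a' y) = ((t3 * y) ^+ 2 / 2 + t3 * y * b r') + (B r.+1 a - b r' ^+ 2 / 4).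
    rewrite {1}/B (rest _ _ (fun j => a j ^+ 2 / 2 + a j * b j)) /a' ?eqxx 1?(mulrC y)// => j jr.
    by rewrite (negbTE jr) ltnS (leq_eqVlt j r); move: jr; rewrite -val_eqE /= => /negbTE ->.
  have gE x : (expR (F r.+1 a x))%:E =
      (\int[lebesgue_measure]_y (pdf y * expR (F r (a' y) x))%:E)%E.
    have := @integral_normal_expR 1 0 (t3 * S r' x) ltr01 ltac:(lra).
    move=> /(congr1 (fun z => (expR (F r.+1 a x - S r' x ^+ 2 / 6))%:E * z)%E).
    rewrite -EFinM mul1r -expRD exprMn t3E.
    rewrite (_ : _ - _ + _ = F r.+1 a x); last by field.
    move=> <-; rewrite -ge0_integralZl_EFin ?expR_ge0//; last 2 first.
    - by move=> y _; rewrite lee_fin mulr_ge0 ?normal_pdf_ge0 ?expR_ge0.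
    - apply/measurable_EFinP; apply: measurable_funM; first exact: measurable_normal_pdf.
      apply: measurableT_comp => //; apply: measurable_funD => //.
        by apply: measurable_funM => //; exact: measurable_funX.
    apply: eq_integral => y _; rewrite -EFinM FE mul0r add0r; congr EFin.
    by rewrite mulrCA -expRD addrC [_ * y]mulrC.
  pose f (z : T * measurableTypeR R) : \bar R := (pdf z.2 * expR (F r (a' z.2) z.1))%:E.
  have mf : measurable_fun setT f.
    apply/measurable_EFinP; apply: measurable_funM.
      apply: measurableT_comp; [exact: measurable_normal_pdf|exact: measurable_snd].
    apply: measurableT_comp => //.
    under eq_fun do rewrite FE.
    apply: measurable_funD; first apply: measurable_funM => //.
      apply: measurable_funM => //; exact: (measurableT_comp (mS r') measurable_fst).
    apply: measurable_funB; first exact: (measurableT_comp (mF r.+1 a) measurable_fst).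
    apply: measurable_funM => //; apply: measurable_funX.
    exact: (measurableT_comp (mS r') measurable_fst).
  have f0 z : (0 <= f z)%E.
    by rewrite lee_fin mulr_ge0 ?normal_pdf_ge0 ?expR_ge0.
  under eq_integral do rewrite gE.
  rewrite (@fubini_tonelli _ _ T (measurableTypeR R) R P lebesgue_measure f mf f0).
  have c0 : 0 <= s32 ^+ r * expR (B r.+1 a - b r' ^+ 2 / 4).
    by rewrite mulr_ge0 ?expR_ge0// exprn_ge0// ltW.
  apply: (@le_trans _ _ (\int[lebesgue_measure]_y
      ((s32 ^+ r * expR (B r.+1 a - b r' ^+ 2 / 4))%:E *
       (pdf y * expR (6^-1 * y ^+ 2 + t3 * b r' * y))%:E))%E).
    apply: ge0_integral_mono => y; first exact: integral_ge0.
    rewrite /f /=; under eq_integral do rewrite EFinM.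
    rewrite ge0_integralZl_EFin; [|by []|by move=> x _; rewrite lee_fin expR_ge0
      |by apply/measurable_EFinP; apply: measurableT_comp|exact: normal_pdf_ge0].
    apply: (@le_trans _ _ ((pdf y)%:E * (s32 ^+ r * expR (B r (a' y)))%:E)%E).
      by rewrite lee_wpmul2l ?lee_fin ?normal_pdf_ge0// IHr// ltnW.
    rewrite -!EFinM lee_fin BE expRD.
    rewrite (_ : (t3 * y) ^+ 2 / 2 + _ = 6^-1 * y ^+ 2 + t3 * b r' * y).
      by rewrite le_eqVlt; apply/orP; left; apply/eqP; ring.
    by rewrite exprMn t3E; field.
  rewrite ge0_integralZl_EFin; [|by []
    |by move=> y _; rewrite lee_fin mulr_ge0 ?normal_pdf_ge0 ?expR_ge0| |by []]; last first.
    apply/measurable_EFinP; apply: measurable_funM; first exact: measurable_normal_pdf.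
    apply: measurableT_comp => //; apply: measurable_funD => //; apply: measurable_funM => //.
  (* The coefficient 1 / 6 of [y ^+ 2] changes the variance to [1 / (1 - 2 / 6) = 3 / 2], hence one
     factor [sqrt (3 / 2)] per coordinate. *)
  rewrite (@integral_normal_expR s32)//; last by rewrite sqr_sqrtr; lra.
  rewrite -EFinM lee_fin exprMn t3E sqr_sqrtr; last by lra.
  rewrite (_ : 3^-1 * b r' ^+ 2 * (3 / 2) / 2 = b r' ^+ 2 / 4); last by field.
  rewrite expRB [in leRHS]exprSr le_eqVlt; apply/orP; left; apply/eqP.
  by field; rewrite gt_eqF// expR_gt0.
have := main h (leqnn h) (fun=> 0).
rewrite /F /B.
under eq_integral => x _ do under eq_bigr do rewrite ltn_ord.
by under eq_bigr do rewrite ltn_ord; rewrite -!mulr_suml;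
  under eq_integral do rewrite -mulr_suml.
Qed.

End squares.

(** The same Gaussian trade for the sum of the signs, which is what multiplies the mean of the
    sample. A standard Gaussian [Z] satisfies [E (expR (Z ^+ 2 / 4)) = sqrt 2]. *)
Lemma sum_signs_expR_square n : (0 < n)%N ->
  \sum_(e : {ffun 'I_n -> bool}) expR ((rsum (fun=> 1) e) ^+ 2 / (4 * n%:R)) <=
  2 ^+ n * Num.sqrt 2 :> R.
Proof.
move=> n0; have nR : 0 < n%:R :> R by rewrite ltr0n.
pose w : R := (Num.sqrt (2 * n%:R))^-1.
have wE : w ^+ 2 = (2 * n%:R)^-1 by rewrite /w exprVn sqr_sqrtr// mulr_ge0// ltW.
pose k (e : {ffun 'I_n -> bool}) : R := rsum (fun=> 1) e.
have kE (e : {ffun 'I_n -> bool}) : (expR (k e ^+ 2 / (4 * n%:R)))%:E =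
    (\int[lebesgue_measure]_y (pdf y * expR (0 * y ^+ 2 + k e * w * y))%:E)%E.
  rewrite (@integral_normal_expR 1)//; last by lra.
  rewrite mul1r exprMn wE; congr (expR _)%:E; by field; rewrite gt_eqF.
suff : ((\sum_(e : {ffun 'I_n -> bool}) expR (k e ^+ 2 / (4 * n%:R)))%:E <=
    (2 ^+ n * Num.sqrt 2)%:E)%E by rewrite lee_fin.
rewrite -sumEFin; under eq_bigr do rewrite kE.
rewrite -ge0_integral_sum//; last 2 first.
- move=> e; apply/measurable_EFinP; apply: measurable_funM; first exact: measurable_normal_pdf.
  apply: measurableT_comp => //; apply: measurable_funD => //; apply: measurable_funM => //.
- by move=> e y _; rewrite lee_fin mulr_ge0 ?normal_pdf_ge0 ?expR_ge0.
apply: (@le_trans _ _ (\int[lebesgue_measure]_y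
    ((2 ^+ n)%:E * (pdf y * expR (4^-1 * y ^+ 2 + 0 * y))%:E))%E).
  apply: ge0_integral_mono => y.
    by apply: sume_ge0 => e _; rewrite lee_fin mulr_ge0 ?normal_pdf_ge0 ?expR_ge0.
  rewrite sumEFin -EFinM lee_fin -mulr_sumr [leRHS]mulrCA ler_wpM2l ?normal_pdf_ge0//.
  have := sum_signs_expR (fun _ : 'I_n => w * y).
  rewrite sumr_const card_ord -(mulr_natr ((w * y) ^+ 2)) exprMn wE.
  rewrite (_ : (2 * n%:R)^-1 * _ * _ / 2 = 4^-1 * y ^+ 2 + 0 * y); last first.
    by field; rewrite gt_eqF.
  apply: le_trans; rewrite le_eqVlt; apply/orP; left; apply/eqP.
  apply: eq_bigr => e _; congr expR.
  rewrite mul0r add0r -mulrA mulrC /k -rsumZ.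
  by apply: eq_bigr => i _; rewrite mulr1.
rewrite ge0_integralZl_EFin; [|by []
  |by move=> y _; rewrite lee_fin mulr_ge0 ?normal_pdf_ge0 ?expR_ge0| |by rewrite exprn_ge0];
  last first.
  apply/measurable_EFinP; apply: measurable_funM; first exact: measurable_normal_pdf.
  apply: measurableT_comp => //; apply: measurable_funD => //; apply: measurable_funM => //.
rewrite (@integral_normal_expR (Num.sqrt 2)) ?sqrtr_gt0//.
  by rewrite expr0n /= !mul0r expR0 mulr1.
by rewrite sqr_sqrtr//; lra.
Qed.

End gaussian.

(** * Part (I) *)

Section samples.
Context {R : realType} {h n : nat}.
Local Notation T := (borel_cV R h).
Local Notation signs := {ffun 'I_n -> bool}.
Variables (Gamma : R) (mu : probability T R).
Hypotheses (hn : (0 < n)%N) (hGamma : 0 < Gamma) (hmu : PuB Gamma mu).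

(** In this unit every coordinate of the signed sample has variance proxy 1 around its mean, and the
    relative mean has Euclidean norm at most 1. *)
Definition sample_scale : R := Gamma * Num.sqrt n%:R.

Definition signed_sample (x : n.-tuple T) (e : signs) (j : 'I_h) : R :=
  rsum (fun i => (tnth x i : 'cV[R]_h) j 0) e / sample_scale.

Definition rel_mean (j : 'I_h) : R := mean mu j 0 / Gamma.

Let c0 : 0 < sample_scale.
Proof. by rewrite mulr_gt0// sqrtr_gt0 ltr0n. Qed.

Lemma rel_mean_le1 : \sum_j rel_mean j ^+ 2 <= 1.
Proof.
have [_ _ m1 _] := hmu.
under eq_bigr do rewrite exprMn.
rewrite -mulr_suml -norm2_sqr exprVn ler_pdivrMr ?exprn_gt0// mul1r.
by rewrite lerXn2r ?nnegrE ?norm2_ge0// ltW.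
Qed.

Lemma measurable_signed_sample e j :
  measurable_fun setT (fun x => signed_sample x e j).
Proof.
apply: measurable_funM => //; apply: measurable_sum => i.
apply: measurable_funM => //.
exact: (measurableT_comp (measurable_coord j) (measurable_tnth i)).
Qed.

Lemma signed_sample_mgf e (a : 'I_h -> R) :
  (\int[iid mu n]_x (expR (\sum_j a j * signed_sample x e j))%:E <=
   (expR (\sum_j (a j ^+ 2 / 2 +
      a j * (rsum (fun=> 1) e / Num.sqrt n%:R * rel_mean j))))%:E)%E.
Proof.
pose al : 'cV[R]_h := \col_j (a j / sample_scale).
have := iid_mgf_le hmu e al.
rewrite (_ : n%:R * _ + _ = \sum_j (a j ^+ 2 / 2 +
      a j * (rsum (fun=> 1) e / Num.sqrt n%:R * rel_mean j))); last first.
  rewrite big_split /=; congr (_ + _).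
    rewrite norm2_sqr [LHS](_ : _ = (\sum_i al i 0 ^+ 2) * (sample_scale ^+ 2 / 2)).
      rewrite mulr_suml; apply: eq_bigr => j _; rewrite mxE.
      by field; rewrite gt_eqF.
    by rewrite /sample_scale exprMn sqr_sqrtr ?ler0n//; ring.
  rewrite (_ : rsum _ e = dotv al (mean mu) * rsum (fun=> 1) e); last first.
    by rewrite -rsumZ; apply: eq_bigr => i _; rewrite mulr1.
  rewrite /dotv mulr_suml; apply: eq_bigr => j _.
  rewrite mxE /rel_mean /sample_scale.
  by field; rewrite !gt_eqF// sqrtr_gt0 ltr0n.
apply: le_trans; rewrite le_eqVlt; apply/orP; left; apply/eqP.
apply: eq_integral => x _; congr (expR _)%:E.
rewrite /dotv rsum_sum; apply: eq_bigr => j _.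
rewrite rsumZ mxE /signed_sample; by field; rewrite gt_eqF.
Qed.

Lemma integral_sum_expR_squares :
  (\int[iid mu n]_x (\sum_e expR ((\sum_j signed_sample x e j ^+ 2) / 6))%:E <=
   (2 ^+ n * (Num.sqrt (3 / 2) ^+ h * Num.sqrt 2))%:E)%E.
Proof.
have mS e : measurable_fun setT
    (fun x : n.-tuple T => (expR ((\sum_j signed_sample x e j ^+ 2) / 6))%:E).
  apply/measurable_EFinP; apply: measurableT_comp => //.
  apply: measurable_funM => //; apply: measurable_sum => j.
  by apply: measurable_funX; exact: measurable_signed_sample.
under eq_integral do rewrite -sumEFin.
rewrite ge0_integral_sum; [|by []|exact: mS|by move=> e x _; rewrite lee_fin expR_ge0].
apply: (@le_trans _ _ (\sum_(e : signs) (Num.sqrt (3 / 2) ^+ h *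
    expR ((rsum (fun=> 1) e) ^+ 2 / (4 * n%:R)))%:E)%E).
  apply: lee_sum => e _.
  have := integral_expR_squares (fun j => measurable_signed_sample e j) (signed_sample_mgf e).
  move=> /le_trans; apply; rewrite lee_fin ler_wpM2l ?exprn_ge0 ?sqrtr_ge0// ler_expR.
  under eq_bigr do rewrite exprMn.
  rewrite -mulr_sumr exprMn exprVn sqr_sqrtr ?ler0n//.
  rewrite (_ : rsum _ e ^+ 2 / (4 * n%:R) = rsum (fun=> 1) e ^+ 2 / n%:R * 1 / 4); last first.
    by field; rewrite gt_eqF// ltr0n.
  rewrite ler_pM2r; last by lra.
  by rewrite ler_wpM2l ?rel_mean_le1// divr_ge0 ?sqr_ge0// ler0n.
rewrite sumEFin lee_fin -mulr_sumr mulrCA ler_wpM2l ?exprn_ge0 ?sqrtr_ge0//.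
exact: sum_signs_expR_square.
Qed.

End samples.

(** Jensen's inequality in linear form: an average of [y] is at most [ell / la] once the average of
    [expR (la * y)] is at most [expR ell]. *)
Lemma le_exp_tangent {R : realType} (la ell y : R) : 0 < la ->
  y <= (ell - 1 + expR (la * y - ell)) / la.
Proof.
move=> la0; rewrite ler_pdivlMr//.
by have := expR_ge1Dx (la * y - ell); lra.
Qed.

Lemma convex_incr_expR {R : realType} (la : R) : 0 <= la ->
  convex_incr (fun y => expR (la * y)).
Proof.
move=> la0; split=> [x y xy|u v t uv t0]; first by rewrite ler_expR ler_wpM2l.
rewrite !mulrDr !expRD -subr_ge0.
rewrite (_ : _ - _ = (expR (la * v) - expR (la * u)) * (expR (la * t) - 1)); last by ring.
by rewrite mulr_ge0// subr_ge0 ?ler_expR ?ler_wpM2l// -expR0 ler_expR mulr_ge0.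
Qed.

Section part_F.
Context {R : realType} {n d : nat} {k : nat -> nat}.
Variables (sigma : nat -> R -> R) (L M : nat -> R) (Gamma : R).
Variable mu : probability (borel_cV R (k 1%N)) R.
Hypotheses (hn : (0 < n)%N) (hG : 0 < Gamma) (hmu : PuB Gamma mu).
Hypotheses (M0 : forall i, (1 <= i <= d.+1)%N -> 0 < M i)
  (L0 : forall i, (1 <= i < d.+1)%N -> 0 < L i)
  (sL : forall i, (1 <= i < d.+1)%N -> forall x y,
     `|sigma i x - sigma i y| <= L i * `|x - y|)
  (sa : forall i, (1 <= i < d.+1)%N -> forall a x, 0 < a ->
     sigma i (a * x) = a * sigma i x).
Local Notation signs := {ffun 'I_n -> bool}.
Local Notation family := (forall i : nat, 'M[R]_(k i.+1, k i)).
Local Notation c0 := (@sample_scale R n Gamma).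
Local Notation scale j := (c0 * \prod_(1 <= i < j.+1) (M i * L i)).

Let c0_gt0 : 0 < c0.
Proof. by rewrite mulr_gt0// sqrtr_gt0 ltr0n. Qed.

Let scale_gt0 j : (j <= d)%N -> 0 < scale j.
Proof.
move=> jd; rewrite mulr_gt0// big_nat_cond; apply: prodr_gt0 => i.
rewrite andbT ltnS => /andP[i1 ij].
by rewrite mulr_gt0 ?M0 ?L0 ?i1//= ?ltnS (leq_trans ij)// (leq_trans jd).
Qed.

Let P (V : family) := forall i, (1 <= i < d.+1)%N -> frobenius (V i) <= M i.

Lemma layers_F (la : R) (x : n.-tuple (borel_cV R (k 1%N))) j : 0 <= la -> (j <= d)%N ->
  forall Vs : signs -> family, (forall e, P (Vs e)) ->
  \sum_e expR (la * (norm2 (lvec sigma (tnth x) (Vs e) j e) / scale j)) <=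
  2 ^+ j * \sum_e expR (la * Num.sqrt (\sum_l signed_sample Gamma x e l ^+ 2)).
Proof.
move=> la0; elim: j => [_ Vs _|j IHj jd].
  rewrite expr0 mul1r big_geq// mulr1 le_eqVlt; apply/orP; left; apply/eqP.
  apply: eq_bigr => e _; congr (expR (la * _)).
  rewrite -[X in _ / X](@gtr0_norm _ c0)// -sqrtr_sqr -sqrtrV ?sqr_ge0//.
  rewrite -sqrtrM; last by apply: sumr_ge0 => l _; exact: sqr_ge0.
  congr Num.sqrt; rewrite mulr_suml; apply: eq_bigr => l _.
  rewrite (_ : lvec _ _ _ _ _ l 0 = rsum (fun i => (tnth x i : 'cV[R]_(k 1)) l 0) e).
    by rewrite /signed_sample; field; rewrite gt_eqF.
  by rewrite mxE.
move=> Vs PV; rewrite exprS -mulrA big_nat_recr//= mulrA.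
apply: (@layer_step_F _ _ _ sigma (tnth x) P j (scale j) (M j.+1) (L j.+1)
  (fun y => expR (la * y))) => //.
- by rewrite scale_gt0// ltnW.
- by rewrite M0//= ltnS ltnW.
- by rewrite L0.
- by move=> V; apply.
- exact: sL.
- exact: sa.
- exact: convex_incr_expR.
- by apply: IHj; exact: ltnW.
Qed.

Lemma rademacher_F :
  (rademacher n (nn_class sigma (weights_F k d.+1 M)) mu <=
   (Gamma * (\prod_(1 <= i < d.+2) M i) * (\prod_(1 <= i < d.+1) L i)
     * Num.sqrt (6 * d.+1%:R * ln 2 + 5 * (k 1%N)%:R / 4)
     / Num.sqrt n%:R)%:E)%E.
Proof.
(* The target is [sqrt (6 * D)]. The fraction 5 / 24 is a rational upper bound for [ln (3 / 2) / 2],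
   the cost of one input coordinate. *)
pose D : R := d.+1%:R * ln 2 + 5 * (k 1%N)%:R / 24.
have ln2_gt : 1 / 2 < ln 2 :> R.
  rewrite -ltr_expR lnK ?posrE//.
  have := @expR_le_pade R (1 / 2) ltac:(lra); lra.
(* This makes the constant term [2 * D - 1] of the tangent bound nonnegative. *)
have D0 : 1 / 2 < D.
  apply: (@lt_le_trans _ _ (ln 2)) => //.
  apply: (@le_trans _ _ (d.+1%:R * ln 2)); first by rewrite ler_peMl ?ler1n//; lra.
  by rewrite lerDl divr_ge0// mulr_ge0.
(* The minimiser of [(3 / 2 * la ^+ 2 + D) / la]; the minimum is [3 * la], and the numerator is then
   [2 * D], the point of tangency. *)
pose la : R := Num.sqrt (2 * D / 3).
have la0 : 0 < la by rewrite sqrtr_gt0; lra.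
have la2 : la ^+ 2 = 2 * D / 3 by rewrite sqr_sqrtr; lra.
pose B : R := c0 * (\prod_(1 <= i < d.+2) M i) * (\prod_(1 <= i < d.+1) L i).
have BE : B = scale d * M d.+1.
  by rewrite /B big_nat_recr//= big_split /=; ring.
have B0 : 0 < B by rewrite BE mulr_gt0 ?scale_gt0 ?M0//=.
have -> : Gamma * (\prod_(1 <= i < d.+2) M i) * (\prod_(1 <= i < d.+1) L i)
     * Num.sqrt (6 * d.+1%:R * ln 2 + 5 * (k 1%N)%:R / 4) / Num.sqrt n%:R =
     n%:R^-1 * (B / la * (2 * D - 1) + B / la).
  have -> : Num.sqrt (6 * d.+1%:R * ln 2 + 5 * (k 1%N)%:R / 4) = 3 * la.
    rewrite (_ : _ + _ = (3 * la) ^+ 2); last by rewrite exprMn la2 /D; field.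
    by rewrite sqrtr_sqr ger0_norm// mulr_ge0// ltW.
  have s0 : 0 < Num.sqrt n%:R :> R by rewrite sqrtr_gt0 ltr0n.
  rewrite (_ : 2 * D = 3 * la ^+ 2); last by rewrite la2; field.
  rewrite (_ : n%:R = Num.sqrt n%:R ^+ 2 :> R); last by rewrite sqr_sqrtr.
  rewrite [Num.sqrt (_ ^+ 2)]sqrtr_sqr (gtr0_norm s0) /B /sample_scale.
  by field; rewrite !gt_eqF.
have Kle : 2 ^+ d * expR (3 / 2 * la ^+ 2) * (Num.sqrt (3 / 2) ^+ k 1%N * Num.sqrt 2)
    <= expR (2 * D).
  rewrite (_ : 2 * D = 3 / 2 * la ^+ 2 + (5 / 24 * (k 1%N)%:R + d.+1%:R * ln 2)); last first.
    by rewrite la2 /D; field.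
  have E1 : Num.sqrt (3 / 2) ^+ k 1%N <= expR (5 / 24 * (k 1%N)%:R) :> R.
    rewrite expRM_natr lerXn2r ?nnegrE ?sqrtr_ge0 ?expR_ge0//.
    rewrite -[leRHS]ger0_norm ?expR_ge0// -sqrtr_sqr ler_wsqrtr// -expRM_natl.
    have := @expR_ge_quadratic R (2 * (5 / 24)) ltac:(lra); lra.
  (* There are only [d] hidden layers at depth [d.+1], so one factor 2 is left to cover the [sqrt 2]
     caused by the mean. *)
  have E2 : 2 ^+ d * Num.sqrt 2 <= expR (d.+1%:R * ln 2) :> R.
    rewrite expRM_natl lnK ?posrE// exprSr ler_pM2l ?exprn_gt0//.
    rewrite -[leRHS]ger0_norm// -sqrtr_sqr ler_wsqrtr//; lra.
  rewrite !expRD (_ : _ * _ * _ = expR (3 / 2 * la ^+ 2) *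
    (Num.sqrt (3 / 2) ^+ k 1%N * (2 ^+ d * Num.sqrt 2))); last by ring.
  rewrite ler_pM2l ?expR_gt0// ler_pM// ?mulr_ge0 ?exprn_ge0 ?sqrtr_ge0//.
pose g (x : n.-tuple (borel_cV R (k 1%N))) : R :=
  B / la * (2 ^+ d * expR (3 / 2 * la ^+ 2 - 2 * D)) *
  \sum_e expR ((\sum_j signed_sample Gamma x e j ^+ 2) / 6).
have Bla : 0 <= B / la by rewrite divr_ge0// ltW.
have th0 : 0 <= B / la * (2 ^+ d * expR (3 / 2 * la ^+ 2 - 2 * D)).
  by rewrite mulr_ge0// mulr_ge0 ?expR_ge0 ?exprn_ge0.
have mE : measurable_fun setT (fun x : n.-tuple (borel_cV R (k 1%N)) =>
    \sum_e expR ((\sum_j signed_sample Gamma x e j ^+ 2) / 6)).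
  apply: measurable_sum => e; apply: measurableT_comp => //.
  apply: measurable_funM => //; apply: measurable_sum => j.
  by apply: measurable_funX; exact: measurable_signed_sample.
apply: (@rademacher_le _ _ _ _ _ _ g).
- pose w0 : @weights R k d.+1 := @Weights R k d.+1 (fun=> 0) 0.
  exists (network sigma w0); exists w0 => //.
  split=> [i id|] /=.
    rewrite /frobenius big1 ?sqrtr0 ?ltW ?M0//; first by have /andP[-> /ltnW ->] := id.
    by move=> i1 _; rewrite big1// => j _; rewrite mxE expr0n.
  by rewrite /norm2 big1 ?sqrtr0 ?ltW ?M0//= => i _; rewrite mxE expr0n.
- by rewrite mulr_ge0//; lra.
- by move=> x; rewrite mulr_ge0// sumr_ge0// => e _; exact: expR_ge0.
- exact: measurable_funM.
- under eq_integral do rewrite EFinM.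
  rewrite ge0_integralZl_EFin; [|by []
    |by move=> x _; rewrite lee_fin sumr_ge0// => e _; exact: expR_ge0
    |exact/measurable_EFinP|by []].
  apply: le_trans (lee_wpmul2l _ (integral_sum_expR_squares hn hG hmu)) _.
    by rewrite lee_fin.
  rewrite -EFinM lee_fin -[leLHS]mulrA [leRHS]mulrC ler_wpM2l//.
  rewrite mulrCA -[leRHS]mulr1 ler_wpM2l ?exprn_ge0//.
  by rewrite expRB mulrA mulrAC ler_pdivrMr ?expR_gt0// mul1r.
move=> x f hf.
have /choice[w hw] : forall e : signs, exists w : @weights R k d.+1,
    weights_F k d.+1 M w /\ network sigma w = f e.
  by move=> e; have [w Pw <-] := hf e; exists w.
have PV e : P (W (w e)) by have [[]] := hw e.
have := @layers_F la x d (ltW la0) (leqnn d) (fun e => W (w e)) PV.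
set A := \sum_e expR (la * Num.sqrt _); move=> hA.
have AE : A <= expR (3 / 2 * la ^+ 2) *
    \sum_e expR ((\sum_j signed_sample Gamma x e j ^+ 2) / 6).
  rewrite mulr_sumr; apply: ler_sum => e _; rewrite -expRD ler_expR.
  set s := \sum_j _; have s0 : 0 <= s by apply: sumr_ge0 => j _; exact: sqr_ge0.
  (* Expanded, this is [la * sqrt s <= 3 / 2 * la ^+ 2 + s / 6], with the coefficient 1 / 6 of
     [integral_expR_squares]. *)
  have := sqr_ge0 (3 * la - Num.sqrt s).
  rewrite sqrrB sqr_sqrtr//; lra.
have pt (e : signs) : `|rsum (fun i => f e (tnth x i)) e| <=
    B / la * (2 * D - 1) + B / la * expR (- (2 * D)) *
    expR (la * (norm2 (lvec sigma (tnth x) (W (w e)) d e) / scale d)).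
  have [[_ wl] <-] := hw e.
  rewrite rsum_dotv; apply: (le_trans (dotv_le _ _)).
  apply: (@le_trans _ _ (B * (norm2 (lvec sigma (tnth x) (W (w e)) d e) / scale d))).
    set X := norm2 (lvec _ _ _ _ _); set q := scale d.
    have q0 : 0 < q by exact: scale_gt0.
    rewrite BE -/q (_ : q * M d.+1 * (X / q) = M d.+1 * X); last by field; rewrite gt_eqF.
    by rewrite ler_wpM2r// norm2_ge0.
  set y := norm2 _ / _; have := @le_exp_tangent R la (2 * D) y la0.
  rewrite -(ler_pM2l B0) => /le_trans; apply; rewrite expRB expRN.
  rewrite le_eqVlt; apply/orP; left; apply/eqP.
  by field; rewrite !gt_eqF// expR_gt0.
apply: (le_trans (ler_sum _ (fun e _ => pt e))).
rewrite big_split /= sumr_const card_ffun card_bool card_ord -(mulr_natl (B / la * _)) natrX lerD2l.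
rewrite -mulr_sumr /g expRD.
set Q := \sum_e expR (_ / 6) in AE *.
apply: (@le_trans _ _ (B / la * expR (- (2 * D)) * (2 ^+ d * (expR (3 / 2 * la ^+ 2) * Q)))).
  apply: ler_wpM2l; first exact: mulr_ge0 Bla (expR_ge0 _).
  apply: (le_trans hA).
  by rewrite ler_wpM2l ?exprn_ge0.
rewrite le_eqVlt; apply/orP; left; apply/eqP; ring.
Qed.

End part_F.

(** * Hinge functions through a layer *)

Section convex_functions.
Context {R : realType}.
Implicit Types (G : R -> R) (t y a b : R).

Definition hinge t y : R := Num.max 0 (y - t).

Lemma hinge_ge0 t y : 0 <= hinge t y.
Proof. by rewrite /hinge le_max lexx. Qed.

Lemma hinge_ge t y : y - t <= hinge t y.
Proof. by rewrite /hinge le_max lexx orbT. Qed.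

Lemma hinge_mid t0 t1 a b :
  hinge ((t0 + t1) / 2) ((a + b) / 2) <= hinge t0 a / 2 + hinge t1 b / 2.
Proof.
have := hinge_ge t0 a; have := hinge_ge t1 b; have := hinge_ge0 t0 a.
by have := hinge_ge0 t1 b; rewrite {5}/hinge ge_max => *; apply/andP; split; lra.
Qed.

Lemma convex_incr_hinge t : convex_incr (hinge t).
Proof.
split=> [x y xy|u v s uv s0].
  rewrite {1}/hinge ge_max hinge_ge0 /=.
  by apply: le_trans (hinge_ge t y); rewrite lerD2r.
by rewrite /hinge; case: (lerP 0 (u + s - t)); case: (lerP 0 (v - t));
  case: (lerP 0 (v + s - t)); case: (lerP 0 (u - t)); lra.
Qed.

Lemma convex_incrD G G' : convex_incr G -> convex_incr G' ->
  convex_incr (fun y => G y + G' y).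
Proof.
move=> [Gh Gc] [Gh' Gc']; split=> [x y xy|u v s uv s0].
  by rewrite lerD ?Gh ?Gh'.
by have := Gc _ _ _ uv s0; have := Gc' _ _ _ uv s0; lra.
Qed.

Lemma convex_incrZ c G : 0 <= c -> convex_incr G -> convex_incr (fun y => c * G y).
Proof.
move=> c0 [Gh Gc]; split=> [x y xy|u v s uv s0]; first by rewrite ler_wpM2l ?Gh.
by rewrite -!mulrDr ler_wpM2l// Gc.
Qed.

Definition ch y : R := (expR y + expR (- y)) / 2.

Lemma ch_ge1 y : 1 <= ch y.
Proof.
have := expR_ge1Dx y; have := expR_ge1Dx (- y); rewrite /ch; lra.
Qed.

Lemma expR_abs_le_ch y : expR `|y| <= 2 * ch y.
Proof.
rewrite /ch; have := expR_ge0 y; have := expR_ge0 (- y).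
by case: (ger0P y) => _; lra.
Qed.

Lemma measurable_ch : measurable_fun setT ch.
Proof.
apply: measurable_funM => //; apply: measurable_funD => //.
by apply: measurableT_comp => //; exact: measurable_oppr.
Qed.

End convex_functions.

Section part_1oo.
Context {R : realType} {n d : nat} {k : nat -> nat}.
Variables (sigma : nat -> R -> R) (L M : nat -> R) (Gamma : R).
Variable mu : probability (borel_cV R (k 1%N)) R.
Hypotheses (hn : (0 < n)%N) (hG : 0 < Gamma) (hmu : PuB Gamma mu).
Hypotheses (hk : forall i, (1 <= i <= d.+1)%N -> (0 < k i)%N)
  (M0 : forall i, (1 <= i <= d.+1)%N -> 0 < M i)
  (L0 : forall i, (1 <= i < d.+1)%N -> 0 < L i)
  (sh : forall i, (1 <= i < d.+1)%N -> {homo sigma i : x y / x <= y})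
  (sL : forall i, (1 <= i < d.+1)%N -> forall x y,
     `|sigma i x - sigma i y| <= L i * `|x - y|)
  (s0 : forall i, (1 <= i < d.+1)%N -> sigma i 0 = 0).
Local Notation signs := {ffun 'I_n -> bool}.
Local Notation family := (forall i : nat, 'M[R]_(k i.+1, k i)).
Local Notation c0 := (@sample_scale R n Gamma).
Local Notation scale j := (c0 * \prod_(1 <= i < j.+1) (M i * L i)).
Local Notation T := (borel_cV R (k 1%N)).

Let c0_gt0 : 0 < c0.
Proof. by rewrite mulr_gt0// sqrtr_gt0 ltr0n. Qed.

Let scale_gt0 j : (j <= d)%N -> 0 < scale j.
Proof.
move=> jd; rewrite mulr_gt0// big_nat_cond; apply: prodr_gt0 => i.
rewrite andbT ltnS => /andP[i1 ij].
by rewrite mulr_gt0 ?M0 ?L0 ?i1//= ?ltnS (leq_trans ij)// (leq_trans jd).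
Qed.

Let P (V : family) := forall i, (1 <= i < d.+1)%N -> norm_1oo (V i) <= M i.

Definition layer_bound (x : n.-tuple T) j (G : R -> R) (C : R) :=
  forall (Vs : signs -> family) (rs : signs -> 'I_(k j.+1)), (forall e, P (Vs e)) ->
  \sum_e G (`|lsum sigma (tnth x) (Vs e) e (rs e)| / scale j) <= C.

Variable x : n.-tuple T.

(** The selected coordinate depends on [e], so it is dominated by the sum over all coordinates; this
    is the origin of [ln h]. *)
Lemma layer_bound0 G : (forall y, 0 <= G y) ->
  layer_bound x 0 G (\sum_e \sum_l G `|signed_sample Gamma x e l|).
Proof.
move=> G0 Vs rs _; apply: ler_sum => e _.
rewrite big_geq// mulr1 (bigD1 (rs e))//= -[leLHS]addr0 lerD ?sumr_ge0//.
by rewrite /signed_sample normrM (@gtr0_norm _ c0^-1) ?invr_gt0.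
Qed.

Lemma layer_boundS j G G1 G2 C : (j < d)%N ->
  {homo G : y z / y <= z} -> {homo G1 : y z / y <= z} ->
  convex_incr G2 -> (forall y, 0 <= G2 y) ->
  (forall a b, 0 <= a -> 0 <= b -> G ((a + b) / 2) <= G1 a + G2 b) ->
  layer_bound x j (fun y => G1 y + 2 * G2 y) C -> layer_bound x j.+1 G C.
Proof.
move=> jd Gh G1h G2c G20 GG H Vs rs PV.
rewrite big_nat_recr//= mulrA.
apply: (@layer_step_1oo _ _ _ sigma (tnth x) P j (scale j) (M j.+1) (L j.+1)
  G G1 G2 C) => //.
- by rewrite scale_gt0// ltnW.
- by rewrite M0//= ltnS ltnW.
- by rewrite L0.
- by rewrite hk//= ltnS ltnW.
- by move=> V; apply.
- exact: sh.
- exact: sL.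
- exact: s0.
Qed.

Lemma layer_bound_mono j G G' C C' : C <= C' -> (forall y, 0 <= y -> G' y <= G y) ->
  (j <= d)%N -> layer_bound x j G C -> layer_bound x j G' C'.
Proof.
move=> CC GG jd H Vs rs PV; apply: le_trans CC; apply: le_trans (H Vs rs PV).
by apply: ler_sum => e _; apply: GG; rewrite divr_ge0// ltW// scale_gt0.
Qed.

Lemma layer_boundZ j G C c : 0 <= c -> layer_bound x j G C ->
  layer_bound x j (fun y => c * G y) (c * C).
Proof. by move=> c_0 H Vs rs PV; rewrite -mulr_sumr ler_wpM2l ?H. Qed.

Lemma layer_boundD j G C c : layer_bound x j G C ->
  layer_bound x j (fun y => c + G y) (2 ^+ n * c + C).
Proof.
move=> H Vs rs PV; rewrite big_split /= lerD ?H//.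
by rewrite sumr_const card_ffun card_bool card_ord -(mulr_natl c) natrX.
Qed.

(** With [u] and [v] the exponentials at half the arguments, [u * v] is at most
    [p * u ^+ 2 + r * v ^+ 2] whenever [4 * p * r = 1]. The cost [p + 2 * r] is least at
    [p = sqrt 2 / 2], where it equals [sqrt 2]. *)
Lemma layer_bound_expR j la C : (j <= d)%N -> 0 <= la ->
  layer_bound x 0 (fun y => expR (la * y)) C ->
  layer_bound x j (fun y => expR (la * y)) (Num.sqrt 2 ^+ j * C).
Proof.
move=> jd la0 H; elim: j jd => [_|j IHj jd]; first by rewrite expr0 mul1r.
have s2 : 0 < Num.sqrt 2 :> R by rewrite sqrtr_gt0.
have s2E : Num.sqrt 2 ^+ 2 = 2 :> R by rewrite sqr_sqrtr.
have s2V : Num.sqrt 2 / 2 = (Num.sqrt 2)^-1 :> R.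
  by apply: (mulfI (lt0r_neq0 s2)); rewrite mulrA -expr2 s2E divff// mulfV ?gt_eqF.
have eh := (convex_incr_expR la0).1.
apply: (layer_boundS (G1 := fun y => Num.sqrt 2 / 2 * expR (la * y))
  (G2 := fun y => (2 * Num.sqrt 2)^-1 * expR (la * y))) => //.
- by move=> y z /eh; rewrite ler_pM2l// divr_gt0.
- by apply: convex_incrZ; [rewrite invr_ge0 mulr_ge0// ltW|exact: convex_incr_expR].
- move=> a b _ _; rewrite (_ : la * ((a + b) / 2) = la * a / 2 + la * b / 2); last by field.
  rewrite expRD; set u := expR _; set v := expR _.
  have -> : expR (la * a) = u ^+ 2 by rewrite /u -expRM_natl; congr expR; field.
  have -> : expR (la * b) = v ^+ 2 by rewrite /v -expRM_natl; congr expR; field.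
  have := sqr_ge0 (Num.sqrt 2 * u - v); rewrite sqrrB exprMn s2E => h.
  rewrite -subr_ge0 (_ : _ - _ = (2 * Num.sqrt 2)^-1 *
    (2 * u ^+ 2 - Num.sqrt 2 * u * v *+ 2 + v ^+ 2)).
    by rewrite mulr_ge0// invr_ge0 mulr_ge0// ltW.
  by rewrite s2V; field; rewrite gt_eqF.
have := layer_boundZ (ltW s2) (IHj (ltnW jd)).
rewrite mulrA -exprS; apply: layer_bound_mono => //; last exact: ltnW.
move=> y _; rewrite mulrA -mulrDl ler_wpM2r ?expR_ge0// invfM mulrA mulfV// mul1r -s2V.
lra.
Qed.

(** The identity half of the activation passes on weight 1 / 2 with the first threshold, the
    contraction half weight [2 * (1 / 2) = 1] with the next one. Iterating, the weights after [j]
    layers are the coefficients of [(1 / 2 + z) ^+ j], and the constant is the binomial average of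
    the thresholds. *)
Lemma layer_bound_hinge1 j t0 t1 C : (j < d)%N ->
  layer_bound x j (fun y => 1 / 2 * hinge t0 y + hinge t1 y) C ->
  layer_bound x j.+1 id (2 ^+ n * ((t0 + t1) / 2) + C).
Proof.
move=> jd /(@layer_boundD _ _ _ ((t0 + t1) / 2)) H.
apply: (layer_boundS (G1 := fun y => (t0 + t1) / 2 + 1 / 2 * hinge t0 y)
  (G2 := fun y => 1 / 2 * hinge t1 y)) => //.
- by move=> y z yz; rewrite lerD2l ler_pM2l ?(convex_incr_hinge _).1//; lra.
- by apply: convex_incrZ; [lra|exact: convex_incr_hinge].
- by move=> y; rewrite mulr_ge0 ?hinge_ge0//; lra.
- by move=> a b _ _; have := hinge_ge t0 a; have := hinge_ge t1 b; lra.
by apply: layer_bound_mono H => //; [move=> y _; lra|exact: ltnW].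
Qed.

Lemma layer_bound_hinge2 j t0 t1 t2 C : (j < d)%N ->
  layer_bound x j (fun y => 1 / 4 * hinge t0 y + hinge t1 y + hinge t2 y) C ->
  layer_bound x j.+1 (fun y => 1 / 2 * hinge ((t0 + t1) / 2) y
    + hinge ((t1 + t2) / 2) y) C.
Proof.
move=> jd H.
apply: (layer_boundS (G1 := fun y => 1 / 4 * hinge t0 y + 1 / 2 * hinge t1 y)
  (G2 := fun y => 1 / 4 * hinge t1 y + 1 / 2 * hinge t2 y)) => //.
- move=> y z yz; have h t := (convex_incr_hinge t).1 _ _ yz.
  by have := h ((t0 + t1) / 2); have := h ((t1 + t2) / 2); lra.
- move=> y z yz; have h t := (convex_incr_hinge t).1 _ _ yz.
  by have := h t0; have := h t1; lra.
- by apply: convex_incrD; apply: convex_incrZ;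
    [lra|exact: convex_incr_hinge|lra|exact: convex_incr_hinge].
- by move=> y; have := hinge_ge0 t1 y; have := hinge_ge0 t2 y; lra.
- by move=> a b _ _; have := hinge_mid t0 t1 a b; have := hinge_mid t1 t2 a b; lra.
by apply: layer_bound_mono H => //; [move=> y _; lra|exact: ltnW].
Qed.

Lemma layer_bound_hinge3 j t0 t1 t2 t3 C : (j < d)%N ->
  layer_bound x j (fun y => 1 / 8 * hinge t0 y + 3 / 4 * hinge t1 y
    + 3 / 2 * hinge t2 y + hinge t3 y) C ->
  layer_bound x j.+1 (fun y => 1 / 4 * hinge ((t0 + t1) / 2) y
    + hinge ((t1 + t2) / 2) y + hinge ((t2 + t3) / 2) y) C.
Proof.
move=> jd H.
apply: (layer_boundS
  (G1 := fun y => 1 / 8 * hinge t0 y + (1 / 2 * hinge t1 y + 1 / 2 * hinge t2 y))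
  (G2 := fun y => 1 / 8 * hinge t1 y + (1 / 2 * hinge t2 y + 1 / 2 * hinge t3 y))) => //.
- move=> y z yz; have h t := (convex_incr_hinge t).1 _ _ yz.
  by have := h ((t0 + t1) / 2); have := h ((t1 + t2) / 2); have := h ((t2 + t3) / 2); lra.
- move=> y z yz; have h t := (convex_incr_hinge t).1 _ _ yz.
  by have := h t0; have := h t1; have := h t2; lra.
- apply: convex_incrD; first by apply: convex_incrZ; [lra|exact: convex_incr_hinge].
  by apply: convex_incrD; apply: convex_incrZ;
    [lra|exact: convex_incr_hinge|lra|exact: convex_incr_hinge].
- by move=> y; have := hinge_ge0 t1 y; have := hinge_ge0 t2 y; have := hinge_ge0 t3 y; lra.
- move=> a b _ _; have := hinge_mid t0 t1 a b; have := hinge_mid t1 t2 a b.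
  by have := hinge_mid t2 t3 a b; lra.
by apply: layer_bound_mono H => //; [move=> y _; lra|exact: ltnW].
Qed.

End part_1oo.

(** * Hyperbolic cosine of a single coordinate of the signed sample *)

Section sample_cosh.
Context {R : realType} {h n : nat}.
Local Notation T := (borel_cV R h).
Local Notation signs := {ffun 'I_n -> bool}.
Variables (Gamma : R) (mu : probability T R).
Hypotheses (hn : (0 < n)%N) (hGamma : 0 < Gamma) (hmu : PuB Gamma mu).

Lemma sum_delta (l : 'I_h) (c : R) (f : 'I_h -> R) :
  \sum_j (if j == l then c else 0) * f j = c * f l.
Proof.
rewrite (bigD1 l)//= eqxx big1 ?addr0// => j /negbTE ->.
by rewrite mul0r.
Qed.

Lemma integral_expR_signed_sample e l (la : R) :
  (\int[iid mu n]_x (expR (la * signed_sample Gamma x e l))%:E <=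
   (expR (la ^+ 2 / 2) *
    expR (rsum (fun=> la * rel_mean Gamma mu l / Num.sqrt n%:R) e))%:E)%E.
Proof.
have := signed_sample_mgf hn hGamma hmu e (fun j => if j == l then la else 0).
under eq_integral do rewrite sum_delta.
rewrite big_split /= sum_delta expRD.
rewrite (_ : \sum_i _ = la ^+ 2 / 2); last first.
  rewrite (bigD1 l)//= eqxx big1 ?addr0// => j /negbTE ->.
  by rewrite expr0n mul0r.
rewrite (_ : la * _ = rsum (fun=> la * rel_mean Gamma mu l / Num.sqrt n%:R) e)//.
transitivity (la * rel_mean Gamma mu l / Num.sqrt n%:R * rsum (fun=> 1) e); first by ring.
by rewrite -rsumZ; apply: eq_bigr => i _; rewrite mulr1.
Qed.

Lemma measurable_ch_sample (la : R) l e :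
  measurable_fun setT (fun x : n.-tuple T => ch (la * signed_sample Gamma x e l)).
Proof.
apply: measurableT_comp; first exact: measurable_ch.
by apply: measurable_funM => //; exact: measurable_signed_sample.
Qed.

(** For fixed signs the mean shifts the exponent by [la] times the relative mean times the
    normalised sum of the signs; averaging over the signs turns this shift into the additional
    variance [rel_mean Gamma mu l ^+ 2]. *)
Lemma integral_ch (la : R) l :
  (\int[iid mu n]_x (\sum_e ch (la * signed_sample Gamma x e l))%:E <=
   (2 ^+ n * expR (la ^+ 2 * (1 + rel_mean Gamma mu l ^+ 2) / 2))%:E)%E.
Proof.
pose r : R := rel_mean Gamma mu l / Num.sqrt n%:R.
have mE s e : measurable_fun setT
    (fun x : n.-tuple T => (expR (s * signed_sample Gamma x e l))%:E).
  apply/measurable_EFinP; apply: measurableT_comp => //.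
  by apply: measurable_funM => //; exact: measurable_signed_sample.
have sumE s : (\int[iid mu n]_x (\sum_e expR (s * signed_sample Gamma x e l))%:E <=
   (2 ^+ n * expR (s ^+ 2 * (1 + rel_mean Gamma mu l ^+ 2) / 2))%:E)%E.
  under eq_integral do rewrite -sumEFin.
  rewrite ge0_integral_sum; [|by []|exact: mE|by move=> e x _; rewrite lee_fin expR_ge0].
  apply: le_trans (lee_sum _ (fun e _ => integral_expR_signed_sample e l s)) _.
  rewrite sumEFin lee_fin -mulr_sumr.
  rewrite (_ : s ^+ 2 * (1 + _) / 2 = s ^+ 2 / 2 + s ^+ 2 * rel_mean Gamma mu l ^+ 2 / 2).
    rewrite expRD [leRHS]mulrCA ler_pM2l ?expR_gt0//.
    have := sum_signs_expR (fun _ : 'I_n => s * rel_mean Gamma mu l / Num.sqrt n%:R).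
    rewrite sumr_const card_ord -(mulr_natl ((_ / _) ^+ 2)) exprMn exprVn sqr_sqrtr//.
    by rewrite [n%:R * _]mulrCA mulfV ?mulr1 ?exprMn// pnatr_eq0 -lt0n.
  by ring.
have chE (x : n.-tuple T) : (\sum_e ch (la * signed_sample Gamma x e l))%:E =
    (2^-1%:E * ((\sum_e expR (la * signed_sample Gamma x e l))%:E +
    (\sum_e expR (- la * signed_sample Gamma x e l))%:E))%E.
  rewrite -EFinD -EFinM -big_split mulr_sumr; congr EFin.
  by apply: eq_bigr => e _; rewrite /ch mulNr mulrC.
have sum0 s (x : n.-tuple T) : (0 <= (\sum_e expR (s * signed_sample Gamma x e l))%:E)%E.
  by rewrite lee_fin sumr_ge0// => e _; exact: expR_ge0.
have msum s : measurable_fun setT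
    (fun x : n.-tuple T => (\sum_e expR (s * signed_sample Gamma x e l))%:E).
  by apply/measurable_EFinP; apply: measurable_sum => e; by apply/measurable_EFinP; exact: mE.
under eq_integral do rewrite chE.
rewrite ge0_integralZl_EFin; [|by []|by move=> x _; apply: adde_ge0; exact: sum0
  |exact: emeasurable_funD|by rewrite invr_ge0].
rewrite ge0_integralD//.
apply: (@le_trans _ _ (2^-1%:E *
  ((2 ^+ n * expR (la ^+ 2 * (1 + rel_mean Gamma mu l ^+ 2) / 2))%:E +
   (2 ^+ n * expR (la ^+ 2 * (1 + rel_mean Gamma mu l ^+ 2) / 2))%:E))%E).
  rewrite lee_wpmul2l ?lee_fin ?invr_ge0// leeD// ?sumE//.
  by rewrite -[X in (_ <= (_ * expR (X * _ / _))%:E)%E]sqrrN; exact: sumE.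
by rewrite -EFinD -EFinM lee_fin; lra.
Qed.

Lemma integral_chB (la delta : R) l : 0 <= delta <= 1 ->
  (\int[iid mu n]_x (\sum_e (ch (la * signed_sample Gamma x e l) - delta))%:E <=
   (2 ^+ n * (expR (la ^+ 2 * (1 + rel_mean Gamma mu l ^+ 2) / 2) - delta))%:E)%E.
Proof.
move=> /andP[d0 d1].
have E (x : n.-tuple T) : (\sum_e ch (la * signed_sample Gamma x e l))%:E =
    ((\sum_e (ch (la * signed_sample Gamma x e l) - delta))%:E + (2 ^+ n * delta)%:E)%E.
  rewrite -EFinD sumrB sumr_const card_ffun card_bool card_ord -(mulr_natl delta) natrX.
  by rewrite subrK.
have := integral_ch la l; under eq_integral do rewrite E.
rewrite ge0_integralD; [|by []| | |by move=> x _; rewrite lee_fin mulr_ge0 ?exprn_ge0|by []].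
- rewrite integral_cst// [X in (_ + _ * X)%E](_ : _ = 1%E); last exact: probability_setT.
  by rewrite mule1 -leeBrDr// -EFinB mulrBr.
- move=> x _; rewrite lee_fin sumr_ge0// => e _.
  by rewrite subr_ge0 (le_trans d1)// ch_ge1.
apply/measurable_EFinP; apply: measurable_sum => e.
by apply: measurable_funB => //; exact: measurable_ch_sample.
Qed.

End sample_cosh.

Section part_1oo.
Context {R : realType} {n d : nat} {k : nat -> nat}.
Variables (sigma : nat -> R -> R) (L M : nat -> R) (Gamma : R).
Variable mu : probability (borel_cV R (k 1%N)) R.
Hypotheses (hn : (0 < n)%N) (hG : 0 < Gamma) (hmu : PuB Gamma mu).
Hypotheses (hk : forall i, (1 <= i <= d.+1)%N -> (0 < k i)%N)
  (M0 : forall i, (1 <= i <= d.+1)%N -> 0 < M i)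
  (L0 : forall i, (1 <= i < d.+1)%N -> 0 < L i).
Local Notation signs := {ffun 'I_n -> bool}.
Local Notation c0 := (@sample_scale R n Gamma).

(** Weights and rates may vary with the coordinate because the variance proxies do. The majorants
    used later are multiples of [ch], with [delta = 0], or of [ch - 1], with [delta = 1]. *)
Lemma rademacher_1oo (c delta : R) (w la : 'I_(k 1%N) -> R) :
  0 <= c -> 0 <= delta <= 1 -> (forall l, 0 <= w l) ->
  (forall x : n.-tuple (borel_cV R (k 1%N)), layer_bound (d := d) sigma L M Gamma x d id
     (2 ^+ n * c + \sum_e \sum_l w l * (ch (la l * signed_sample Gamma x e l) - delta))) ->
  (rademacher n (nn_class sigma (weights_1oo k d.+1 M)) mu <=
   (n%:R^-1 * (c0 * (\prod_(1 <= i < d.+2) M i) * (\prod_(1 <= i < d.+1) L i) *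
     (c + \sum_l w l *
       (expR (la l ^+ 2 * (1 + rel_mean Gamma mu l ^+ 2) / 2) - delta))))%:E)%E.
Proof.
move=> c_0 d01 w0 H; have /andP[_ d1] := d01.
set B := c0 * _ * _.
pose scale := c0 * \prod_(1 <= i < d.+1) (M i * L i).
have c0_gt0 : 0 < c0 by rewrite mulr_gt0// sqrtr_gt0 ltr0n.
have scale_gt0 : 0 < scale.
  rewrite mulr_gt0// big_nat_cond; apply: prodr_gt0 => i.
  rewrite andbT => /andP[i1 id].
  by rewrite mulr_gt0 ?M0 ?L0 ?i1//= ltnW.
have BE : B = scale * M d.+1.
  by rewrite /B /scale big_nat_recr//= big_split /=; ring.
have B0 : 0 < B by rewrite BE mulr_gt0 ?M0//=.
pose g (x : n.-tuple (borel_cV R (k 1%N))) : R := B *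
  \sum_l w l * \sum_e (ch (la l * signed_sample Gamma x e l) - delta).
have s_ge0 l (x : n.-tuple (borel_cV R (k 1%N))) :
    0 <= \sum_e (ch (la l * signed_sample Gamma x e l) - delta).
  by apply: sumr_ge0 => e _; rewrite subr_ge0 (le_trans d1)// ch_ge1.
have ms l : measurable_fun setT (fun x : n.-tuple (borel_cV R (k 1%N)) =>
    \sum_e (ch (la l * signed_sample Gamma x e l) - delta)).
  apply: measurable_sum => e.
  by apply: measurable_funB => //; exact: measurable_ch_sample.
have mws l : measurable_fun setT (fun x : n.-tuple (borel_cV R (k 1%N)) =>
    w l * \sum_e (ch (la l * signed_sample Gamma x e l) - delta)).
  exact: measurable_funM.
rewrite mulrDr; apply: (@rademacher_le _ _ _ _ _ _ g).
- pose v0 : @weights R k d.+1 := @Weights R k d.+1 (fun=> 0) 0.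
  exists (network sigma v0); exists v0 => //.
  split=> [i id|] /=.
    have Mi : 0 <= M i by apply/ltW/M0; have /andP[-> /ltnW ->] := id.
    apply: bigmax_le => // i1 _.
    by rewrite big1// => j _; rewrite mxE normr0.
  by rewrite /norm1 big1 ?ltW ?M0//= => i _; rewrite mxE normr0.
- by rewrite mulr_ge0// ltW.
- by move=> x; rewrite mulr_ge0 ?(ltW B0)// sumr_ge0// => l _; rewrite mulr_ge0.
- by apply: measurable_funM => //; exact: measurable_sum.
- under eq_integral do rewrite EFinM.
  rewrite ge0_integralZl_EFin; [|by []
    |by move=> x _; rewrite lee_fin sumr_ge0// => l _; rewrite mulr_ge0
    |by apply/measurable_EFinP; exact: measurable_sum|exact: ltW].
  rewrite [X in (_ <= X%:E)%E]mulrCA [X in (_ <= X)%E]EFinM lee_wpmul2l ?lee_fin ?(ltW B0)//.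
  under eq_integral do rewrite -sumEFin.
  rewrite ge0_integral_sum; [|by []|by move=> l; apply/measurable_EFinP
    |by move=> l x _; rewrite lee_fin mulr_ge0].
  rewrite mulr_sumr -sumEFin; apply: lee_sum => l _.
  under eq_integral do rewrite EFinM.
  rewrite ge0_integralZl_EFin; [|by []|by move=> x _; rewrite lee_fin
    |exact/measurable_EFinP|exact: w0].
  rewrite [X in (_ <= X%:E)%E]mulrCA [X in (_ <= X)%E]EFinM lee_wpmul2l ?lee_fin//.
  exact: integral_chB.
move=> x f hf.
have /choice[v hv] : forall e : signs, exists v : @weights R k d.+1,
    weights_1oo k d.+1 M v /\ network sigma v = f e.
  by move=> e; have [v Pv <-] := hf e; exists v.
have /choice[r hr] (e : signs) := exists_max (Ordinal (hk (i := d.+1) (leqnn _)))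
  (fun r => `|lsum sigma (tnth x) (W (v e)) e r|).
have := H x (fun e => W (v e)) r (fun e => (hv e).1.1).
rewrite /g exchange_big /= => hH.
rewrite [X in _ <= _ + _ * X](_ : _ = \sum_l \sum_e
    w l * (ch (la l * signed_sample Gamma x e l) - delta)); last first.
  by apply: eq_bigr => l _; rewrite mulr_sumr.
rewrite mulrCA -mulrDr; apply: le_trans (ler_wpM2l (ltW B0) hH).
rewrite mulr_sumr; apply: ler_sum => e _.
have [[_ vl] <-] := hv e.
rewrite rsum_dotv BE -/scale (_ : scale * M d.+1 * (_ / scale) =
  M d.+1 * `|lsum sigma (tnth x) (W (v e)) e (r e)|); last by field; rewrite gt_eqF.
apply: (@le_trans _ _ (norm1 (wlast (v e)) * `|lsum sigma (tnth x) (W (v e)) e (r e)|)).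
  by apply: sum_le_norm1 => i; rewrite mxE; exact: hr.
by rewrite ler_wpM2r.
Qed.

End part_1oo.

(** * Numerical bounds *)

Section numerics.
Context {R : realType}.

(** Cutting [x] into 32 parts makes the Padé bound sharp enough, and leaves an inequality between
    rational numbers once [x] and [r] are numerals. *)
Lemma expR_le_num (x r : R) : 0 <= x -> x <= 8 ->
  (2 + x / 32) ^+ 32 <= r * (2 - x / 32) ^+ 32 -> expR x <= r.
Proof.
move=> x0 x8; rewrite -ler_pdivrMr ?exprn_gt0//; last by lra.
rewrite -expr_div_n; apply: le_trans.
rewrite (_ : expR x = expR (x / 32) ^+ 32); last by rewrite -expRM_natl; congr expR; field.
rewrite lerXn2r ?nnegrE ?expR_ge0//; first by rewrite divr_ge0//; lra.
by rewrite ler_pdivlMr; [rewrite mulrC; apply: expR_le_pade; lra|lra].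
Qed.

Lemma expR_ge_num (x r : R) : 0 <= x ->
  r <= (1 + x / 32 + (x / 32) ^+ 2 / 2) ^+ 32 -> r <= expR x.
Proof.
move=> x0 /le_trans; apply.
rewrite (_ : expR x = expR (x / 32) ^+ 32); last by rewrite -expRM_natl; congr expR; field.
have x32 : 0 <= x / 32 by lra.
rewrite lerXn2r ?nnegrE ?expR_ge0//; last exact: expR_ge_quadratic.
by have := sqr_ge0 (x / 32); lra.
Qed.

Lemma ln_le_num (w l : R) : 0 < w -> 0 <= l ->
  w <= (1 + l / 32 + (l / 32) ^+ 2 / 2) ^+ 32 -> ln w <= l.
Proof.
by move=> w0 l0 /(expR_ge_num l0); rewrite -{1}(lnK w0) ler_expR.
Qed.

Lemma ln_ge_num (w l : R) : 0 < w -> 0 <= l -> l <= 8 ->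
  (2 + l / 32) ^+ 32 <= w * (2 - l / 32) ^+ 32 -> l <= ln w.
Proof.
by move=> w0 l0 l8 /(expR_le_num l0 l8); rewrite -{1}(lnK w0) ler_expR.
Qed.

Lemma ln2_gt : 69 / 100 <= ln 2 :> R.
Proof. by apply: ln_ge_num; lra. Qed.

Lemma expR_line (w l u : R) : 0 < w -> ln w <= l -> w * (1 + u - l) <= expR u.
Proof.
move=> w0 lw; have -> : expR u = w * expR (u - ln w).
  by rewrite -{1}(lnK w0) -expRD addrC subrK.
by rewrite ler_pM2l//; apply: le_trans (expR_ge1Dx _); lra.
Qed.

Lemma expR_tangent (u v : R) : expR u * (1 + (v - u)) <= expR v.
Proof.
have -> : expR v = expR u * expR (v - u) by rewrite -expRD addrC subrK.
by rewrite ler_pM2l ?expR_gt0// expR_ge1Dx.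
Qed.

Lemma expR_chord (p a b : R) : 0 <= p <= 1 ->
  expR ((1 - p) * a + p * b) <= (1 - p) * expR a + p * expR b.
Proof.
move=> /andP[p0 p1]; set m := _ + _.
have ha := expR_tangent m a; have hb := expR_tangent m b.
have q0 : 0 <= 1 - p by lra.
have := ler_wpM2l q0 ha; have := ler_wpM2l p0 hb.
have : (1 - p) * (expR m * (1 + (a - m))) + p * (expR m * (1 + (b - m))) = expR m.
  by rewrite /m; ring.
lra.
Qed.

(** The left side is convex and increasing in the squares [m l ^+ 2], so the worst case is a vertex
    of the simplex: one coordinate of variance proxy 2 and the others of proxy 1. *)
Lemma corner_sum h (m : 'I_h -> R) (la : R) : \sum_l m l ^+ 2 <= 1 ->
  \sum_l expR (la ^+ 2 * (1 + m l ^+ 2) / 2) <=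
  (h%:R - 1) * expR (la ^+ 2 / 2) + expR (la ^+ 2).
Proof.
move=> m1; pose E1 := expR (la ^+ 2 / 2); pose E2 := expR (la ^+ 2).
have E12 : E1 <= E2 by rewrite ler_expR; have := sqr_ge0 la; lra.
have ml1 l : m l ^+ 2 <= 1.
  by apply: le_trans m1; rewrite (bigD1 l)//= lerDl sumr_ge0// => j _; exact: sqr_ge0.
apply: (@le_trans _ _ (\sum_(l < h) (E1 + m l ^+ 2 * (E2 - E1)))).
  apply: ler_sum => l _.
  rewrite (_ : _ / 2 = (1 - m l ^+ 2) * (la ^+ 2 / 2) + m l ^+ 2 * la ^+ 2); last by field.
  apply: le_trans (expR_chord _ _ _) _; first by rewrite sqr_ge0 ml1.
  by rewrite -/E1 -/E2; lra.
rewrite big_split /= sumr_const card_ord -(mulr_natl E1) -mulr_suml.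
have := ler_wpM2r (_ : 0 <= E2 - E1) m1; rewrite subr_ge0 => /(_ E12).
rewrite -/E1 -/E2; lra.
Qed.

Lemma hinge_shift (s t la y : R) : 0 < la ->
  hinge (s + t / la) y = hinge t (la * (y - s)) / la.
Proof.
move=> la0; rewrite /hinge maxr_pMl ?invr_ge0 ?(ltW la0)// mul0r; congr Num.max.
by field; rewrite gt_eqF.
Qed.

(* The slopes 1/8, 7/8, 19/8 and 27/8 are forced by [layer_bound_hinge3]; the breakpoints keep
   each piece below the tangent of [expR] of the same slope. *)
Lemma hinge3_le_expR (u : R) :
  1 / 8 * hinge (- 3) u + 3 / 4 * hinge (- (3 / 4)) u
  + 3 / 2 * hinge (1 / 2) u + hinge (11 / 10) u <= expR u.
Proof.
have h0 := expR_ge0 u.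
have h1 : 1 / 8 * (1 + u - - 2) <= expR u.
  apply: expR_line; first lra.
  rewrite (_ : 1 / 8 = 8^-1); last by lra.
  by rewrite lnV ?posrE// lerN2; apply: ln_ge_num; lra.
have h2 : 7 / 8 * (1 + u - - (1 / 10)) <= expR u.
  apply: expR_line; first lra.
  rewrite (_ : 7 / 8 = (8 / 7)^-1); last by lra.
  by rewrite lnV ?posrE ?divr_gt0// lerN2; apply: ln_ge_num; lra.
have h3 : 19 / 8 * (1 + u - 92 / 100) <= expR u.
  by apply: expR_line; [lra|apply: ln_le_num; lra].
have h4 : 27 / 8 * (1 + u - 127 / 100) <= expR u.
  by apply: expR_line; [lra|apply: ln_le_num; lra].
rewrite /hinge; case: (lerP 0 (u - - 3)) => c0; last by rewrite !max_l; lra.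
case: (lerP 0 (u - - (3 / 4))) => c1; last by rewrite !max_l; lra.
case: (lerP 0 (u - 1 / 2)) => c2; last by rewrite max_l; lra.
by case: (lerP 0 (u - 11 / 10)); lra.
Qed.

Lemma hinge2_le_expR (u : R) :
  1 / 4 * hinge (- (119 / 50)) u + hinge (- (37 / 100)) u + hinge (11 / 20) u <= expR u.
Proof.
have h0 := expR_ge0 u.
have h1 : 1 / 4 * (1 + u - - (69 / 50)) <= expR u.
  apply: expR_line; first lra.
  rewrite (_ : 1 / 4 = 4^-1); last by lra.
  by rewrite lnV ?posrE// lerN2; apply: ln_ge_num; lra.
have h2 : 5 / 4 * (1 + u - 9 / 40) <= expR u.
  by apply: expR_line; [lra|apply: ln_le_num; lra].
have h3 : 9 / 4 * (1 + u - 163 / 200) <= expR u.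
  by apply: expR_line; [lra|apply: ln_le_num; lra].
rewrite /hinge; case: (lerP 0 (u - - (119 / 50))) => c0; last by rewrite !max_l; lra.
case: (lerP 0 (u - - (37 / 100))) => c1; last by rewrite max_l; lra.
by case: (lerP 0 (u - 11 / 20)); lra.
Qed.

(* A line of slope [sg] that vanishes at [z] lies below [w (ch (la y) - 1)]
   because it lies below the tangent where [la y = ln r]; there
   [(ch - 1) / sinh = (r - 1) / (r + 1)]. *)
Lemma ch_tangent (w la r sg z y : R) : 0 < w -> 0 < la -> 1 < r ->
  2 * sg * r <= w * la * (r ^+ 2 - 1) ->
  ln r <= la * z + (1 - 2 / (r + 1)) ->
  z <= y -> sg * (y - z) <= w * (ch (la * y) - 1).
Proof.
move=> w0 la0 r1 hsg hu zy.
have r0 : 0 < r by lra.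
set u := ln r in hu.
have rE : expR u = r by rewrite lnK.
have hp : r * (1 + (la * y - u)) <= expR (la * y) by rewrite -{1}rE expR_tangent.
have hm : r^-1 * (1 - (la * y - u)) <= expR (- (la * y)).
  have := expR_tangent (- u) (- (la * y)).
  by rewrite expRN rE (_ : - _ - - u = - (la * y - u)) //; ring.
have rV : r^-1 < 1 by rewrite invf_lt1.
set D := (r - r^-1) / 2; have D0 : 0 <= D by rewrite /D; lra.
have e0 : D * (1 - 2 / (r + 1)) = (r + r^-1) / 2 - 1.
  by rewrite /D; field; apply/andP; split; apply/eqP; lra.
have hD : sg <= w * la * D.
  rewrite -(ler_pM2l (_ : 0 < 2 * r)) ?mulr_gt0//.
  rewrite [leRHS](_ : _ = w * la * (r ^+ 2 - 1)); last by rewrite /D; field; rewrite gt_eqF.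
  lra.
apply: (@le_trans _ _ (w * la * D * (y - z))); first by rewrite ler_wpM2r// subr_ge0.
have h4 : la * D * (y - z) <= ch (la * y) - 1.
  have := ler_wpM2l D0 hu; rewrite mulrDr e0 => h3.
  rewrite /ch; move: h3 hp hm; rewrite /D; set p := r^-1.
  by set Ey := expR _; set Em := expR _ => h3 hp hm; lra.
by have := ler_wpM2l (ltW w0) h4; lra.
Qed.

End numerics.

(** * The last layers pulled back through hinge functions *)

Section depth_bounds.
Context {R : realType} {n d : nat} {k : nat -> nat}.
Variables (sigma : nat -> R -> R) (L M : nat -> R) (Gamma : R).
Hypotheses (hn : (0 < n)%N) (hG : 0 < Gamma).
Hypotheses (hk : forall i, (1 <= i <= d.+1)%N -> (0 < k i)%N)
  (M0 : forall i, (1 <= i <= d.+1)%N -> 0 < M i)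
  (L0 : forall i, (1 <= i < d.+1)%N -> 0 < L i)
  (sh : forall i, (1 <= i < d.+1)%N -> {homo sigma i : x y / x <= y})
  (sL : forall i, (1 <= i < d.+1)%N -> forall x y,
     `|sigma i x - sigma i y| <= L i * `|x - y|)
  (s0 : forall i, (1 <= i < d.+1)%N -> sigma i 0 = 0).
Variable x : n.-tuple (borel_cV R (k 1%N)).
Local Notation ss e l := (signed_sample Gamma x e l).
Local Notation bound j := (layer_bound (d := d) sigma L M Gamma x j).

Lemma layer_bound_hinge12 j t0 t1 t2 C : (j.+2 <= d)%N ->
  bound j (fun y => 1 / 4 * hinge t0 y + hinge t1 y + hinge t2 y) C ->
  bound j.+2 id (2 ^+ n * ((t0 + 2 * t1 + t2) / 4) + C).
Proof.
move=> jd /(layer_bound_hinge2 hn hG hk M0 L0 sh sL s0 (ltnW jd)).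
move=> /(layer_bound_hinge1 hn hG hk M0 L0 sh sL s0 jd).
by rewrite (_ : (_ + _) / 2 = (t0 + 2 * t1 + t2) / 4)//; field.
Qed.

Lemma layer_bound_hinge123 j t0 t1 t2 t3 C : (j.+3 <= d)%N ->
  bound j (fun y => 1 / 8 * hinge t0 y + 3 / 4 * hinge t1 y + 3 / 2 * hinge t2 y
    + hinge t3 y) C ->
  bound j.+3 id (2 ^+ n * ((t0 + 3 * t1 + 3 * t2 + t3) / 8) + C).
Proof.
move=> jd /(layer_bound_hinge3 hn hG hk M0 L0 sh sL s0 (ltnW (ltnW jd))).
move=> /(layer_bound_hinge12 jd).
by rewrite (_ : (_ + _) / 4 = (t0 + 3 * t1 + 3 * t2 + t3) / 8)//; field.
Qed.

Let hinge_expR G C j la s : 0 < la -> (j <= d)%N ->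
  (forall y, G y <= expR (la * (y - s)) / la) ->
  Num.sqrt 2 ^+ j * (2 / la * expR (- (la * s))) = C ->
  bound j G (\sum_e \sum_l C * (ch (la * ss e l) - 0)).
Proof.
move=> la0 jd Gle <-.
have e0 : 0 <= expR (- (la * s)) / la by rewrite divr_ge0 ?expR_ge0// ltW.
have := layer_bound0 sigma L (M := M) (d := d) hn hG x (fun y => expR_ge0 (la * y)).
move=> /(layer_bound_expR hn hG hk M0 L0 sh sL s0 jd (ltW la0)).
move=> /(layer_boundZ e0); apply: layer_bound_mono => //; last first.
  by move=> y _; apply: le_trans (Gle y) _; rewrite mulrBr addrC expRD; lra.
rewrite !mulr_sumr; apply: ler_sum => e _.
rewrite !mulr_sumr; apply: ler_sum => l _; rewrite subr0.
have := expR_abs_le_ch (la * ss e l); rewrite normrM (gtr0_norm la0).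
have w0 : 0 <= Num.sqrt 2 ^+ j * (expR (- (la * s)) / la).
  by rewrite mulr_ge0// exprn_ge0// sqrtr_ge0.
by move=> /(ler_wpM2l w0); set E := expR _; set E' := expR _; set c := ch _; lra.
Qed.

(** The breakpoints of [hinge3_le_expR] are scaled by [la^-1] and shifted by [s]; [- (53 / 160)] is
    their average with weights 1, 3, 3, 1 over 8. *)
Lemma layer_bound_exp3 j la s : 0 < la -> (j.+3 <= d)%N ->
  bound j.+3 id (2 ^+ n * (s - 53 / 160 / la) + \sum_e \sum_l
    Num.sqrt 2 ^+ j * (2 / la * expR (- (la * s))) * (ch (la * ss e l) - 0)).
Proof.
move=> la0 jd.
pose t z := s + z / la.
rewrite (_ : s - _ = (t (- 3) + 3 * t (- (3 / 4)) + 3 * t (1 / 2) + t (11 / 10)) / 8).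
  apply: layer_bound_hinge123 => //.
  apply: (@hinge_expR _ _ _ la s) => //; first by do 3!apply: ltnW.
  move=> y; rewrite /t !hinge_shift//.
  have := hinge3_le_expR (la * (y - s)).
  by rewrite -(ler_pM2r (_ : 0 < la^-1)) ?invr_gt0// => h; apply: le_trans h; lra.
by rewrite /t; field; rewrite gt_eqF.
Qed.

Lemma layer_bound_exp2 la s : 0 < la -> (2 <= d)%N ->
  bound 2 id (2 ^+ n * (s - 257 / 400 / la) + \sum_e \sum_l
    2 / la * expR (- (la * s)) * (ch (la * ss e l) - 0)).
Proof.
move=> la0 d2.
pose t z := s + z / la.
rewrite (_ : s - _ = (t (- (119 / 50)) + 2 * t (- (37 / 100)) + t (11 / 20)) / 4).
  apply: layer_bound_hinge12 => //.
  apply: (@hinge_expR _ _ _ la s) => //; last by rewrite expr0 mul1r.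
  move=> y; rewrite /t !hinge_shift//.
  have := hinge2_le_expR (la * (y - s)).
  by rewrite -(ler_pM2r (_ : 0 < la^-1)) ?invr_gt0// => h; apply: le_trans h; lra.
by rewrite /t; field; rewrite gt_eqF.
Qed.

Let chN (y : R) : ch (- y) = ch y.
Proof. by rewrite /ch opprK addrC. Qed.

Let bound_ch G delta (w la : 'I_(k 1%N) -> R) : (forall y, 0 <= G y) ->
  (forall l y, 0 <= y -> G y <= w l * (ch (la l * y) - delta)) ->
  bound 0 G (\sum_e \sum_l w l * (ch (la l * ss e l) - delta)).
Proof.
move=> G0 H; have := layer_bound0 sigma L (M := M) (d := d) hn hG x G0.
apply: layer_bound_mono => //; apply: ler_sum => e _; apply: ler_sum => l _.
apply: le_trans (H l _ (normr_ge0 _)) _.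
by case: (ger0P (ss e l)) => _; rewrite ?mulrN ?chN.
Qed.

Lemma layer_bound_ch1 t0 t1 delta (w la : 'I_(k 1%N) -> R) : (1 <= d)%N ->
  (forall l y, 0 <= y ->
     1 / 2 * hinge t0 y + hinge t1 y <= w l * (ch (la l * y) - delta)) ->
  bound 1 id (2 ^+ n * ((t0 + t1) / 2)
    + \sum_e \sum_l w l * (ch (la l * ss e l) - delta)).
Proof.
move=> d1 H; apply: (layer_bound_hinge1 hn hG hk M0 L0 sh sL s0 d1).
apply: bound_ch => // y.
by have := hinge_ge0 t0 y; have := hinge_ge0 t1 y; lra.
Qed.

Lemma layer_bound_ch2 t0 t1 t2 delta (w la : 'I_(k 1%N) -> R) : (2 <= d)%N ->
  (forall l y, 0 <= y ->
     1 / 4 * hinge t0 y + hinge t1 y + hinge t2 y <= w l * (ch (la l * y) - delta)) ->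
  bound 2 id (2 ^+ n * ((t0 + 2 * t1 + t2) / 4)
    + \sum_e \sum_l w l * (ch (la l * ss e l) - delta)).
Proof.
move=> d2 H; apply: (layer_bound_hinge12 d2); apply: bound_ch => // y.
by have := hinge_ge0 t0 y; have := hinge_ge0 t1 y; have := hinge_ge0 t2 y; lra.
Qed.

End depth_bounds.

(** * Choice of rate and threshold for exponential majorants *)

Section entropic.
Context {R : realType}.
Local Notation ln2 := (ln 2 : R).

Lemma sqrt2E : Num.sqrt 2 = expR (ln 2 / 2) :> R.
Proof.
rewrite -[RHS]ger0_norm ?expR_ge0// -sqrtr_sqr -expRM_natl; congr Num.sqrt.
by rewrite mulrC divfK ?lnK// posrE.
Qed.

Lemma ln_nat_ge (c h a b : nat) : (0 < c)%N -> (c <= h)%N ->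
  2 ^+ a <= c%:R ^+ b :> R -> a%:R * ln2 <= b%:R * ln h%:R.
Proof.
move=> c0 ch ab; have h0 : (0 < h)%N := leq_trans c0 ch.
rewrite !mulr_natl -!lnXn ?ltr0n// ler_ln ?posrE ?exprn_gt0 ?ltr0n//.
by apply: le_trans ab _; rewrite lerXn2r ?nnegrE ?ler0n// ler_nat.
Qed.

(** In the applications [x] is the depth times [ln 2]. With target [b] and threshold
    [b - kappa / la], the constant term is [b - la^-1], so the exponential term may cost [la^-1].
    The rate [la = b - q] is [b / 2], optimal for variance proxy 2, when [h = 1]; the ratio [la / b]
    tends to 1, the optimal ratio for proxy 1, as [h] grows. The two summands of the hypothesis
    belong to the coordinates of proxy 1 and to the one of proxy 2. *)
Lemma entropic_bound (x C kappa : R) (h : nat) : (0 < h)%N -> 4 / 3 <= x -> 0 <= C ->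
  C * (2 * expR kappa) * expR (- (x / 2)) *
    ((1 - h%:R^-1) * expR (- (x / 4)) + expR (x - Num.sqrt (x * (x + ln h%:R)))) <= 1 ->
  exists la s, [/\ 0 < la, 0 <= s - (1 - kappa) / la &
    s - (1 - kappa) / la + C * (2 / la * expR (- (la * s))) *
      ((h%:R - 1) * expR (la ^+ 2 / 2) + expR (la ^+ 2))
    <= Num.sqrt (2 * (x + ln h%:R))].
Proof.
move=> h0 x1 C0 H; set y := ln h%:R in H *.
have hR : 0 < h%:R :> R by rewrite ltr0n.
have y0 : 0 <= y by rewrite ln_ge0// ler1n.
set b := Num.sqrt (2 * _); set q := Num.sqrt (x / 2).
have b2 : b ^+ 2 = 2 * (x + y) by rewrite sqr_sqrtr//; lra.
have q2 : q ^+ 2 = x / 2 by rewrite sqr_sqrtr//; lra.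
have bq : Num.sqrt (x * (x + y)) = b * q.
  by rewrite -sqrtrM; [congr Num.sqrt; field|lra].
rewrite bq in H.
have q0 : 0 <= q := sqrtr_ge0 _.
have la0 : 0 < b - q by rewrite subr_gt0 ltr_sqrt; lra.
pose la := b - q; exists la, (b - kappa / la).
have -> : b - kappa / la - (1 - kappa) / la = b - la^-1 by field; rewrite gt_eqF.
have lab : 1 <= la * b.
  have : la * b - la ^+ 2 / 2 = 3 / 4 * x + y.
    rewrite (_ : _ - _ = (b ^+ 2 - q ^+ 2) / 2); last by rewrite /la; field.
    by rewrite b2 q2; field.
  by have := sqr_ge0 la; lra.
split=> //; first by rewrite subr_ge0 -div1r ler_pdivrMr// mulrC.
rewrite -addrA gerDl addrC subr_le0.
set K := (X in _ * _ * X <= _).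
rewrite (_ : C * _ * K = la^-1 * (C * 2 * (expR (kappa - la * b) * K))); last first.
  rewrite (_ : la * (b - kappa / la) = la * b - kappa); last by field; rewrite gt_eqF.
  rewrite opprB.
  by field; rewrite gt_eqF.
rewrite ger_pMr ?invr_gt0//; apply: le_trans H.
rewrite le_eqVlt; apply/orP; left; apply/eqP.
(* Here [la * b - la ^+ 2 / 2 = (b ^+ 2 - q ^+ 2) / 2 = 3 / 4 * x + ln h], so the number of
   coordinates cancels. *)
have e1 : expR (la ^+ 2 / 2) = expR (la * b) * expR (- (x / 2)) * expR (- (x / 4)) / h%:R.
  rewrite -(lnK (_ : h%:R \is Num.pos)) ?posrE// -expRN -!expRD; congr expR.
  rewrite (_ : la * b = (b ^+ 2 - q ^+ 2) / 2 + la ^+ 2 / 2); last by rewrite /la; field.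
  by rewrite b2 q2 -/y; field.
have e2 : expR (la ^+ 2) = expR (la * b) * expR (- (x / 2)) * expR (x - b * q).
  rewrite -!expRD; congr expR.
  rewrite (_ : la * b = la ^+ 2 + b * q - q ^+ 2); last by rewrite /la; ring.
  by rewrite q2; field.
rewrite /K e1 e2 expRB; field.
by rewrite !gt_eqF// expR_gt0.
Qed.

(** The square of [x + theta * ln 2] is at most [x * (x + ln h)]: the cross term uses [2 * theta],
    and [ln 2 <= x / 3] makes the last square linear in [ln 2]. *)
Lemma corner_bound (x theta e : R) (h : nat) : (0 < h)%N -> 3 * ln2 <= x ->
  0 <= theta -> (2 * theta + theta ^+ 2 / 3) * ln2 <= ln h%:R ->
  expR (- (theta * ln2)) <= e ->
  expR (x - Num.sqrt (x * (x + ln h%:R))) <= e.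
Proof.
move=> h0 x3 t0 hy; apply: le_trans; rewrite ler_expR.
have l0 := @ln2_gt R; have x0 : 0 <= x by lra.
suff : x + theta * ln2 <= Num.sqrt (x * (x + ln h%:R)) by lra.
rewrite -[leLHS]ger0_norm -?sqrtr_sqr ?ler_wsqrtr//; last by rewrite addr_ge0// mulr_ge0//; lra.
have := ler_wpM2l x0 hy.
have := ler_wpM2l (_ : 0 <= theta ^+ 2 * ln2 / 3) x3.
rewrite divr_ge0 ?mulr_ge0 ?sqr_ge0//; last lra.
move=> /(_ isT); lra.
Qed.

End entropic.

Section corner.
Context {R : realType}.
Local Notation ln2 := (ln 2 : R).

Lemma expRN_le_num (t e : R) : 0 <= t -> 0 < e ->
  1 <= e * (1 + t / 32 + (t / 32) ^+ 2 / 2) ^+ 32 -> expR (- t) <= e.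
Proof.
move=> t0 e0 H; rewrite expRN -div1r ler_pdivrMr ?expR_gt0//; apply: le_trans H _.
by rewrite ler_pM2l//; apply: expR_ge_num.
Qed.

Lemma expRN_ln2_le (theta e : R) : 0 <= theta -> 0 < e ->
  1 <= e * (1 + theta * (69 / 100) / 32 + (theta * (69 / 100) / 32) ^+ 2 / 2) ^+ 32 ->
  expR (- (theta * ln2)) <= e.
Proof.
move=> t0 e0 H; apply: (@le_trans _ _ (expR (- (theta * (69 / 100))))).
  by rewrite ler_expR lerN2 ler_wpM2l// ln2_gt.
by apply: expRN_le_num; rewrite ?mulr_ge0//; lra.
Qed.

(** At [h = 1] the sum is exactly 1. As [h] grows the first summand stays below [(1 - h^-1) / 2],
    while the second decreases fast enough, which is checked on five ranges of [h]. *)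
Lemma corner_deep (x : R) (h : nat) : (0 < h)%N -> 4 * ln2 <= x ->
  (1 - h%:R^-1) * expR (- (x / 4)) + expR (x - Num.sqrt (x * (x + ln h%:R))) <= 1.
Proof.
move=> h0 x4; have l0 := @ln2_gt R.
have x3 : 3 * ln2 <= x by lra.
have E4 : expR (- (x / 4)) <= 1 / 2.
  rewrite (_ : 1 / 2 = expR (- ln2)); first by rewrite ler_expR; lra.
  by rewrite expRN lnK ?posrE// div1r.
have hR : 0 < h%:R :> R by rewrite ltr0n.
(* The certificate [2 ^+ a <= g ^+ b] gives [ln h >= (a / b) * ln 2]; [e] is a rational bound for
   [2] to the power [- theta], and [c] one for [1 - h^-1]. *)
have hy (a b g : nat) (c theta e : R) : (0 < b)%N -> (0 < g)%N -> (g <= h)%N ->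
    2 ^+ a <= g%:R ^+ b :> R -> 0 <= theta -> 0 < e ->
    2 * theta + theta ^+ 2 / 3 <= a%:R / b%:R ->
    expR (- (theta * ln2)) <= e -> (1 - h%:R^-1) <= c -> 0 <= c -> c / 2 + e <= 1 ->
    (1 - h%:R^-1) * expR (- (x / 4)) + expR (x - Num.sqrt (x * (x + ln h%:R))) <= 1.
  move=> b0 g0 gh ab t0 e0 tab Ee hc c_ge0 ce.
  have bR : 0 < b%:R :> R by rewrite ltr0n.
  have h1 : expR (x - Num.sqrt (x * (x + ln h%:R))) <= e.
    apply: corner_bound x3 t0 _ Ee => //.
    apply: (@le_trans _ _ (a%:R / b%:R * ln2)); first by rewrite ler_wpM2r//; lra.
    by rewrite mulrAC ler_pdivrMr// [leRHS]mulrC (ln_nat_ge g0).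
  have h2 : (1 - h%:R^-1) * expR (- (x / 4)) <= c * (1 / 2).
    apply: le_trans (ler_wpM2r (expR_ge0 _) hc) _.
    by rewrite ler_wpM2l.
  lra.
have hV (c : nat) : (0 < c)%N -> (h <= c)%N -> 1 - h%:R^-1 <= 1 - c%:R^-1 :> R.
  move=> c0 hc; have : c%:R^-1 <= h%:R^-1 :> R by rewrite lef_pV2 ?posrE ?ltr0n// ler_nat.
  lra.
case: (leqP h 1) => h1.
  apply: (hy 0%N 1%N 1%N 0 0 1) => //.
  - by rewrite expr0n /=; lra.
  - by rewrite mul0r oppr0 expR0.
  - by have := hV 1%N isT h1; lra.
case: (leqP h 2) => h2.
  apply: (hy 1%N 1%N 2%N (1 / 2) (9 / 20) (3 / 4)) => //; try lra.
  - by apply: expRN_ln2_le; lra.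
  - by have := hV 2%N isT h2; lra.
case: (leqP h 3) => h3.
  apply: (hy 3%N 2%N 3%N (2 / 3) (2 / 3) (2 / 3)) => //; try lra.
  - by apply: expRN_ln2_le; lra.
  - by have := hV 3%N isT h3; lra.
case: (leqP h 5) => h5.
  apply: (hy 2%N 1%N 4%N (4 / 5) (3 / 4) (3 / 5)) => //; try lra.
  - by apply: expRN_ln2_le; lra.
  - by have := hV 5%N isT h5; lra.
apply: (hy 7%N 3%N 6%N 1 1 (1 / 2)) => //; try lra.
- by rewrite mul1r expRN lnK ?posrE// div1r.
Qed.

(** The depth cancels: [sqrt 2 ^+ m * 2 * expR (- (x / 2))] is 1 / 2 for [x = (m + 4) * ln 2], so
    the prefactor is at most 1 because [kappa = 107 / 160] is below [ln 2]. *)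
Lemma exp3_bound (m h : nat) : (0 < h)%N ->
  exists la s : R, [/\ 0 < la, 0 <= s - 53 / 160 / la &
    s - 53 / 160 / la + Num.sqrt 2 ^+ m * (2 / la * expR (- (la * s))) *
      ((h%:R - 1) * expR (la ^+ 2 / 2) + expR (la ^+ 2))
    <= Num.sqrt (2 * (m.+4%:R * ln 2 + ln h%:R))].
Proof.
move=> h0; have l0 := @ln2_gt R.
have mE : m.+4%:R = m%:R + 4 :> R by rewrite -natrD addn4.
have x4 : 4 * ln2 <= m.+4%:R * ln2 by rewrite ler_wpM2r ?ler_nat//; lra.
have e0 : 0 <= Num.sqrt 2 ^+ m :> R by rewrite exprn_ge0// sqrtr_ge0.
have := entropic_bound (kappa := 107 / 160) h0 (_ : 4 / 3 <= m.+4%:R * ln2) e0 _.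
rewrite (_ : 1 - 107 / 160 = 53 / 160); last by field.
apply; first by lra.
apply: le_trans _ (corner_deep h0 x4).
rewrite -[leRHS]mul1r; set K := (X in _ * X <= _ * X).
have K0 : 0 <= K.
  rewrite addr_ge0 ?expR_ge0// mulr_ge0 ?expR_ge0//.
  by rewrite subr_ge0 invf_le1 ?ltr0n// ler1n.
apply: ler_wpM2r => //.
rewrite sqrt2E -expRM_natl -[X in _ * (X * _) * _ <= _](lnK (_ : 2 \is Num.pos)) ?posrE//.
by rewrite -!expRD -[leRHS]expR0 ler_expR mE; lra.
Qed.

Lemma exp2_bound (h : nat) : (9 <= h)%N ->
  exists la s : R, [/\ 0 < la, 0 <= s - 257 / 400 / la &
    s - 257 / 400 / la + 2 / la * expR (- (la * s)) *
      ((h%:R - 1) * expR (la ^+ 2 / 2) + expR (la ^+ 2))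
    <= Num.sqrt (2 * (3 * ln 2 + ln h%:R))].
Proof.
move=> h9; have l0 := @ln2_gt R.
have h0 : (0 < h)%N by apply: leq_trans h9.
have hR : 0 < h%:R :> R by rewrite ltr0n.
(* This prefactor exceeds 1, so the bracket has to stay below 1 by a margin; [h >= 9] provides
   it. *)
have F : 2 * expR (143 / 400) * expR (- (3 * ln2 / 2)) <= 102 / 100.
  rewrite -mulrA -expRD -ler_pdivlMl//.
  apply: (@le_trans _ _ (expR (- (271 / 400)))); first by rewrite ler_expR; lra.
  by apply: expRN_le_num; lra.
have E1 : expR (- (3 * ln2 / 4)) <= 597 / 1000.
  rewrite (_ : 3 * ln2 / 4 = 3 / 4 * ln2); last by field.
  by apply: expRN_ln2_le; lra.
have V1 : 0 <= 1 - h%:R^-1 :> R by rewrite subr_ge0 invf_le1// ler1n.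
have := entropic_bound (x := 3 * ln2) (kappa := 143 / 400) (C := 1) h0 _ ler01.
rewrite (_ : 1 - 143 / 400 = 257 / 400); last by field.
under [X in _ -> _ -> X]eq_exists do under eq_exists do rewrite mul1r.
move=> H; apply: H; first by lra.
rewrite mul1r; move: F (expR_ge0 (143 / 400 : R)) (expR_ge0 (- (3 * ln2 / 2))).
set e1 := 2 * _ * _; set e2 := _ + _ => F e1_ge0 _.
have e1_ge : 0 <= e1 by rewrite !mulr_ge0 ?expR_ge0.
have fin (c e : R) : 1 - h%:R^-1 <= c ->
    expR (3 * ln2 - Num.sqrt (3 * ln2 * (3 * ln2 + ln h%:R))) <= e ->
    102 / 100 * (c * (597 / 1000) + e) <= 1 -> e1 * e2 <= 1.
  move=> hc he; apply: le_trans; apply: ler_pM e1_ge _ F (lerD (ler_pM V1 _ hc E1) he);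
    by rewrite ?addr_ge0 ?mulr_ge0 ?expR_ge0.
have [h13|h14] := leqP h 13.
  apply: (fin (12 / 13) (41 / 100)); [| |lra].
    have : 13^-1 <= h%:R^-1 :> R by rewrite lef_pV2 ?posrE// ler_nat.
    lra.
  apply: (@corner_bound _ _ (13 / 10) _ h h0 (lexx _)); [lra| |by apply: expRN_ln2_le; lra].
  have := @ln_nat_ge R 9 h 19 6 isT h9=> ly.
  by have {ly} := ly ltac:(lra); lra.
apply: (fin 1 (36 / 100)); [by rewrite gerBl invr_ge0 ltW| |lra].
apply: (@corner_bound _ _ (3 / 2) _ h h0 (lexx _)); [lra| |by apply: expRN_ln2_le; lra].
have := @ln_nat_ge R 14 h 15 4 isT h14=> ly.
by have {ly} := ly ltac:(lra); lra.
Qed.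

End corner.

(** * Depths 2 and 3 in small input dimension *)

Section small_widths.
Context {R : realType}.
Implicit Type h : nat.

Definition below_ch (w la sg z : R) := forall y, z <= y -> sg * (y - z) <= w * (ch (la * y) - 1).

Lemma below_ch_num (w la sg z r l : R) : 0 < w -> 0 < la -> 1 < r ->
  2 * sg * r <= w * la * (r ^+ 2 - 1) -> 0 <= l ->
  l * (r + 1) <= la * z * (r + 1) + (r - 1) ->
  r <= (1 + l / 32 + (l / 32) ^+ 2 / 2) ^+ 32 -> below_ch w la sg z.
Proof.
move=> w0 la0 r1 hsg l0 hl /(ln_le_num (lt_trans ltr01 r1) l0) hr y zy.
apply: (ch_tangent w0 la0 r1 hsg _ zy).
have r0 : 0 < r + 1 by lra.
apply: le_trans hr _.
rewrite -(ler_pM2r r0); apply: le_trans hl _.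
by rewrite mulrDl lerD2l mulrBl divfK ?gt_eqF//; lra.
Qed.

(** The second breakpoint is parametrised by the zero [z] of the last piece: beyond it the sum of
    the hinges is [3 / 2 * (y - z)]. *)
Lemma hinge1_le_ch (w la t z : R) : 0 < w -> t <= z ->
  below_ch w la (1 / 2) t -> below_ch w la (3 / 2) z ->
  forall y, 1 / 2 * hinge t y + hinge ((3 * z - t) / 2) y <= w * (ch (la * y) - 1).
Proof.
move=> w0 tz Ht Hz y; rewrite /hinge.
have g0 : 0 <= w * (ch (la * y) - 1) by rewrite mulr_ge0 ?(ltW w0)// subr_ge0 ch_ge1.
case: (lerP 0 (y - t)) => c0; last by rewrite max_l; lra.
case: (lerP 0 (y - (3 * z - t) / 2)) => c1; last by have := Ht y; lra.
by have := Hz y; lra.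
Qed.

(** Each [zi] is the zero of the line that extends the i-th piece, of slope 1 / 4, 5 / 4 or 9 / 4;
    [10 * z2 <= z1 + 9 * z3] puts the last two breakpoints in order. *)
Lemma hinge2_le_ch (w la z1 z2 z3 : R) : 0 < w -> z1 <= z2 <= z3 ->
  10 * z2 <= z1 + 9 * z3 ->
  below_ch w la (1 / 4) z1 -> below_ch w la (5 / 4) z2 -> below_ch w la (9 / 4) z3 ->
  forall y, 1 / 4 * hinge z1 y + hinge ((5 * z2 - z1) / 4) y
    + hinge ((9 * z3 - 5 * z2) / 4) y <= w * (ch (la * y) - 1).
Proof.
move=> w0 /andP[z12 z23] z123 H1 H2 H3 y; rewrite /hinge.
have g0 : 0 <= w * (ch (la * y) - 1) by rewrite mulr_ge0 ?(ltW w0)// subr_ge0 ch_ge1.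
case: (lerP 0 (y - z1)) => c0; last by rewrite !max_l; lra.
case: (lerP 0 (y - (5 * z2 - z1) / 4)) => c1; last by rewrite max_l; have := H1 y; lra.
case: (lerP 0 (y - (9 * z3 - 5 * z2) / 4)) => c2; last by have := H2 y; lra.
by have := H3 y; lra.
Qed.

Lemma ln_chord (p A B : R) : 0 <= p <= 1 -> 0 < A -> 0 < B ->
  (1 - p) * ln A + p * ln B <= ln ((1 - p) * A + p * B).
Proof.
move=> p01 A0 B0; have h := expR_chord (ln A) (ln B) p01.
have h0 := lt_le_trans (expR_gt0 _) h.
by move: h h0; rewrite !lnK ?posrE// => h h0; rewrite -[leLHS]expRK ler_ln ?posrE ?expR_gt0.
Qed.

(* It suffices to test the two ends of a range of widths, because [v] is affine in
   the width, so that its square is convex, while [ln] is concave. *)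
Lemma le_sqrt_ln (D a b h : nat) (v0 v1 ea eb : R) : (0 < a)%N -> (a < b)%N ->
  (a <= h <= b)%N -> 0 <= v0 -> 0 <= v1 -> 0 <= ea -> ea <= 8 -> 0 <= eb -> eb <= 8 ->
  (2 + ea / 32) ^+ 32 <= (2 ^+ D * a%:R) * (2 - ea / 32) ^+ 32 ->
  (2 + eb / 32) ^+ 32 <= (2 ^+ D * b%:R) * (2 - eb / 32) ^+ 32 ->
  (v0 + a%:R * v1) ^+ 2 <= 2 * ea -> (v0 + b%:R * v1) ^+ 2 <= 2 * eb ->
  v0 + h%:R * v1 <= Num.sqrt (2 * (D%:R * ln 2 + ln h%:R)).
Proof.
move=> a0 ab /andP[ah hb] v00 v10 ea0 ea8 eb0 eb8 Ha Hb va vb.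
have [aR bR] : 0 < a%:R :> R /\ 0 < b%:R :> R by rewrite !ltr0n (ltn_trans a0 ab).
have hR : 0 < h%:R :> R by rewrite ltr0n (leq_trans a0).
have D0 : 0 < 2 ^+ D :> R by rewrite exprn_gt0.
have {Ha}la := ln_ge_num (mulr_gt0 D0 aR) ea0 ea8 Ha.
have {Hb}lb := ln_ge_num (mulr_gt0 D0 bR) eb0 eb8 Hb.
have ba : 0 < b%:R - a%:R :> R by rewrite subr_gt0 ltr_nat.
pose p := (h%:R - a%:R) / (b%:R - a%:R) : R.
have p01 : 0 <= p <= 1.
  apply/andP; split; last by rewrite ler_pdivrMr// mul1r lerD2r ler_nat.
  by apply: divr_ge0; [rewrite subr_ge0 ler_nat|exact: ltW].
have hE : h%:R = (1 - p) * a%:R + p * b%:R by rewrite /p; field; rewrite gt_eqF.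
have vE : v0 + h%:R * v1 = (1 - p) * (v0 + a%:R * v1) + p * (v0 + b%:R * v1).
  by rewrite hE; ring.
rewrite -[leLHS]ger0_norm; last by rewrite addr_ge0// mulr_ge0// ltW.
rewrite -sqrtr_sqr ler_wsqrtr//.
have /andP[p0 p1] := p01; have p1' : 0 <= 1 - p by rewrite subr_ge0.
apply: (@le_trans _ _ (2 * ((1 - p) * ea + p * eb))).
  rewrite vE; move: va vb; set x := v0 + _; set y := v0 + _ => va vb.
  have := ler_wpM2l p1' va; have := ler_wpM2l p0 vb.
  have := mulr_ge0 (mulr_ge0 p0 p1') (sqr_ge0 (x - y)); lra.
rewrite ler_pM2l//.
rewrite [X in _ <= X + _](_ : _ = ln (2 ^+ D)); last by rewrite lnXn// mulr_natl.
rewrite -lnM ?posrE// (_ : 2 ^+ D * h%:R = (1 - p) * (2 ^+ D * a%:R) + p * (2 ^+ D * b%:R)).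
  apply: le_trans (ln_chord p01 (mulr_gt0 D0 aR) (mulr_gt0 D0 bR)).
  by rewrite lerD// ler_wpM2l.
by rewrite hE; ring.
Qed.

Lemma rate_chord (w l a b f0 ka p : R) : 0 <= w -> a < b -> a <= p <= b ->
  w * (expR (l ^+ 2 * (1 + a) / 2) - 1) <= f0 + ka * a ->
  w * (expR (l ^+ 2 * (1 + b) / 2) - 1) <= f0 + ka * b ->
  w * (expR (l ^+ 2 * (1 + p) / 2) - 1) <= f0 + ka * p.
Proof.
move=> w0 ab /andP[ap pb] Ha Hb; set s := (p - a) / (b - a).
have ba : 0 < b - a by rewrite subr_gt0.
have s01 : 0 <= s <= 1.
  by rewrite divr_ge0 ?subr_ge0 ?(ltW ab)//= ler_pdivrMr// mul1r lerD2r.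
have pE : p = (1 - s) * a + s * b by rewrite /s; field; rewrite gt_eqF.
have /andP[s0 s1] := s01; have s1' : 0 <= 1 - s by rewrite subr_ge0.
have := ler_wpM2l s1' Ha; have := ler_wpM2l s0 Hb.
have := ler_wpM2l w0 (expR_chord (l ^+ 2 * (1 + a) / 2) (l ^+ 2 * (1 + b) / 2) s01).
rewrite [in X in _ -> _ -> _ -> _ * (expR X - 1) <= _](_ : l ^+ 2 * (1 + p) / 2 =
  (1 - s) * (l ^+ 2 * (1 + a) / 2) + s * (l ^+ 2 * (1 + b) / 2)); last first.
  by rewrite {1}pE; field.
rewrite [in X in _ -> _ -> _ -> _ <= X]pE.
set E := expR (_ + _); set Ea := expR _; set Eb := expR _; lra.
Qed.

(** The cost of a coordinate is convex in [m l ^+ 2], so it lies below the affine function with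
    coefficients [f0] and [ka] on an interval as soon as it does at both ends; each rate is used on
    one of two intervals meeting at 2 / 5. Affine costs add up to at most [h * f0 + ka], however the
    mean is distributed. *)
Lemma two_rates h (m : 'I_h -> R) (w1 l1 w2 l2 f0 ka : R) (G : R -> R) :
  \sum_l m l ^+ 2 <= 1 -> 0 < w1 -> 0 < w2 ->
  (forall y, G y <= w1 * (ch (l1 * y) - 1)) ->
  (forall y, G y <= w2 * (ch (l2 * y) - 1)) -> 0 <= ka ->
  w1 * (expR (l1 ^+ 2 * (1 + 0) / 2) - 1) <= f0 + ka * 0 ->
  w1 * (expR (l1 ^+ 2 * (1 + 2 / 5) / 2) - 1) <= f0 + ka * (2 / 5) ->
  w2 * (expR (l2 ^+ 2 * (1 + 2 / 5) / 2) - 1) <= f0 + ka * (2 / 5) ->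
  w2 * (expR (l2 ^+ 2 * (1 + 1) / 2) - 1) <= f0 + ka * 1 ->
  exists w la : 'I_h -> R, [/\ forall l, 0 <= w l,
    forall l y, G y <= w l * (ch (la l * y) - 1) &
    \sum_l w l * (expR (la l ^+ 2 * (1 + m l ^+ 2) / 2) - 1) <= h%:R * f0 + ka].
Proof.
move=> m1 w10 w20 G1 G2 ka0 E10 E11 E21 E22.
exists (fun l => if m l ^+ 2 <= 2 / 5 then w1 else w2).
exists (fun l => if m l ^+ 2 <= 2 / 5 then l1 else l2).
have ml1 l : m l ^+ 2 <= 1.
  by apply: le_trans m1; rewrite (bigD1 l)//= lerDl sumr_ge0// => j _; exact: sqr_ge0.
split=> [l|l y|]; [by case: ifP => _; exact: ltW|by case: ifP|].
apply: (@le_trans _ _ (\sum_(l < h) (f0 + ka * m l ^+ 2))).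
  apply: ler_sum => l _; case: (lerP (m l ^+ 2) (2 / 5)) => hm.
    by apply: rate_chord (ltW w10) _ _ E10 E11; rewrite ?sqr_ge0//; lra.
  by apply: rate_chord (ltW w20) _ _ E21 E22; rewrite ?(ltW hm) ?ml1//; lra.
by rewrite big_split /= sumr_const card_ord -(mulr_natl f0) -mulr_sumr lerD2l ler_piMr.
Qed.

Lemma scaled_expR_le (w x u c : R) : 0 <= w -> 0 <= x -> x <= 8 ->
  (2 + x / 32) ^+ 32 <= u * (2 - x / 32) ^+ 32 -> w * (u - 1) <= c ->
  w * (expR x - 1) <= c.
Proof.
move=> w0 x0 x8 H; apply: le_trans; rewrite ler_wpM2l// lerD2r; exact: expR_le_num.
Qed.

(* What [layer_bound_ch1] and [rademacher_1oo] ask for at depth 2, [m] being the mean of the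
   sample relative to [Gamma]; [hinge2_data] plays the same role at depth 3. *)
Definition hinge1_data h (m : 'I_h -> R) :=
  exists (t0 t1 delta : R) (w la : 'I_h -> R),
  [/\ 0 <= (t0 + t1) / 2, 0 <= delta <= 1, forall l, 0 <= w l,
    forall l y, 0 <= y -> 1 / 2 * hinge t0 y + hinge t1 y <= w l * (ch (la l * y) - delta) &
    (t0 + t1) / 2 + \sum_l w l * (expR (la l ^+ 2 * (1 + m l ^+ 2) / 2) - delta)
    <= Num.sqrt (2 * (2%:R * ln 2 + ln h%:R))].

Definition hinge2_data h :=
  exists t0 t1 t2 w la : R, [/\ 0 <= (t0 + 2 * t1 + t2) / 4, 0 <= w,
    forall y, 1 / 4 * hinge t0 y + hinge t1 y + hinge t2 y <= w * (ch (la * y) - 1) &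
    (t0 + 2 * t1 + t2) / 4
    + w * (h%:R * (expR (la ^+ 2 / 2) - 1) + (expR (la ^+ 2) - expR (la ^+ 2 / 2)))
    <= Num.sqrt (2 * (3%:R * ln 2 + ln h%:R))].

Lemma hinge1_data_rates h (m : 'I_h -> R) (w1 l1 w2 l2 t z f0 ka : R) :
  \sum_l m l ^+ 2 <= 1 -> 0 < w1 -> 0 < w2 -> 0 <= t -> t <= z -> 0 <= ka ->
  below_ch w1 l1 (1 / 2) t -> below_ch w1 l1 (3 / 2) z ->
  below_ch w2 l2 (1 / 2) t -> below_ch w2 l2 (3 / 2) z ->
  w1 * (expR (l1 ^+ 2 * (1 + 0) / 2) - 1) <= f0 + ka * 0 ->
  w1 * (expR (l1 ^+ 2 * (1 + 2 / 5) / 2) - 1) <= f0 + ka * (2 / 5) ->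
  w2 * (expR (l2 ^+ 2 * (1 + 2 / 5) / 2) - 1) <= f0 + ka * (2 / 5) ->
  w2 * (expR (l2 ^+ 2 * (1 + 1) / 2) - 1) <= f0 + ka * 1 ->
  ((t + 3 * z) / 4 + ka) + h%:R * f0 <= Num.sqrt (2 * (2%:R * ln 2 + ln h%:R)) ->
  hinge1_data m.
Proof.
move=> m1 w10 w20 t_ge0 tz ka0 B1 B2 B3 B4 E1 E2 E3 E4 H.
have [w [la [w0 Hw Hs]]] := two_rates m1 w10 w20 (hinge1_le_ch w10 tz B1 B2)
  (hinge1_le_ch w20 tz B3 B4) ka0 E1 E2 E3 E4.
exists t, ((3 * z - t) / 2), 1, w, la.
rewrite (_ : (t + (3 * z - t) / 2) / 2 = (t + 3 * z) / 4); last by field.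
split=> //; [lra|by rewrite ler01 lexx|].
by apply: le_trans H; rewrite -[leRHS]addrA lerD2l addrC.
Qed.

Lemma hinge2_data_rate h (w la z1 z2 z3 u1 u2 : R) : (0 < h)%N ->
  0 < w -> 0 <= z1 -> z1 <= z2 -> z2 <= z3 -> 10 * z2 <= z1 + 9 * z3 ->
  below_ch w la (1 / 4) z1 -> below_ch w la (5 / 4) z2 -> below_ch w la (9 / 4) z3 ->
  expR (la ^+ 2 / 2) <= u1 -> expR (la ^+ 2) <= u2 ->
  ((z1 / 2 + 5 / 4 * z2 + 9 / 4 * z3) / 4 + w * (u2 - u1)) + h%:R * (w * (u1 - 1))
    <= Num.sqrt (2 * (3%:R * ln 2 + ln h%:R)) ->
  hinge2_data h.
Proof.
move=> h0 w0 z10 z12 z23 z123 B1 B2 B3 E1 E2 H.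
exists z1, ((5 * z2 - z1) / 4), ((9 * z3 - 5 * z2) / 4), w, la.
rewrite (_ : (z1 + _ + _) / 4 = (z1 / 2 + 5 / 4 * z2 + 9 / 4 * z3) / 4); last by field.
split; [lra|exact: ltW|by apply: hinge2_le_ch; rewrite ?z12|].
apply: le_trans H; rewrite -[leRHS]addrA lerD2l [h%:R * (w * _)]mulrCA -mulrDr ler_pM2l//.
have h1 : 0 <= h%:R - 1 :> R by rewrite subr_ge0 ler1n.
by have := ler_wpM2l h1 E1; lra.
Qed.

(* The rates and weights below come from a numerical minimisation over each range of
   widths. A coordinate uses the first rate if its mean is small ([m l ^ 2 <= 2 / 5]), and the
   second otherwise. *)
Let hinge1_data_1_2 h (m : 'I_h -> R) : (1 <= h <= 2)%N -> \sum_l m l ^+ 2 <= 1 ->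
  hinge1_data m.
Proof.
move=> hab m1.
apply: (hinge1_data_rates (w1 := (5 / 2)) (l1 := (1 / 2)) (w2 := (5 / 2)) (l2 := (1 / 2))
  (t := (2 / 5)) (z := (221 / 200)) (f0 := (333 / 1000)) (ka := (189 / 500)) m1);
  [lra|lra|lra|lra|lra|..].
- by apply: (@below_ch_num _ _ _ _ (37 / 25) (393 / 1000)); lra.
- by apply: (@below_ch_num _ _ _ _ (139 / 50) (1023 / 1000)); lra.
- by apply: (@below_ch_num _ _ _ _ (37 / 25) (393 / 1000)); lra.
- by apply: (@below_ch_num _ _ _ _ (139 / 50) (1023 / 1000)); lra.
- by apply: (@scaled_expR_le _ _ (417 / 368)); lra.
- by apply: (@scaled_expR_le _ _ (31 / 26)); lra.
- by apply: (@scaled_expR_le _ _ (31 / 26)); lra.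
- by apply: (@scaled_expR_le _ _ (113 / 88)); lra.
by apply: (@le_sqrt_ln 2 1 2 h _ _ (269 / 200) (973 / 500)) ; [by []|by []|by []|lra..].
Qed.

Let hinge1_data_3_5 h (m : 'I_h -> R) : (3 <= h <= 5)%N -> \sum_l m l ^+ 2 <= 1 ->
  hinge1_data m.
Proof.
move=> hab m1.
apply: (hinge1_data_rates (w1 := (13 / 250)) (l1 := (3 / 2)) (w2 := (9 / 50)) (l2 := (21 / 20))
  (t := (57 / 50)) (z := (181 / 100)) (f0 := (217 / 2000)) (ka := (127 / 500)) m1);
  [lra|lra|lra|lra|lra|..].
- by apply: (@below_ch_num _ _ _ _ (129 / 10) (1283 / 500)); lra.
- by apply: (@below_ch_num _ _ _ _ (77 / 2) (458 / 125)); lra.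
- by apply: (@below_ch_num _ _ _ _ (137 / 25) (236 / 125)); lra.
- by apply: (@below_ch_num _ _ _ _ (797 / 50) (1391 / 500)); lra.
- by apply: (@scaled_expR_le _ _ (37 / 12)); lra.
- by apply: (@scaled_expR_le _ _ 5); lra.
- by apply: (@scaled_expR_le _ _ (13 / 6)); lra.
- by apply: (@scaled_expR_le _ _ (217 / 72)); lra.
by apply: (@le_sqrt_ln 2 3 5 h _ _ (2469 / 1000) (119 / 40)) ; [by []|by []|by []|lra..].
Qed.

Let hinge1_data_6_8 h (m : 'I_h -> R) : (6 <= h <= 8)%N -> \sum_l m l ^+ 2 <= 1 ->
  hinge1_data m.
Proof.
move=> hab m1.
apply: (hinge1_data_rates (w1 := (11 / 1000)) (l1 := (19 / 10)) (w2 := (17 / 250)) (l2 := (5 / 4))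
  (t := (77 / 50)) (z := (421 / 200)) (f0 := (7 / 125)) (ka := (201 / 1000)) m1);
  [lra|lra|lra|lra|lra|..].
- by apply: (@below_ch_num _ _ _ _ (1197 / 25) (777 / 200)); lra.
- by apply: (@below_ch_num _ _ _ _ (3589 / 25) (997 / 200)); lra.
- by apply: (@below_ch_num _ _ _ _ (593 / 50) (2769 / 1000)); lra.
- by apply: (@below_ch_num _ _ _ _ (1767 / 50) (447 / 125)); lra.
- by apply: (@scaled_expR_le _ _ (67 / 11)); lra.
- by apply: (@scaled_expR_le _ _ 13); lra.
- by apply: (@scaled_expR_le _ _ 3); lra.
- by apply: (@scaled_expR_le _ _ (43 / 9)); lra.
by apply: (@le_sqrt_ln 2 6 8 h _ _ (3127 / 1000) (1707 / 500)) ; [by []|by []|by []|lra..].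
Qed.

Let hinge1_data_9_16 h (m : 'I_h -> R) : (9 <= h <= 16)%N -> \sum_l m l ^+ 2 <= 1 ->
  hinge1_data m.
Proof.
move=> hab m1.
apply: (hinge1_data_rates (w1 := (1 / 500)) (l1 := (47 / 20)) (w2 := (31 / 1000)) (l2 := (7 / 5))
  (t := (187 / 100)) (z := (469 / 200)) (f0 := (3 / 100)) (ka := (4 / 25)) m1);
  [lra|lra|lra|lra|lra|..].
- by apply: (@below_ch_num _ _ _ _ 213 (1077 / 200)); lra.
- by apply: (@below_ch_num _ _ _ _ 639 (6507 / 1000)); lra.
- by apply: (@below_ch_num _ _ _ _ (231 / 10) (707 / 200)); lra.
- by apply: (@below_ch_num _ _ _ _ (3457 / 50) (2127 / 500)); lra.
- by apply: (@scaled_expR_le _ _ 16); lra.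
- by apply: (@scaled_expR_le _ _ 48); lra.
- by apply: (@scaled_expR_le _ _ 4); lra.
- by apply: (@scaled_expR_le _ _ (57 / 8)); lra.
by apply: (@le_sqrt_ln 2 9 16 h _ _ (441 / 125) (1027 / 250)) ; [by []|by []|by []|lra..].
Qed.

Let hinge2_data_1_2 h : (1 <= h <= 2)%N -> hinge2_data h.
Proof.
move=> hab; have /andP[h0 _] := hab.
apply: (hinge2_data_rate (w := (8 / 5)) (la := (3 / 5)) (z1 := (9 / 40)) (z2 := (99 / 100))
  (z3 := (31 / 20)) (u1 := (599 / 500)) (u2 := (717 / 500)) h0); [lra|lra|lra|lra|lra|..].
- by apply: (@below_ch_num _ _ _ _ (13 / 10) (53 / 200)); lra.
- by apply: (@below_ch_num _ _ _ _ (74 / 25) (136 / 125)); lra.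
- by apply: (@below_ch_num _ _ _ _ (49 / 10) (1591 / 1000)); lra.
- by apply: expR_le_num; lra.
- by apply: expR_le_num; lra.
by apply: (@le_sqrt_ln 3 1 2 h _ _ (1813 / 1000) (1233 / 500)) ; [by []|by []|by []|lra..].
Qed.

Let hinge2_data_3_8 h : (3 <= h <= 8)%N -> hinge2_data h.
Proof.
move=> hab; have /andP[h0 _] := hab.
apply: (hinge2_data_rate (w := (1 / 25)) (la := (3 / 2)) (z1 := (9 / 10)) (z2 := (93 / 50))
  (z3 := (56 / 25)) (u1 := (3081 / 1000)) (u2 := (9497 / 1000)) (ltnW (ltnW h0)));
  [lra|lra|lra|lra|lra|..].
- by apply: (@below_ch_num _ _ _ _ (423 / 50) (1069 / 500)); lra.
- by apply: (@below_ch_num _ _ _ _ (417 / 10) (3743 / 1000)); lra.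
- by apply: (@below_ch_num _ _ _ _ (3751 / 50) (4333 / 1000)); lra.
- by apply: expR_le_num; lra.
- by apply: expR_le_num; lra.
by apply: (@le_sqrt_ln 3 3 8 h _ _ (3027 / 1000) (4137 / 1000)) ; [by []|by []|by []|lra..].
Qed.

Lemma hinge1_data_le16 h (m : 'I_h -> R) : (0 < h <= 16)%N -> \sum_l m l ^+ 2 <= 1 ->
  hinge1_data m.
Proof.
move=> /andP[h0 h16].
have [h2|h2] := leqP h 2; first by apply: hinge1_data_1_2; rewrite h0.
have [h5|h5] := leqP h 5; first by apply: hinge1_data_3_5; rewrite h2.
have [h8|h8] := leqP h 8; first by apply: hinge1_data_6_8; rewrite h5.
by apply: hinge1_data_9_16; rewrite h8.
Qed.

Lemma hinge2_data_le8 h : (0 < h <= 8)%N -> hinge2_data h.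
Proof.
move=> /andP[h0 h8].
have [h2|h2] := leqP h 2; first by apply: hinge2_data_1_2; rewrite h0.
by apply: hinge2_data_3_8; rewrite h2.
Qed.

End small_widths.

(** * Depth 2 in large input dimension *)

Section large_width.
Context {R : realType}.

(** The left side is a perspective of the exponential, hence convex in [v]; the right side is its
    chord between [v = 1] and [v = 2]. *)
Lemma perspective_expR_le (A v : R) : 1 <= v <= 2 ->
  v * expR (- (A / v)) <= (2 - v) * expR (- A) + (v - 1) * (2 * expR (- (A / 2))).
Proof.
move=> /andP[v1 v2]; have v0 : 0 < v by lra.
have p01 : 0 <= 2 * (v - 1) / v <= 1.
  by rewrite divr_ge0 ?ler_pdivrMr ?mul1r; lra.
have := expR_chord (- A) (- (A / 2)) p01.
rewrite (_ : _ + _ = - (A / v)); last by field; rewrite gt_eqF.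
rewrite -(ler_pM2l v0) => /le_trans; apply; rewrite le_eqVlt; apply/orP; left; apply/eqP.
by field; rewrite gt_eqF.
Qed.

(** The tangent of slope 3 / 2 vanishes at [a] for every rate, and the one of slope 1 / 2 at
    [a - ln 3 / la]. The breakpoints must serve all coordinates, whose rates differ, so they are
    those of the extreme rate [la = a]. *)
Lemma hinge1_le_expR (a la y : R) : 0 < la -> la <= a ->
  1 / 2 * hinge (a - ln 3 / a) y + hinge (a + ln 3 / (2 * a)) y
  <= 3 / 2 / la * expR (la * (y - a) - 1).
Proof.
move=> la0 laa; have a0 := lt_le_trans la0 laa.
set u := la * (y - a); set t0 := a - _; set t1 := a + _.
have l3 : 0 <= ln 3 :> R by rewrite ln_ge0// ler1n.
have yE : y = a + u / la by rewrite /u; field; rewrite gt_eqF.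
have k0 : 0 <= 3 / 2 / la :> R by rewrite !divr_ge0// ltW.
have g0 : 0 <= 3 / 2 / la * expR (u - 1) by rewrite mulr_ge0 ?expR_ge0.
have L1 : 1 / 2 * (y - t0) <= 3 / 2 / la * expR (u - 1).
  have l3a : ln 3 / a <= ln 3 / la by rewrite ler_wpM2l// lef_pV2 ?posrE.
  have := @expR_line R 3^-1 (- ln 3) (u - 1).
  rewrite lnV ?posrE// lexx invr_gt0 => /(_ (ltr0Sn _ _) isT) hu.
  rewrite (_ : 3 / 2 / la * _ = 3 * expR (u - 1) / 2 / la); last by ring.
  apply: (@le_trans _ _ ((u + ln 3) / 2 / la)); first by rewrite {1}yE /t0; lra.
  by rewrite !ler_pM2r ?invr_gt0//; lra.
have L2 : 3 / 2 * (y - a) <= 3 / 2 / la * expR (u - 1).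
  have hu : u <= expR (u - 1) by have := expR_ge1Dx (u - 1); lra.
  rewrite {1}yE (_ : _ * (_ - a) = 3 / 2 / la * u); last by ring.
  by rewrite ler_wpM2l.
have t0a : t0 <= a by rewrite gerBl divr_ge0// ltW.
have t1E : t1 = (3 * a - t0) / 2 by rewrite /t0 /t1; field; rewrite gt_eqF.
rewrite /hinge t1E; clearbody t0; move: L1 L2 g0; set E := _ * expR _ => L1 L2 g0.
case: (lerP 0 (y - t0)) => c0; last by rewrite max_l; lra.
by case: (lerP 0 (y - (3 * a - t0) / 2)) => c1; lra.
Qed.

(** After multiplication by [a] the left side is at most [a ^+ 2 + 755 / 1000], and squaring then
    leaves an inequality linear in [a ^+ 2]. *)
Lemma large_width_cost (a g : R) : 0 < a -> 68 / 10 <= a ^+ 2 -> 0 < g ->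
  g <= 182 / 1000 ->
  a - ln 3 / (4 * a) + 3 / (expR 1 * a) * (9 / 16 + 2 * g)
  <= Num.sqrt (a ^+ 2 + 4 * ln (3 / 2)).
Proof.
move=> a0 a2 g0 gle.
have l3 : 1098 / 1000 <= ln 3 :> R by apply: ln_ge_num; lra.
have l32 : 405 / 1000 <= ln (3 / 2) :> R by apply: ln_ge_num; lra.
have e1 : 2717 / 1000 <= expR 1 :> R by apply: expR_ge_num; lra.
rewrite -(ler_pM2l a0) -[X in _ <= X * _](gtr0_norm a0) -sqrtr_sqr -sqrtrM ?sqr_ge0//.
apply: (@le_trans _ _ (a ^+ 2 + 755 / 1000)).
  rewrite [leLHS](_ : _ = a ^+ 2 + (3 / expR 1 * (9 / 16 + 2 * g) - ln 3 / 4)); last first.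
    by field; rewrite !gt_eqF// expR_gt0.
  rewrite lerD2l.
  have : 3 / expR 1 <= 1105 / 1000 :> R by rewrite ler_pdivrMr ?expR_gt0//; lra.
  move=> /(ler_wpM2r (_ : 0 <= 9 / 16 + 2 * g)) h3.
  by have {h3} := h3 ltac:(lra); lra.
rewrite -[leLHS]ger0_norm; last by lra.
rewrite -sqrtr_sqr ler_wsqrtr//.
by have := ler_wpM2l (sqr_ge0 a) l32; lra.
Qed.

(* The rates [a / v] are the optimal ones for the variance proxies [v = 1 + m ^ 2]. *)
Lemma hinge1_data_ge17 h (m : 'I_h -> R) : (17 <= h)%N -> \sum_l m l ^+ 2 <= 1 ->
  hinge1_data m.
Proof.
move=> h17 m1.
have hR : 17 <= h%:R :> R by rewrite ler_nat.
(* With this choice the squared target is [a ^+ 2 + 4 * ln (3 / 2)], and [h * expR (- A)] is the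
   constant 9 / 16. *)
pose A : R := ln (16 / 9 * h%:R); pose a := Num.sqrt (2 * A).
have X0 : 0 < 16 / 9 * h%:R :> R by lra.
have A34 : 34 / 10 <= A.
  apply: (@le_trans _ _ (ln (16 / 9 * 17))); first by apply: ln_ge_num; lra.
  by rewrite ler_ln ?posrE//; lra.
have a2 : a ^+ 2 = 2 * A by rewrite sqr_sqrtr//; lra.
have a0 : 0 < a by rewrite sqrtr_gt0; lra.
pose t0 := a - ln 3 / a; pose t1 := a + ln 3 / (2 * a).
pose v l := 1 + m l ^+ 2.
have v12 l : 1 <= v l <= 2.
  rewrite /v lerDl sqr_ge0 -lerBrDl /= (_ : 2 - 1 = 1); last by ring.
  by apply: le_trans m1; rewrite (bigD1 l)//= lerDl sumr_ge0// => j _; exact: sqr_ge0.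
have v0 l : 0 < v l by have /andP[v1 _] := v12 l; lra.
pose la l := a / v l; pose w l := 3 / la l * expR (- (la l * a) - 1).
have la0 l : 0 < la l by rewrite divr_gt0.
have tE : (t0 + t1) / 2 = a - ln 3 / (4 * a) by rewrite /t0 /t1; field; rewrite gt_eqF.
exists t0, t1, 0, w, la; split.
- rewrite tE subr_ge0 ler_pdivrMr ?mulr_gt0//.
  rewrite (_ : a * (4 * a) = 4 * a ^+ 2); last by ring.
  by have : ln 3 <= 2 :> R by [apply: ln_le_num; lra]; rewrite a2; lra.
- by rewrite lexx ler01.
- by move=> l; rewrite mulr_ge0 ?expR_ge0// divr_ge0// ltW.
- move=> l y _.
  have laa : la l <= a.
    by rewrite /la ler_pdivrMr// ler_peMr ?(ltW a0)//; have /andP[] := v12 l.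
  apply: le_trans (hinge1_le_expR y (la0 l) laa) _.
  rewrite (_ : la l * (y - a) - 1 = - (la l * a) - 1 + la l * y); last by ring.
  rewrite expRD /w /ch subr0.
  have k0 : 0 <= 3 / 2 / la l * expR (- (la l * a) - 1).
    by rewrite mulr_ge0 ?expR_ge0// divr_ge0 ?ltW//.
  have := mulr_ge0 k0 (expR_ge0 (- (la l * y))).
  set x1 := expR _; set x2 := expR _; set x3 := expR _; lra.
rewrite tE.
pose g := expR (- (A / 2)).
have g0 : 0 < g := expR_gt0 _.
have g2 : g ^+ 2 = expR (- A) by rewrite /g -expRM_natl; congr expR; field.
have hA : h%:R * g ^+ 2 = 9 / 16.
  by rewrite g2 expRN lnK ?posrE//; field; rewrite gt_eqF//; lra.
have gle : g <= 182 / 1000.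
  have := ler_wpM2r (sqr_ge0 g) hR; rewrite hA => g3.
  rewrite leNgt; apply/negP => gg.
  by have := ler_wpM2l (ltW g0) (ltW gg); lra.
have S : \sum_l w l * (expR (la l ^+ 2 * (1 + m l ^+ 2) / 2) - 0) <=
   3 / (expR 1 * a) * (9 / 16 + 2 * g).
  have K0 : 0 <= 3 / (expR 1 * a) by rewrite divr_ge0// mulr_ge0 ?expR_ge0 ?ltW.
  (* At rate [a / v l] the exponent becomes [- (A / v l) - 1], and the weight contributes the factor
     [v l]; the chord makes the cost affine in [m l ^+ 2]. *)
  apply: (@le_trans _ _ (\sum_(l < h) 3 / (expR 1 * a) * (g ^+ 2 + m l ^+ 2 * (2 * g - g ^+ 2)))).
    apply: ler_sum => l _; rewrite subr0 -/(v l) /w -mulrA -expRD.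
    rewrite (_ : - (la l * a) - 1 + _ = - (A / v l) - 1); last first.
      have AE : A = a ^+ 2 / 2 by rewrite a2; field.
      by rewrite AE /la; field; rewrite gt_eqF.
    rewrite expRB (_ : 3 / la l * _ = 3 / (expR 1 * a) * (v l * expR (- (A / v l)))); last first.
      by rewrite /la; field; rewrite !gt_eqF ?expR_gt0.
    rewrite ler_wpM2l//; apply: le_trans (perspective_expR_le A (v12 l)) _.
    by rewrite -g2 -/g /v; lra.
  rewrite -mulr_sumr ler_wpM2l// big_split /= sumr_const card_ord -(mulr_natl (g ^+ 2)) hA.
  rewrite lerD2l -mulr_suml; have d0 : 0 <= 2 * g - g ^+ 2.
    by have := ler_wpM2l (ltW g0) gle; rewrite -expr2; lra.
  by have := ler_wpM2r d0 m1; have := sqr_ge0 g; lra.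
apply: le_trans (lerD (lexx _) S) _.
have B : 2 * (2%:R * ln 2 + ln h%:R) = a ^+ 2 + 4 * ln (3 / 2).
  rewrite a2 /A lnM ?posrE; [|lra|lra].
  have : ln (2 * 2) = ln (16 / 9 * (3 / 2 * (3 / 2))) :> R by congr ln; field.
  have [p2 p1] : (0 < 3 / 2 :> R) /\ (0 < 16 / 9 :> R) by split; lra.
  by rewrite !(lnM (x := 2), lnM (x := 16 / 9), lnM (x := 3 / 2)) ?posrE ?mulr_gt0//; lra.
by rewrite B; apply: large_width_cost => //; rewrite a2; lra.
Qed.

End large_width.

(** * Part (II) *)

Section part_1oo.
Context {R : realType} {n d : nat} {k : nat -> nat}.
Variables (sigma : nat -> R -> R) (L M : nat -> R) (Gamma : R).
Variable mu : probability (borel_cV R (k 1%N)) R.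
Hypotheses (hn : (0 < n)%N) (hG : 0 < Gamma) (hmu : PuB Gamma mu) (d0 : (0 < d)%N).
Hypotheses (hk : forall i, (1 <= i <= d.+1)%N -> (0 < k i)%N)
  (M0 : forall i, (1 <= i <= d.+1)%N -> 0 < M i)
  (L0 : forall i, (1 <= i < d.+1)%N -> 0 < L i)
  (sh : forall i, (1 <= i < d.+1)%N -> {homo sigma i : x y / x <= y})
  (sL : forall i, (1 <= i < d.+1)%N -> forall x y,
     `|sigma i x - sigma i y| <= L i * `|x - y|)
  (s0 : forall i, (1 <= i < d.+1)%N -> sigma i 0 = 0).
Local Notation h := (k 1%N).
Local Notation m := (rel_mean Gamma mu).
Local Notation mean_cost := (fun delta (w la : 'I_h -> R) =>
  \sum_l w l * (expR (la l ^+ 2 * (1 + m l ^+ 2) / 2) - delta)).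

Let layer_bound_last (c delta : R) (w la : 'I_h -> R) :=
  forall x : n.-tuple (borel_cV R h), layer_bound (d := d) sigma L M Gamma x d id
    (2 ^+ n * c + \sum_e \sum_l w l * (ch (la l * signed_sample Gamma x e l) - delta)).

Let h0 : (0 < h)%N. Proof. exact: hk. Qed.

Let m1 : \sum_l m l ^+ 2 <= 1 := rel_mean_le1 hG hmu.

Lemma mean_cost_const (C la : R) :
  0 <= C -> mean_cost 0 (fun=> C) (fun=> la) <=
    C * ((h%:R - 1) * expR (la ^+ 2 / 2) + expR (la ^+ 2)).
Proof.
move=> C0 /=; rewrite -mulr_sumr ler_wpM2l//.
by under eq_bigr do rewrite subr0; exact: corner_sum.
Qed.

Lemma layer_bound_cost : exists (c delta : R) (w la : 'I_h -> R),
  [/\ 0 <= c, 0 <= delta <= 1, forall l, 0 <= w l, layer_bound_last c delta w la &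
    c + mean_cost delta w la <= Num.sqrt (2 * (d.+1%:R * ln 2 + ln h%:R))].
Proof.
have trans_d j C x : j = d -> layer_bound (d := d) sigma L M Gamma x j id C ->
  @layer_bound R n d k sigma L M Gamma x d id C by move=> ->.
have d01 : 0 <= (0 : R) <= 1 by rewrite lexx ler01.
have d11 : 0 <= (1 : R) <= 1 by rewrite ler01 lexx.
(* The depth is [d.+1]: one hidden layer allows one hinge step, two allow two, and from three on the
   layers before the last three are passed with exponentials. *)
case: (ltngtP d 2) => d2.
- have dE : d = 1%N by apply/eqP; rewrite eqn_leq d0 andbT -ltnS.
  have [t0 [t1 [delta [w [la [c0 dl w0 H cost]]]]]] : hinge1_data m.
    have [h16|h17] := leqP h 16; first by apply: hinge1_data_le16; rewrite ?h0.
    exact: hinge1_data_ge17.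
  exists ((t0 + t1) / 2), delta, w, la; split=> //; last by rewrite dE.
  move=> x; apply: (@trans_d 1%N) => //.
  exact: (layer_bound_ch1 hn hG hk M0 L0 sh sL s0 x d0).
- pose j := (d - 3)%N.
  have jd : (j.+3 = d)%N by rewrite /j -addn3 subnK.
  have [la [s [la0 c0 cost]]] := @exp3_bound R j h h0.
  exists (s - 53 / 160 / la), 0.
  exists (fun=> Num.sqrt 2 ^+ j * (2 / la * expR (- (la * s)))), (fun=> la).
  have C0 : 0 <= Num.sqrt 2 ^+ j * (2 / la * expR (- (la * s))).
    by rewrite mulr_ge0 ?exprn_ge0 ?sqrtr_ge0// mulr_ge0 ?expR_ge0// divr_ge0// ltW.
  split=> //.
    move=> x; apply: (trans_d _ _ _ jd).
    exact: (layer_bound_exp3 hn hG hk M0 L0 sh sL s0 x s la0 (eq_leq jd)).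
  apply: le_trans (lerD (lexx _) (mean_cost_const _ C0)) _.
  by rewrite -jd.
have [h8|h9] := leqP h 8.
  have [t0 [t1 [t2 [w [la [c0 w0 H cost]]]]]] := @hinge2_data_le8 R h (introT andP (conj h0 h8)).
  exists ((t0 + 2 * t1 + t2) / 4), 1, (fun=> w), (fun=> la); split=> //.
    move=> x; apply: (@trans_d 2%N) => //.
    by apply: (layer_bound_ch2 hn hG hk M0 L0 sh sL s0 x (eq_leq (esym d2))) => l y _; exact: H.
  rewrite d2; apply: le_trans cost; rewrite lerD2l -mulr_sumr ler_wpM2l//.
  rewrite sumrB sumr_const card_ord; have := corner_sum la m1; lra.
have [la [s [la0 c0 cost]]] := @exp2_bound R h h9.
exists (s - 257 / 400 / la), 0, (fun=> 2 / la * expR (- (la * s))), (fun=> la).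
have C0 : 0 <= 2 / la * expR (- (la * s)).
  by rewrite mulr_ge0 ?expR_ge0// divr_ge0// ltW.
split=> //.
  move=> x; apply: (@trans_d 2%N) => //.
  exact: (layer_bound_exp2 hn hG hk M0 L0 sh sL s0 x s la0 (eq_leq (esym d2))).
apply: le_trans (lerD (lexx _) (mean_cost_const _ C0)) _.
by rewrite d2.
Qed.

Lemma rademacher_1oo_le :
  (rademacher n (nn_class sigma (weights_1oo k d.+1 M)) mu <=
   (Num.sqrt 2 * Gamma * (\prod_(1 <= i < d.+2) M i) * (\prod_(1 <= i < d.+1) L i)
     * Num.sqrt (d.+1%:R * ln 2 + ln h%:R) / Num.sqrt n%:R)%:E)%E.
Proof.
have [c [delta [w [la [c0 d01 w0 H cost]]]]] := layer_bound_cost.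
apply: le_trans (rademacher_1oo hn hG hmu hk M0 L0 c0 d01 w0 H) _.
rewrite lee_fin.
set B := (X in n%:R^-1 * (X * _)).
have nR : 0 < n%:R :> R by rewrite ltr0n.
have B0 : 0 <= B.
  rewrite !mulr_ge0 ?(ltW hG) ?sqrtr_ge0// big_nat_cond prodr_ge0// => i.
    by rewrite andbT ltnS => hi; apply/ltW/M0.
  by rewrite andbT => hi; apply/ltW/L0.
apply: (@le_trans _ _ (n%:R^-1 * (B * Num.sqrt (2 * (d.+1%:R * ln 2 + ln h%:R))))).
  by rewrite ler_wpM2l ?invr_ge0 ?(ltW nR)// ler_wpM2l.
rewrite sqrtrM// /B /sample_scale le_eqVlt; apply/orP; left; apply/eqP.
rewrite -[X in X^-1 * _](sqr_sqrtr (ltW nR)); field.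
by rewrite gt_eqF// sqrtr_gt0.
Qed.

End part_1oo.

Theorem theorem7 (R : realType) (d n : nat) (k : nat -> nat)
    (sigma : nat -> R -> R) (L MF M1 : nat -> R) (Gamma : R)
    (mu : probability (borel_cV R (k 1%N)) R)
    (hd : (2 <= d)%N) (hn : (1 <= n)%N)
    (hk : forall i, (1 <= i <= d)%N -> (1 <= k i)%N)
    (hMF : forall i, (1 <= i <= d)%N -> 0 < MF i)
    (hM1 : forall i, (1 <= i <= d)%N -> 0 < M1 i)
    (hA : assumptionA d sigma L) (hB : assumptionB d sigma)
    (hGamma : 0 < Gamma) (hmu : PuB Gamma mu) :
  ((forall i, (1 <= i < d)%N -> forall alpha x : R, 0 < alpha ->
      sigma i (alpha * x) = alpha * sigma i x) ->
    (rademacher n (nn_class sigma (weights_F k d MF)) mu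
     <= (Gamma * (\prod_(1 <= i < d.+1) MF i) * (\prod_(1 <= i < d) L i)
         * Num.sqrt (6 * d%:R * ln 2 + 5 * (k 1%N)%:R / 4)
         / Num.sqrt n%:R)%R%:E)%E)
  /\
  ((forall i, (1 <= i < d)%N -> sigma i 0 = 0) ->
    (rademacher n (nn_class sigma (weights_1oo k d M1)) mu
     <= (Num.sqrt 2 * Gamma * (\prod_(1 <= i < d.+1) M1 i)
         * (\prod_(1 <= i < d) L i)
         * Num.sqrt (d%:R * ln 2 + ln (k 1%N)%:R)
         / Num.sqrt n%:R)%R%:E)%E).
Proof.
case: d hd hk hMF hM1 hA hB => [//|d] hd hk hMF hM1 hA hB.
have L0 i : (1 <= i < d.+1)%N -> 0 < L i by case/hA.
have sh i : (1 <= i < d.+1)%N -> {homo sigma i : x y / x <= y} by case/hA.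
have sL i : (1 <= i < d.+1)%N -> forall x y, `|sigma i x - sigma i y| <= L i * `|x - y|.
  by case/hA => _ _ _ _ lip x y; exact: (lip (x, y)).
by split=> [sa|s0]; [exact: rademacher_F|exact: rademacher_1oo_le].
Qed.
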